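(* Let $\nu\in\mathbb R$, $A_2=\begin{pmatrix}0&\nu\\0&0\end{pmatrix}$, $J_2=\begin{pmatrix}1&0\\0&0\end{pmatrix}$ and $W(x)=e^{-x^2}e^{A_2x}e^{A_2^{T}x}$, $x\in\mathbb R$. The Hermite-type Christoffel–Darboux kernel $K_n(x,y)$ associated with $W$ can be written as $$K_n(x,y)=\frac{2}{(2\pi i)^2}e^{(x^2-y^2)/2}\int_{\mathcal I}dw\oint_\gamma dz\;z^{J_2}B_nz^{-J_2}w^{J_2}B_n^{-1}w^{-J_2}\,\frac{e^{w^2-2xw-z^2+2zy+n\log(w/z)}}{w-z},$$ where $$B_n=\begin{pmatrix}1&-\nu\\ \dfrac{n\nu}{2}&1\end{pmatrix},\qquad \det B_n=1+\frac n2\nu^2 .$$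
   Context: $T$ denotes the transpose. The matrix-valued inner product is $\langle F,G\rangle_W=\int_{\mathbb{R}}F(x)W(x)G^{T}(x)\,dx$. Let $(P_k)_{k\in\mathbb N}$ be a sequence of orthonormal matrix polynomials for $W$: $\deg P_k=k$, $\langle P_k,P_m\rangle_W=\delta_{km}I_2$. The Hermite-type Christoffel–Darboux kernel is $K_n(x,y):=\sum_{k=0}^{n-1}\Phi_k^{T}(y)\Phi_k(x)$ with $\Phi_k(x):=e^{-x^2/2}P_k(x)e^{A_2x}$ (it does not depend on the choice of orthonormal sequence). For a matrix $M$, $z^{M}:=e^{M\log z}$ with branch cut of $\log$ on the negative real axis; since $n$ is an integer, $e^{n\log(w/z)}=(w/z)^n$. The contour $\gamma$ comes from $-\infty$ below the negative real axis, goes counterclockwise around the origin, and returns to $-\infty$ above the negative real axis; $\mathcal I=L+i\mathbb R$ (oriented upwards), with $L>0$ such that $\gamma$ lies to the left of $\mathcal I$ and does not intersect it. *)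

(* Defs.v *)
From HB Require Import structures.
From mathcomp Require Import all_boot all_order all_algebra.
From mathcomp Require Import all_classical all_reals all_analysis.
Set Implicit Arguments.
Unset Strict Implicit.
Unset Printing Implicit Defensive.
Import Order.TTheory GRing.Theory Num.Theory.
Import numFieldNormedType.Exports.
From mathcomp Require Import complex.
Local Open Scope classical_set_scope.
Local Open Scope complex_scope.
Local Open Scope ring_scope.

Definition mx2 (K : nmodType) (a b c d : K) : 'M[K]_2 :=
  \matrix_(i, j) if i == ord0 then (if j == ord0 then a else b)
                 else (if j == ord0 then c else d).

Definition expmx (K : numFieldType) (m : nat) (M : 'M[K]_m.+1) : 'M[K]_m.+1 :=
  lim (series (fun k : nat => (k`!%:R : K)^-1 *: M ^+ k) @ \oo).

Section Weight.
Context {R : realType}.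
Implicit Types (nu x y : R) (W F G : R -> 'M[R]_2).

Definition mxA nu : 'M[R]_2 := mx2 0 nu 0 0.

Definition hermite_weight nu x : 'M[R]_2 :=
  expR (- x ^+ 2) *: (expmx (x *: mxA nu) *m expmx (x *: (mxA nu)^T)).

Definition mx_inner W F G : 'M[R]_2 :=
  \matrix_(i, j)
    \int[@lebesgue_measure R]_x (F x *m W x *m (G x)^T) i j.

(* A matrix polynomial is a polynomial with (left) matrix coefficients; its
   value at the real number x is its Horner value at the scalar matrix x. *)
Definition mxpoly_eval (p : {poly 'M[R]_2}) x : 'M[R]_2 := p.[x%:M].

Definition orthonormal_mxpolys W (P : nat -> {poly 'M[R]_2}) : Prop :=
  (forall k, size (P k) = k.+1) /\
  (forall k m, mx_inner W (mxpoly_eval (P k)) (mxpoly_eval (P m))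
               = (k == m)%:R%:M).

Definition hermite_fun nu (P : nat -> {poly 'M[R]_2}) (k : nat) x : 'M[R]_2 :=
  expR (- x ^+ 2 / 2) *: (mxpoly_eval (P k) x *m expmx (x *: mxA nu)).

Definition CD_kernel nu (P : nat -> {poly 'M[R]_2}) (n : nat) x y : 'M[R]_2 :=
  \sum_(k < n) (hermite_fun nu P k y)^T *m hermite_fun nu P k x.

Definition mxB (n : nat) nu : 'M[R]_2 := mx2 1 (- nu) (n%:R * nu / 2) 1.

End Weight.

Section ComplexAnalysis.
Context {R : realType}.
Implicit Types (z w : R[i]) (g : R -> R[i]) (h : R -> R).

Definition cexp z : R[i] :=
  (expR (Re z))%:C * (cos (Im z) +i* sin (Im z)).

(* Principal argument, in ]-pi, pi], and principal logarithm. *)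
Definition carg z : R :=
  let a := acos (Re z / ComplexField.Normc.normc z) in
  if 0 <= Im z then a else - a.

Definition clog z : R[i] := ln (ComplexField.Normc.normc z) +i* carg z.

Definition cpowmx z (M : 'M[R[i]]_2) : 'M[R[i]]_2 := expmx (clog z *: M).

(* Improper integral over the line, the two endpoints tending independently to
   infinity. *)
Definition improper_int h : R :=
  lim ((\int[@lebesgue_measure R]_(t in `[b, 0]) h t) @[b --> -oo]) +
  lim ((\int[@lebesgue_measure R]_(t in `[0, b]) h t) @[b --> +oo]).

Definition improper_cvg h : Prop :=
  cvg ((\int[@lebesgue_measure R]_(t in `[b, 0]) h t) @[b --> -oo]) /\
  cvg ((\int[@lebesgue_measure R]_(t in `[0, b]) h t) @[b --> +oo]).

Definition curve_deriv g (t : R) : R[i] :=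
  derive1 (fun s => Re (g s)) t +i* derive1 (fun s => Im (g s)) t.

Definition contour_int g (f : R[i] -> R[i]) : R[i] :=
  improper_int (fun t => Re (f (g t) * curve_deriv g t)) +i*
  improper_int (fun t => Im (f (g t) * curve_deriv g t)).

Definition contour_cvg g (f : R[i] -> R[i]) : Prop :=
  improper_cvg (fun t => Re (f (g t) * curve_deriv g t)) /\
  improper_cvg (fun t => Im (f (g t) * curve_deriv g t)).

Definition contour_intmx g (F : R[i] -> 'M[R[i]]_2) : 'M[R[i]]_2 :=
  \matrix_(i, j) contour_int g (fun z => F z i j).

Definition contour_cvgmx g (F : R[i] -> 'M[R[i]]_2) : Prop :=
  forall i j, contour_cvg g (fun z => F z i j).

Definition piecewise_C1 h : Prop :=
  continuous h /\ exists s : seq R,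
    (forall t, t \notin s -> derivable h t 1 /\ {for t, continuous (derive1 h)}) /\
    (forall t, t \in s -> cvg (derive1 h u @[u --> t^'-]) /\
                          cvg (derive1 h u @[u --> t^'+])).

(* A contour coming from -oo below the negative real axis and returning to -oo
   above it.  Both ends are asymptotic to the direction of the negative real
   axis (Im / Re -> 0), as needed for the convergence of integrals involving
   exp (- z^2).  The contour avoids ]-oo, 0], the branch cut of the logarithm;
   with the position of its ends this forces it to go once counterclockwise
   around the origin. *)
Definition hankel_contour g : Prop :=
  [/\ piecewise_C1 (fun t => Re (g t)) /\ piecewise_C1 (fun t => Im (g t)),
      forall t, Im (g t) = 0 -> 0 < Re (g t),
      [/\ Re (g t) @[t --> -oo] --> -oo,
          (Im (g t) / Re (g t)) @[t --> -oo] --> (0 : R)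
        & \forall t \near -oo, Im (g t) < 0]
    & [/\ Re (g t) @[t --> +oo] --> -oo,
          (Im (g t) / Re (g t)) @[t --> +oo] --> (0 : R)
        & \forall t \near +oo, 0 < Im (g t)]].

Definition vertical_line (L : R) : R -> R[i] := fun t => L +i* t.

Definition CD_integrand (n : nat) (nu x y : R) w z : 'M[R[i]]_2 :=
  let J : 'M[R[i]]_2 := mx2 1 0 0 0 in
  let B := map_mx (real_complex R) (mxB n nu) in
  (cexp (w ^+ 2 - 2 * x%:C * w - z ^+ 2 + 2 * z * y%:C
         + n%:R * clog (w / z)) / (w - z)) *:
  (cpowmx z J *m B *m cpowmx z (- J) *m
   cpowmx w J *m invmx B *m cpowmx w (- J)).

End ComplexAnalysis.

(* Main.v *)
Require Import Defs.
From mathcomp Require Import all_boot all_order all_algebra.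
From mathcomp Require Import all_classical all_reals all_analysis.
Import Order.TTheory GRing.Theory Num.Theory.
Import numFieldNormedType.Exports.
From mathcomp Require Import complex.
From mathcomp Require Import measurable_realfun ring lra.

Set Implicit Arguments.
Unset Strict Implicit.
Unset Printing Implicit Defensive.

Local Open Scope classical_set_scope.
Local Open Scope complex_scope.
Local Open Scope ring_scope.

(* Multiplying out the four matrix powers, every entry of the integrand is a
   combination of products of e^(w^2 - 2xw) w^k, e^(2zy - z^2) z^(-k) and
   (w/z)^m / (w - z).  As
     (w/z)^m / (w - z) = 1/(w - z) + \sum_(j < m) w^j / z^(j+1),
   the double integral splits into products of single ones.  The term 1/(w - z)
   integrates to 0 over gamma, the powers z^(-k) yield (by induction on k) the
   Hermite polynomials in y, and the powers w^k those in x.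

   Vanishing integrals over gamma are obtained without Cauchy's theorem: gamma is
   translated to the left by N, which changes the truncated integral only by
   endpoint terms, and N tends to infinity.  For the simple pole at 0, the
   comparison with L / (z (L - z)), whose primitive is a logarithm, gives 2 pi i.

   On the kernel side, the rows of P_k(x) e^(A x) with k < n are an orthonormal
   basis of the space of rows (p, nu x p + q) with deg p, deg q < n.  An explicit
   orthogonal basis made of Hermite polynomials produces the same four entries. *)

(** * Real integrals *)

(** The contour is an arbitrary piecewise C1 curve, known only through its ends, its position to the
    left of [L] and its avoidance of the cut, so no standard path can be substituted for it.
    Translation to the left is effective because each integrand, once its pole at 0 is removed, is
    smooth on the whole half-plane Re z < L and is O(1 / (Re z)^2) in a sector around the negative
    axis. Both ends of the curve lie in that sector, and e^(-z^2) decays there.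

    Conjugation by z^J multiplies the upper right entry of B by z and divides the lower left one by
    z. In the product of the two conjugates this leaves z/w and w/z on the diagonal, hence the
    exponents n - 1 and n + 1, and multiples of w - z off the diagonal, which cancel the pole. On
    the kernel side the same effect comes from one exceptional basis row, whose squared norm carries
    the factor det B = 1 + n nu^2 / 2.

    The order of integration is kept: for fixed w the z-integral is a polynomial in w times e^(w^2 -
    2xw). Since [lim] has a default value, every improper integral is proved convergent together
    with its value. *)

Section RealIntegrals.
Context {R : realType}.
Local Notation mu := (@lebesgue_measure R).
Implicit Types (a b c t : R) (f F : R -> R) (s : seq R).

Definition rint a b f : R := \int[mu]_(t in `[a, b]) f t.

Definition rintegrable a b f : Prop := mu.-integrable `[a, b] (EFin \o f).

Lemma rint_ftc a b f F : a <= b -> {within `[a, b], continuous f} ->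
  {within `[a, b], continuous F} ->
  (forall t, a < t < b -> is_derive t 1 F (f t)) ->
  rint a b f = F b - F a.
Proof.
rewrite le_eqVlt => /predU1P[<- _ _ _|ab cf cF dF].
  by rewrite /rint set_itv1 Rintegral_set1 subrr.
rewrite /rint /Rintegral (@continuous_FTC2 _ f F) //.
  have [h1 h2 h3] := (continuous_within_itvP _ ab).1 cF.
  by split=> // t; rewrite in_itv => /dF[].
by move=> t; rewrite in_itv => /dF[? <-]; rewrite derive1E.
Qed.

Lemma measurable_itvoo a b f g : {in `]a, b[, f =1 g} ->
  measurable_fun `[a, b] f -> measurable_fun `[a, b] g.
Proof.
move=> fg mf; apply: (@measurable_fun_itv_cc _ _ _ false true).
apply: (@eq_measurable_fun _ _ _ _ _ f).
  by move=> t; rewrite inE => /fg.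
by apply: measurable_funS mf => //; exact: subset_itv_oo_cc.
Qed.

Lemma integral_itvccoo a b (f : R -> \bar R) : measurable_fun `[a, b] f ->
  (\int[mu]_(t in `[a, b]) f t = \int[mu]_(t in `]a, b[) f t)%E.
Proof.
move=> mf; apply: integral_itv_bndoo.
by apply: measurable_funS mf => //; exact: subset_itv_oo_cc.
Qed.

Lemma rintegrable_itvoo a b f g : {in `]a, b[, f =1 g} ->
  rintegrable a b f -> rintegrable a b g.
Proof.
move=> fg /integrableP[mf fi].
have mg : measurable_fun `[a, b] (EFin \o g).
  by apply/measurable_EFinP; apply: (measurable_itvoo fg); exact/measurable_EFinP.
apply/integrableP; split=> //.
rewrite integral_itvccoo; last exact: measurableT_comp.
move: fi; rewrite integral_itvccoo; last exact: measurableT_comp.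
by under eq_integral => t /[!inE] /fg /= -> do [].
Qed.

Lemma eq_rint_itvoo a b f g : {in `]a, b[, f =1 g} ->
  rintegrable a b f -> rint a b f = rint a b g.
Proof.
move=> fg fi; have gi := rintegrable_itvoo fg fi.
rewrite /rint /Rintegral; congr fine.
rewrite integral_itvccoo; last exact: measurable_int fi.
rewrite integral_itvccoo; last exact: measurable_int gi.
by apply: eq_integral => t; rewrite inE => /fg /= ->.
Qed.

Lemma rint_cat a b c f : a <= c -> c <= b -> rintegrable a b f ->
  rint a b f = rint a c f + rint c b f.
Proof.
move=> ac cb fi; apply/eqP; rewrite addrC -subr_eq; apply/eqP.
rewrite /rint Rintegral_itvB ?bnd_simp //; apply: Rintegral_itv_obnd_cbnd.
by apply: integrableS fi => //; apply: subset_itvr; rewrite bnd_simp.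
Qed.

Lemma rintegrable_cat a b c f : a <= c -> c <= b ->
  rintegrable a c f -> rintegrable c b f -> rintegrable a b f.
Proof.
move=> ac cb f1 f2.
have E : `[a, b]%classic = `[a, c] `|` `]c, b].
  by rewrite -itv_bndbnd_setU ?bnd_simp.
have {}f2 : mu.-integrable `]c, b] (EFin \o f).
  by apply: integrableS f2 => //; apply: subset_itvr; rewrite bnd_simp.
have [/integrableP[m1 i1] /integrableP[m2 i2]] := (f1, f2).
have m : measurable_fun `[a, b] (EFin \o f).
  by rewrite E; apply/measurable_funU.
apply/integrableP; split=> //; rewrite E ge0_integral_setU //=.
- exact: lte_add_pinfty.
- rewrite -E; apply/measurable_EFinP; apply: measurableT_comp => //.
  exact/measurable_EFinP.
- apply/disj_setPS => t [/=]; rewrite !in_itv /= => /andP[_ h] /andP[].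
  by rewrite ltNge h.
Qed.

Lemma continuous_rintegrable a b f :
  {within `[a, b], continuous f} -> rintegrable a b f.
Proof.
by move=> cf; apply: continuous_compact_integrable => //; exact: segment_compact.
Qed.

(** One-sided limits are required at every point, so that any point can serve as an endpoint when an
    interval is cut at the elements of [s]. The values of [f] on [s] are unconstrained, since
    [derive1] is arbitrary at a corner. *)
Definition pcontinuous s f : Prop :=
  (forall t, t \notin s -> {for t, continuous f}) /\
  (forall t, cvg (f u @[u --> t^'-]) /\ cvg (f u @[u --> t^'+])).

(** Replacing the endpoint values by one-sided limits gives continuity on the closed interval. Only
    the open interval counts for the integral. *)
Lemma within_continuous_modif a b f : a < b ->
  {in `]a, b[, continuous f} ->
  cvg (f u @[u --> a^'+]) -> cvg (f u @[u --> b^'-]) ->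
  exists2 g, {within `[a, b], continuous g} & {in `]a, b[, g =1 f}.
Proof.
move=> ab cf fa fb.
pose g t := if t <= a then lim (f u @[u --> a^'+]) else
  if b <= t then lim (f u @[u --> b^'-]) else f t.
have gf t : a < t -> t < b -> g t = f t.
  by move=> h1 h2; rewrite /g leNgt h1 leNgt h2.
exists g; last by move=> t; rewrite in_itv => /andP[]; exact: gf.
apply/(continuous_within_itvP _ ab); split.
- move=> t tab; move: (tab); rewrite in_itv => /andP[h1 h2].
  rewrite /continuous_at gf //; apply: cvg_trans (cf t tab).
  apply: near_eq_cvg; near=> u; rewrite gf //; near: u.
    exact: lt_nbhsr.
  exact: lt_nbhsl.
- rewrite {2}/g lexx; apply: cvg_trans fa.
  apply: near_eq_cvg; near=> u; rewrite gf //; near: u;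
    first [exact: nbhs_right_gt|exact: nbhs_right_lt].
- rewrite {2}/g leNgt ab /= lexx; apply: cvg_trans fb.
  apply: near_eq_cvg; near=> u; rewrite gf //; near: u;
    first [exact: nbhs_left_gt|exact: nbhs_left_lt].
Unshelve. all: by end_near. Qed.

(** Induction on the list of break points with the interval generalised: a break point inside []a,
    b[] cuts the interval in two, one outside is dropped from the list. Continuity is therefore
    first weakened to the points of []a, b[]. *)
Lemma pcontinuous_rintegrable s f a b : pcontinuous s f -> rintegrable a b f.
Proof.
move=> [cf lf]; have {}cf t : a < t < b -> t \notin s -> {for t, continuous f}.
  by move=> _; exact: cf.
elim: s a b cf => [|c s IH] a b cf.
  have [ab|ba] := ltP a b; last first.
    apply: (@rintegrable_itvoo _ _ (cst 0)).
      move=> t; rewrite in_itv => /andP[h1 h2].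
      by move: (lt_trans h1 h2); rewrite ltNge ba.
    by apply: continuous_rintegrable; apply: continuous_subspaceT => t; exact: cvg_cst.
  have [|g cg gf] := @within_continuous_modif a b f ab _ (lf a).2 (lf b).1.
    by move=> t; rewrite in_itv => h; exact: cf.
  exact: rintegrable_itvoo gf (continuous_rintegrable cg).
have [/andP[ac cb]|nc] := boolP (a < c < b).
  apply: (rintegrable_cat (ltW ac) (ltW cb)); apply: IH => t /andP[h1 h2] ts.
    apply: cf; first by rewrite h1 (lt_trans h2).
    by rewrite inE negb_or ts lt_eqF.
  apply: cf; first by rewrite h2 (lt_trans ac).
  by rewrite inE negb_or ts gt_eqF.
apply: IH => t h ts; apply: cf => //; rewrite inE negb_or ts andbT.
by apply/eqP => E; move: nc; rewrite -E h.
Qed.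

(** Same induction as for integrability. Continuity of [F] across the break points makes the
    increments over the pieces telescope. *)
Lemma pcontinuous_ftc s f F a b : a <= b -> pcontinuous s f -> continuous F ->
  (forall t, t \notin s -> is_derive t 1 F (f t)) -> rint a b f = F b - F a.
Proof.
move=> ab pf cF dF.
have {}dF t : a < t < b -> t \notin s -> is_derive t 1 F (f t).
  by move=> _; exact: dF.
have fi a' b' := pcontinuous_rintegrable a' b' pf.
have [+ lf] := pf => cf.
have {pf}cf t : a < t < b -> t \notin s -> {for t, continuous f}.
  by move=> _; exact: cf.
elim: s a b ab dF cf => [|c s IH] a b.
  rewrite le_eqVlt => /predU1P[<- _ _|ab dF cf].
    by rewrite /rint set_itv1 Rintegral_set1 subrr.
  have [|g cg gf] := @within_continuous_modif a b f ab _ (lf a).2 (lf b).1.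
    by move=> t; rewrite in_itv => h; exact: cf.
  rewrite -(eq_rint_itvoo gf); last exact: continuous_rintegrable.
  apply: rint_ftc => //; [exact: ltW|exact: continuous_subspaceT|].
  by move=> t h; rewrite gf ?in_itv //; exact: dF.
move=> ab dF cf.
have [/andP[ac cb]|nc] := boolP (a < c < b).
  have -> : rint a b f = rint a c f + rint c b f by apply: rint_cat => //; exact: ltW.
  have -> : rint a c f = F c - F a.
    apply: IH (ltW ac) _ _ => t /andP[h1 h2] ts; [apply: dF|apply: cf];
      rewrite ?h1 ?(lt_trans h2) //; by rewrite inE negb_or ts lt_eqF.
  have -> : rint c b f = F b - F c.
    apply: IH (ltW cb) _ _ => t /andP[h1 h2] ts; [apply: dF|apply: cf];
      rewrite ?h2 ?(lt_trans ac) //; by rewrite inE negb_or ts gt_eqF.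
  by rewrite addrC addrA subrK.
have nt t : a < t < b -> t \notin s -> t \notin c :: s.
  move=> h ts; rewrite inE negb_or ts andbT.
  by apply/eqP => E; move: nc; rewrite -E h.
by apply: IH => // t h ts; [apply: dF|apply: cf] => //; exact: nt.
Qed.

Lemma continuous_rint_param (f : R -> R -> R) a b u v M :
  (forall x, u < x < v -> {within `[a, b], continuous (f x)}) ->
  (forall t x, a <= t <= b -> u < x < v -> {for x, continuous (f ^~ t)}) ->
  (forall x t, u < x < v -> a <= t <= b -> `|f x t| <= M) ->
  forall x, u < x < v -> {for x, continuous (fun x => rint a b (f x))}.
Proof.
move=> cf cx fM x xuv.
apply: (@continuity_under_integral R _ _ mu f `[a, b] _ u v _ _ (cst M)).
- by [].
- by move=> z /=; rewrite in_itv => /cf /continuous_rintegrable.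
- by apply: aeW => t /=; rewrite in_itv => h z; rewrite inE /= in_itv => /(cx _ _ h).
- by apply: continuous_rintegrable; apply: continuous_subspaceT => t; exact: cvg_cst.
- by move=> z /=; rewrite in_itv => h; apply: aeW => t /=; rewrite in_itv; exact: fM.
- by rewrite inE /= in_itv.
Qed.

Lemma is_derive_rint_param (f f' : R -> R -> R) a b u v M :
  (forall x, u < x < v -> {within `[a, b], continuous (f x)}) ->
  (forall t x, a <= t <= b -> u < x < v -> is_derive x 1 (f ^~ t) (f' x t)) ->
  (forall x t, u < x < v -> a <= t <= b -> `|f' x t| <= M) ->
  forall x, u < x < v ->
    is_derive x 1 (fun x => rint a b (f x)) (rint a b (f' x)).
Proof.
move=> cf df fM x xuv.
have fi z : `]u, v[%classic z -> mu.-integrable `[a, b] (EFin \o f z).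
  by rewrite /= in_itv => /cf /continuous_rintegrable.
have dd z t : `]u, v[%classic z -> `[a, b]%classic t -> derivable (f ^~ t) z 1.
  by rewrite /= !in_itv => h1 h2; have [] := df t z h2 h1.
have M0 (y : R) : 0 <= `|M| by [].
have Mi : mu.-integrable `[a, b] (EFin \o fun=> `|M|).
  by apply: continuous_rintegrable; apply: continuous_subspaceT => t; exact: cvg_cst.
have db z t : `]u, v[%classic z -> `[a, b]%classic t -> `|partial1of2 f z t| <= `|M|.
  rewrite /= !in_itv => h1 h2; rewrite partial1of2E.
  have [_ ->] := df t z h2 h1.
  by apply: le_trans (ler_norm M); exact: fM.
have xI : `]u, v[%classic x by rewrite /= in_itv.
have mab : measurable (`[a, b]%classic : set R) by [].
split.
  exact: (@derivable_under_integral R _ _ mu f _ mab x u v xI fi dd _ M0 Mi db).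
rewrite -derive1E.
apply: etrans (@differentiation_under_integral R _ _ mu f _ mab x u v xI fi dd _ M0 Mi db) _.
apply: eq_Rintegral => t; rewrite inE /= in_itv => h; rewrite partial1of2E.
by have [_ ->] := df t x h xuv.
Qed.

End RealIntegrals.

(** * Calculus along curves in the complex plane *)

Section ComplexCurves.
Context {R : realType}.
Implicit Types (a b t u v x y M : R) (z w d e : R[i]) (c f g : R -> R[i]).

Local Notation normc := (@ComplexField.Normc.normc R).

Lemma ReD z w : Re (z + w) = Re z + Re w. Proof. by case: z w => ? ? []. Qed.
Lemma ImD z w : Im (z + w) = Im z + Im w. Proof. by case: z w => ? ? []. Qed.
Lemma ReN z : Re (- z) = - Re z. Proof. by case: z. Qed.
Lemma ImN z : Im (- z) = - Im z. Proof. by case: z. Qed.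
Lemma ReM z w : Re (z * w) = Re z * Re w - Im z * Im w.
Proof. by case: z w => ? ? []. Qed.
Lemma ImM z w : Im (z * w) = Re z * Im w + Im z * Re w.
Proof. by case: z w => ? ? []. Qed.
Lemma ReV z : Re z^-1 = Re z / (Re z ^+ 2 + Im z ^+ 2).
Proof. by case: z. Qed.
Lemma ImV z : Im z^-1 = - Im z / (Re z ^+ 2 + Im z ^+ 2).
Proof. by case: z => a b; rewrite mulNr. Qed.
Definition ReImE := (ReD, ImD, ReN, ImN, ReM, ImM).

Lemma complex_ext z w : Re z = Re w -> Im z = Im w -> z = w.
Proof. by case: z w => ? ? [? ?] /= -> ->. Qed.

Lemma normc_sqr z : normc z ^+ 2 = Re z ^+ 2 + Im z ^+ 2.
Proof. by case: z => a b /=; rewrite sqr_sqrtr // addr_ge0 ?sqr_ge0. Qed.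

Lemma normc_ge0 z : 0 <= normc z.
Proof. by case: z => a b; exact: sqrtr_ge0. Qed.

Lemma normr_Re_le z : `|Re z| <= normc z.
Proof.
rewrite -(ler_pXn2r (ltn0Sn 1)) ?nnegrE ?normc_ge0 // normc_sqr real_normK ?num_real //.
by rewrite lerDl sqr_ge0.
Qed.

Lemma normr_Im_le z : `|Im z| <= normc z.
Proof.
rewrite -(ler_pXn2r (ltn0Sn 1)) ?nnegrE ?normc_ge0 // normc_sqr real_normK ?num_real //.
by rewrite lerDr sqr_ge0.
Qed.

Lemma normc_le_ReIm z : normc z <= `|Re z| + `|Im z|.
Proof.
rewrite -(ler_pXn2r (ltn0Sn 1)) ?nnegrE ?normc_ge0 ?addr_ge0 // normc_sqr.
rewrite sqrrD !real_normK ?num_real // addrAC lerDl.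
by rewrite mulrn_wge0 // mulr_ge0.
Qed.

Lemma normcX z n : normc (z ^+ n) = normc z ^+ n.
Proof.
elim: n => [|n IH]; first by rewrite !expr0 ComplexField.Normc.normc1.
by rewrite !exprS ComplexField.Normc.normcM IH.
Qed.

Lemma normc_real x : normc x%:C = `|x|.
Proof. by rewrite /= expr0n addr0 sqrtr_sqr. Qed.

Lemma normc_eq0 z : (normc z == 0) = (z == 0).
Proof.
by apply/eqP/eqP => [/ComplexField.Normc.eq0_normc //|->]; exact: ComplexField.Normc.normc0.
Qed.

Lemma normc_gt0 z : (0 < normc z) = (z != 0).
Proof. by rewrite lt0r normc_eq0 normc_ge0 andbT. Qed.

Lemma le_normcB z w : normc (z - w) <= normc z + normc w.
Proof. by rewrite (le_trans (le_normcD _ _)) // normcN. Qed.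

Lemma sqrD_neq0 z : z != 0 -> Re z ^+ 2 + Im z ^+ 2 != 0.
Proof. by move=> z0; rewrite -normc_sqr sqrf_eq0 normc_eq0. Qed.

Lemma is_derive_continuous_at (h : R -> R) t x :
  is_derive t 1 h x -> {for t, continuous h}.
Proof.
by move=> [dh _]; apply: differentiable_continuous; exact/derivable1_diffP.
Qed.

(** Curves have a real parameter, so real and imaginary parts are differentiated separately and real
    calculus applies to each. This matches [curve_deriv] and [contour_int]. *)
Definition is_cder c t d : Prop :=
  is_derive t 1 (fun u => Re (c u)) (Re d) /\
  is_derive t 1 (fun u => Im (c u)) (Im d).

Definition ccont c t : Prop :=
  {for t, continuous (fun u => Re (c u))} /\
  {for t, continuous (fun u => Im (c u))}.

Lemma is_cder_ccont c t d : is_cder c t d -> ccont c t.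
Proof.
by move=> [h1 h2]; split; exact: is_derive_continuous_at.
Qed.

Lemma is_cder_eq c t d e : is_cder c t d -> d = e -> is_cder c t e.
Proof. by move=> h <-. Qed.

Lemma is_cder_cst z t : is_cder (fun=> z) t 0.
Proof. by split; exact: is_derive_cst. Qed.

Lemma is_cder_addi z w t : is_cder (fun u => z + u%:C * w) t w.
Proof.
split.
- rewrite (_ : (fun u => _) = cst (Re z) + (Re w \*: id)).
    apply: (is_derive_eq (is_deriveD (is_derive_cst _ _ _) (is_deriveZ _ (is_derive_id _ _)))).
    by rewrite add0r scaler1.
  by apply/funext => u; rewrite !ReImE /= mul0r subr0 mulrC.
- rewrite (_ : (fun u => _) = cst (Im z) + (Im w \*: id)).
    apply: (is_derive_eq (is_deriveD (is_derive_cst _ _ _) (is_deriveZ _ (is_derive_id _ _)))).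
    by rewrite add0r scaler1.
  by apply/funext => u; rewrite !ReImE /= mul0r addr0 mulrC.
Qed.

Lemma is_cderD c f t d e : is_cder c t d -> is_cder f t e ->
  is_cder (fun u => c u + f u) t (d + e).
Proof.
move=> [h1 h2] [h3 h4]; split; rewrite ReImE.
- rewrite (_ : (fun u => _) = (fun u => Re (c u)) + (fun u => Re (f u))).
    exact: is_deriveD.
  by apply/funext => u; rewrite ReImE.
- rewrite (_ : (fun u => _) = (fun u => Im (c u)) + (fun u => Im (f u))).
    exact: is_deriveD.
  by apply/funext => u; rewrite ReImE.
Qed.

Lemma is_cderM c f t d e : is_cder c t d -> is_cder f t e ->
  is_cder (fun u => c u * f u) t (d * f t + c t * e).
Proof.
move=> [h1 h2] [h3 h4]; split; rewrite !ReImE.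
- rewrite (_ : (fun u => _) = (fun u => Re (c u)) * (fun u => Re (f u)) -
     (fun u => Im (c u)) * (fun u => Im (f u))).
    apply: (is_derive_eq (is_deriveB (is_deriveM h1 h3) (is_deriveM h2 h4))).
    by rewrite /GRing.scale /=; ring.
  by apply/funext => u; rewrite ReImE.
- rewrite (_ : (fun u => _) = (fun u => Re (c u)) * (fun u => Im (f u)) +
     (fun u => Im (c u)) * (fun u => Re (f u))).
    apply: (is_derive_eq (is_deriveD (is_deriveM h1 h4) (is_deriveM h2 h3))).
    by rewrite /GRing.scale /=; ring.
  by apply/funext => u; rewrite ReImE.
Qed.

Lemma is_cderZ z c t d : is_cder c t d -> is_cder (fun u => z * c u) t (z * d).
Proof.
by move=> h; apply: is_cder_eq (is_cderM (is_cder_cst z t) h) _; rewrite mul0r add0r.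
Qed.

Lemma is_cderN c t d : is_cder c t d -> is_cder (fun u => - c u) t (- d).
Proof.
move=> h; rewrite (_ : (fun u => _) = (fun u => (- 1) * c u)).
  by apply: is_cder_eq (is_cderZ (- 1) h) _; rewrite mulN1r.
by apply/funext => u; rewrite mulN1r.
Qed.

Lemma is_cderB c f t d e : is_cder c t d -> is_cder f t e ->
  is_cder (fun u => c u - f u) t (d - e).
Proof. by move=> h1 h2; apply: is_cderD => //; exact: is_cderN. Qed.

Lemma is_cderX c t d n : is_cder c t d ->
  is_cder (fun u => c u ^+ n) t (n%:R * c t ^+ n.-1 * d).
Proof.
move=> h; elim: n => [|n IH].
  by rewrite !mul0r; exact: is_cder_cst.
rewrite (_ : (fun u => _) = (fun u => c u * c u ^+ n)); last first.
  by apply/funext => u; rewrite exprS.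
apply: is_cder_eq (is_cderM h IH) _.
by case: n {IH} => [|n] /=; rewrite ?expr0 ?exprS -?(natr1 n.+1); ring.
Qed.

Lemma is_cderV c t d : c t != 0 -> is_cder c t d ->
  is_cder (fun u => (c u)^-1) t (- d / c t ^+ 2).
Proof.
move=> c0 [h1 h2].
pose N u := Re (c u) ^+ 2 + Im (c u) ^+ 2.
have N0 : N t != 0 by exact: sqrD_neq0.
have hN : is_derive t 1 N (2 * (Re (c t) * Re d + Im (c t) * Im d)).
  rewrite (_ : N = (fun u => Re (c u)) * (fun u => Re (c u)) +
     (fun u => Im (c u)) * (fun u => Im (c u))); last first.
    by apply/funext => u; rewrite /N !expr2.
  apply: (is_derive_eq (is_deriveD (is_deriveM h1 h1) (is_deriveM h2 h2))).
  by rewrite /GRing.scale /=; ring.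
have hV : is_derive t 1 (fun u => (N u)^-1)
    (- (2 * (Re (c t) * Re d + Im (c t) * Im d)) / N t ^+ 2).
  apply: is_derive_eq (is_deriveV N0 hN) _.
  by rewrite /GRing.scale /= mulrC mulrN mulNr.
have e1 : Re (- d / c t ^+ 2) = Re d * (N t)^-1 -
   Re (c t) * (2 * (Re (c t) * Re d + Im (c t) * Im d) / N t ^+ 2).
  have N2 : Re (c t ^+ 2) ^+ 2 + Im (c t ^+ 2) ^+ 2 = N t ^+ 2.
    by rewrite /N expr2 !ReImE; ring.
  rewrite !ReImE ReV ImV N2 expr2 !ReImE /N.
  by move: N0; rewrite /N => N0; field.
have e2 : Im (- d / c t ^+ 2) = - Im d * (N t)^-1 +
   Im (c t) * (2 * (Re (c t) * Re d + Im (c t) * Im d) / N t ^+ 2).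
  have N2 : Re (c t ^+ 2) ^+ 2 + Im (c t ^+ 2) ^+ 2 = N t ^+ 2.
    by rewrite /N expr2 !ReImE; ring.
  rewrite !ReImE ReV ImV N2 expr2 !ReImE /N.
  by move: N0; rewrite /N => N0; field.
split.
- rewrite (_ : (fun u => _) = (fun u => Re (c u)) * (fun u => (N u)^-1)).
    apply: (is_derive_eq (is_deriveM h1 hV)).
    by rewrite e1 /GRing.scale /=; ring.
  by apply/funext => u; rewrite ReV.
- rewrite (_ : (fun u => _) = - ((fun u => Im (c u)) * (fun u => (N u)^-1))).
    apply: (is_derive_eq (is_deriveN (is_deriveM h2 hV))).
    by rewrite e2 /GRing.scale /=; ring.
  by apply/funext => u; rewrite ImV mulNr.
Qed.

Lemma normc_cexp z : normc (cexp z) = expR (Re z).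
Proof.
rewrite /cexp ComplexField.Normc.normcM normc_real ger0_norm ?expR_ge0 //=.
by rewrite cos2Dsin2 sqrtr1 mulr1.
Qed.

Lemma cexp_neq0 z : cexp z != 0.
Proof. by rewrite -normc_gt0 normc_cexp expR_gt0. Qed.

Lemma cexpD z w : cexp (z + w) = cexp z * cexp w.
Proof.
rewrite /cexp !ReImE expRD cosD sinD.
by apply: complex_ext; rewrite !ReImE /=; ring.
Qed.

Lemma cexp_real x : cexp x%:C = (expR x)%:C.
Proof. by rewrite /cexp /= cos0 sin0 mulr1. Qed.

Lemma cexp0 : cexp (0 : R[i]) = 1.
Proof. by rewrite cexp_real expR0. Qed.

Lemma cexpMn n z : cexp (n%:R * z) = cexp z ^+ n.
Proof.
elim: n => [|n IH]; first by rewrite mul0r cexp0.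
by rewrite -natr1 mulrDl mul1r cexpD IH exprSr.
Qed.

Lemma cexpN z : cexp (- z) = (cexp z)^-1.
Proof.
apply: (mulIf (cexp_neq0 z)); rewrite -cexpD addNr cexp0 mulVf //.
exact: cexp_neq0.
Qed.

Lemma is_cder_cexp c t d : is_cder c t d ->
  is_cder (fun u => cexp (c u)) t (cexp (c t) * d).
Proof.
move=> [h1 h2].
have hE : is_derive t 1 (fun u => expR (Re (c u))) (expR (Re (c t)) * Re d).
  by rewrite (_ : (fun u => _) = expR \o (fun u => Re (c u))) //; exact: is_derive1_comp.
have hC : is_derive t 1 (fun u => cos (Im (c u))) (- sin (Im (c t)) * Im d).
  by rewrite (_ : (fun u => _) = cos \o (fun u => Im (c u))) //; exact: is_derive1_comp.
have hS : is_derive t 1 (fun u => sin (Im (c u))) (cos (Im (c t)) * Im d).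
  by rewrite (_ : (fun u => _) = sin \o (fun u => Im (c u))) //; exact: is_derive1_comp.
split.
- rewrite (_ : (fun u => _) = (fun u => expR (Re (c u))) * (fun u => cos (Im (c u)))).
    apply: (is_derive_eq (is_deriveM hE hC)).
    by rewrite !ReImE /GRing.scale /=; ring.
  by apply/funext => u; rewrite /= mul0r subr0.
- rewrite (_ : (fun u => _) = (fun u => expR (Re (c u))) * (fun u => sin (Im (c u)))).
    apply: (is_derive_eq (is_deriveM hE hS)).
    by rewrite !ReImE /GRing.scale /=; ring.
  by apply/funext => u; rewrite /= mul0r addr0.
Qed.

Lemma eq_continuous_at (k h : R -> R) t : k =1 h ->
  {for t, continuous h} -> {for t, continuous k}.
Proof. by move=> /funext ->. Qed.

Lemma ccont_cst z t : ccont (fun=> z) t.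
Proof. by split; exact: cvg_cst. Qed.

Lemma ccontD c f t : ccont c t -> ccont f t -> ccont (fun u => c u + f u) t.
Proof.
move=> [h1 h2] [h3 h4]; split.
- apply: eq_continuous_at => [u|]; [by rewrite ReImE|]; exact: continuousD.
- apply: eq_continuous_at => [u|]; [by rewrite ReImE|]; exact: continuousD.
Qed.

Lemma ccontM c f t : ccont c t -> ccont f t -> ccont (fun u => c u * f u) t.
Proof.
move=> [h1 h2] [h3 h4]; split.
- apply: eq_continuous_at => [u|]; [by rewrite ReImE|]; apply: continuousB; exact: continuousM.
- apply: eq_continuous_at => [u|]; [by rewrite ReImE|]; apply: continuousD; exact: continuousM.
Qed.

Lemma ccontN c t : ccont c t -> ccont (fun u => - c u) t.
Proof.
move=> [h1 h2]; split.
- apply: eq_continuous_at => [u|]; [by rewrite ReImE|]; exact: continuousN.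
- apply: eq_continuous_at => [u|]; [by rewrite ReImE|]; exact: continuousN.
Qed.

Lemma ccontB c f t : ccont c t -> ccont f t -> ccont (fun u => c u - f u) t.
Proof. by move=> h1 h2; apply: ccontD => //; exact: ccontN. Qed.

Lemma ccontX c t n : ccont c t -> ccont (fun u => c u ^+ n) t.
Proof.
move=> h; elim: n => [|n IH]; first exact: ccont_cst.
rewrite (_ : (fun u => _) = (fun u => c u * c u ^+ n)); first exact: ccontM.
by apply/funext => u; rewrite exprS.
Qed.

Lemma ccontV c t : c t != 0 -> ccont c t -> ccont (fun u => (c u)^-1) t.
Proof.
move=> c0 [h1 h2].
have hV : {for t, continuous (fun u => (Re (c u) ^+ 2 + Im (c u) ^+ 2)^-1)}.
  apply: continuousV; first exact: sqrD_neq0.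
  by apply: continuousD; exact: continuousM.
split.
- apply: eq_continuous_at => [u|]; [by rewrite ReV|]; exact: continuousM.
- apply: eq_continuous_at => [u|]; [by rewrite ImV|]; apply: continuousM => //; exact: continuousN.
Qed.

Lemma ccont_cexp c t : ccont c t -> ccont (fun u => cexp (c u)) t.
Proof.
move=> [h1 h2].
have hE : {for t, continuous (fun u => expR (Re (c u)))}.
  by apply: continuous_comp => //; exact: continuous_expR.
have hC : {for t, continuous (fun u => cos (Im (c u)))}.
  by apply: continuous_comp => //; exact: continuous_cos.
have hS : {for t, continuous (fun u => sin (Im (c u)))}.
  by apply: continuous_comp => //; exact: continuous_sin.
split.
- apply: eq_continuous_at => [u|]; [by rewrite /cexp !ReImE /= mul0r subr0|]; exact: continuousM.
- apply: eq_continuous_at => [u|]; [by rewrite /cexp !ReImE /= mul0r addr0|]; exact: continuousM.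
Qed.

End ComplexCurves.

(** * Complex-valued integrals over intervals and over the line *)

Section ComplexIntegrals.
Context {R : realType}.
Implicit Types (a b t u v x y M : R) (z w d e : R[i]) (c f g : R -> R[i]).
Local Notation normc := (@ComplexField.Normc.normc R).

Definition cint a b f : R[i] :=
  rint a b (fun t => Re (f t)) +i* rint a b (fun t => Im (f t)).

Definition cintegrable a b f : Prop :=
  rintegrable a b (fun t => Re (f t)) /\ rintegrable a b (fun t => Im (f t)).

Definition pccont (s : seq R) f : Prop :=
  pcontinuous s (fun t => Re (f t)) /\ pcontinuous s (fun t => Im (f t)).

Lemma cvg_at_lr (h : R -> R) t : {for t, continuous h} ->
  cvg (h x @[x --> t^'-]) /\ cvg (h x @[x --> t^'+]).
Proof.
by move=> ht; split; apply/cvg_ex; exists (h t);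
  [exact: cvg_at_left_filter|exact: cvg_at_right_filter].
Qed.

Lemma ccont_pccont s f : (forall t, ccont f t) -> pccont s f.
Proof.
move=> cf; split; split=> t; first by move=> _; case: (cf t).
- by apply: cvg_at_lr; case: (cf t).
- by move=> _; case: (cf t).
- by apply: cvg_at_lr; case: (cf t).
Qed.

Lemma pcontinuousD s (h k : R -> R) : pcontinuous s h -> pcontinuous s k ->
  pcontinuous s (fun t => h t + k t).
Proof.
move=> [h1 h2] [k1 k2]; split=> t; first by move=> ts; apply: continuousD; auto.
by split; apply: is_cvgD; case: (h2 t); case: (k2 t).
Qed.

Lemma pcontinuousN s (h : R -> R) : pcontinuous s h ->
  pcontinuous s (fun t => - h t).
Proof.
move=> [h1 h2]; split=> t; first by move=> ts; apply: continuousN; auto.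
by split; apply: is_cvgN; case: (h2 t).
Qed.

Lemma pcontinuousM s (h k : R -> R) : pcontinuous s h -> pcontinuous s k ->
  pcontinuous s (fun t => h t * k t).
Proof.
move=> [h1 h2] [k1 k2]; split=> t; first by move=> ts; apply: continuousM; auto.
by split; apply: is_cvgM; case: (h2 t); case: (k2 t).
Qed.

Lemma pccontM s c f : pccont s c -> pccont s f -> pccont s (fun t => c t * f t).
Proof.
move=> [h1 h2] [h3 h4]; split.
- under eq_fun do rewrite ReM.
  by apply: pcontinuousD; [|apply: pcontinuousN]; exact: pcontinuousM.
- under eq_fun do rewrite ImM.
  by apply: pcontinuousD; exact: pcontinuousM.
Qed.

Lemma pccont_cintegrable s f a b : pccont s f -> cintegrable a b f.
Proof.
by move=> [h1 h2]; split; [exact: pcontinuous_rintegrable h1|exact: pcontinuous_rintegrable h2].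
Qed.

Lemma within_ccont a b f : (forall t, a <= t <= b -> ccont f t) ->
  {within `[a, b], continuous (fun t => Re (f t))} /\
  {within `[a, b], continuous (fun t => Im (f t))}.
Proof.
by move=> cf; split; apply: continuous_in_subspaceT => t;
  rewrite inE /= in_itv => /cf [].
Qed.

Lemma ccont_cintegrable a b f : (forall t, a <= t <= b -> ccont f t) ->
  cintegrable a b f.
Proof. by move=> /within_ccont[h1 h2]; split; exact: continuous_rintegrable. Qed.

Lemma cint_ftc a b f g : a <= b -> (forall t, a <= t <= b -> ccont f t) ->
  (forall t, a <= t <= b -> is_cder g t (f t)) -> cint a b f = g b - g a.
Proof.
move=> ab cf dg; have [f1 f2] := within_ccont cf.
have cg t : a <= t <= b -> ccont g t by move=> /dg /is_cder_ccont.
have [g1 g2] := within_ccont cg.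
have ltab t : a < t < b -> a <= t <= b by move=> /andP[h1 h2]; rewrite !ltW.
apply: complex_ext; rewrite !ReImE /=.
- by apply: (rint_ftc (F := fun t => Re (g t))) => // t /ltab /dg[].
- by apply: (rint_ftc (F := fun t => Im (g t))) => // t /ltab /dg[].
Qed.

Lemma cint_pcftc s a b f g : a <= b -> pccont s f -> (forall t, ccont g t) ->
  (forall t, t \notin s -> is_cder g t (f t)) -> cint a b f = g b - g a.
Proof.
move=> ab [f1 f2] cg dg.
apply: complex_ext; rewrite !ReImE /=.
- apply: (pcontinuous_ftc (F := fun t => Re (g t)) ab f1).
    by move=> t; case: (cg t).
  by move=> t /dg[].
- apply: (pcontinuous_ftc (F := fun t => Im (g t)) ab f2).
    by move=> t; case: (cg t).
  by move=> t /dg[].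
Qed.

Lemma cint_cat a b x f : a <= x -> x <= b -> cintegrable a b f ->
  cint a b f = cint a x f + cint x b f.
Proof.
move=> ax xb [f1 f2].
by apply: complex_ext; rewrite !ReImE /=; exact: rint_cat.
Qed.

Lemma rintD a b (h k : R -> R) : rintegrable a b h -> rintegrable a b k ->
  rint a b (fun t => h t + k t) = rint a b h + rint a b k.
Proof. by move=> h1 h2; exact: RintegralD. Qed.

Lemma rintZ a b x (h : R -> R) : rintegrable a b h ->
  rint a b (fun t => x * h t) = x * rint a b h.
Proof. by move=> h1; exact: RintegralZl. Qed.

Lemma rintegrableD a b (h k : R -> R) : rintegrable a b h -> rintegrable a b k ->
  rintegrable a b (fun t => h t + k t).
Proof.
move=> h1 h2; rewrite /rintegrable.
rewrite (_ : _ \o _ = (EFin \o h) \+ (EFin \o k))%E; last by apply/funext.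
exact: integrableD.
Qed.

Lemma rintegrableZ a b x (h : R -> R) : rintegrable a b h ->
  rintegrable a b (fun t => x * h t).
Proof.
move=> h1; rewrite /rintegrable.
rewrite (_ : _ \o _ = fun t => (x%:E * (h t)%:E)%E); last by apply/funext.
exact: integrableZl.
Qed.

Lemma rintegrable_norm a b (h : R -> R) : rintegrable a b h ->
  rintegrable a b (fun t => `|h t|).
Proof. by move=> h1; exact: (integrable_abse h1). Qed.

Lemma cintegrableD a b c f : cintegrable a b c -> cintegrable a b f ->
  cintegrable a b (fun t => c t + f t).
Proof.
move=> [h1 h2] [h3 h4]; split.
- by under eq_fun do rewrite ReD; exact: rintegrableD.
- by under eq_fun do rewrite ImD; exact: rintegrableD.
Qed.

Lemma cintegrableZ a b z f : cintegrable a b f ->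
  cintegrable a b (fun t => z * f t).
Proof.
move=> [h1 h2]; split.
- under eq_fun do rewrite ReM -mulNr.
  by apply: rintegrableD; exact: rintegrableZ.
- under eq_fun do rewrite ImM.
  by apply: rintegrableD; exact: rintegrableZ.
Qed.

Lemma cintD a b c f : cintegrable a b c -> cintegrable a b f ->
  cint a b (fun t => c t + f t) = cint a b c + cint a b f.
Proof.
move=> [h1 h2] [h3 h4]; apply: complex_ext; rewrite !ReImE /=.
- by under eq_fun do rewrite ReD; exact: rintD.
- by under eq_fun do rewrite ImD; exact: rintD.
Qed.

Lemma cintZ a b z f : cintegrable a b f ->
  cint a b (fun t => z * f t) = z * cint a b f.
Proof.
move=> [h1 h2]; apply: complex_ext; rewrite !ReImE /=.
- under eq_fun do rewrite ReM -mulNr.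
  by rewrite rintD ?rintZ ?mulNr //; exact: rintegrableZ.
- under eq_fun do rewrite ImM.
  by rewrite rintD ?rintZ //; exact: rintegrableZ.
Qed.

Lemma normr_rint_le a b (h k : R -> R) : rintegrable a b h -> rintegrable a b k ->
  (forall t, a <= t <= b -> `|h t| <= k t) -> `|rint a b h| <= rint a b k.
Proof.
move=> h1 k1 hk; apply: (le_trans (le_normr_Rintegral _ h1)) => //.
by apply: le_Rintegral => //; exact: rintegrable_norm.
Qed.

(** The real and the imaginary part are each bounded by the integral of [k]; the resulting factor 2
    is harmless, as the bound is only used for convergence. *)
Lemma normc_cint_le a b f (k : R -> R) : cintegrable a b f -> rintegrable a b k ->
  (forall t, a <= t <= b -> normc (f t) <= k t) ->
  normc (cint a b f) <= 2 * rint a b k.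
Proof.
move=> [h1 h2] k1 fk; rewrite (le_trans (normc_le_ReIm _)) //= mulr_natl mulr2n.
apply: lerD; apply: normr_rint_le => // t /fk; apply: le_trans.
  exact: normr_Re_le.
exact: normr_Im_le.
Qed.

Lemma ccont_cint_param (f : R -> R -> R[i]) a b u v M :
  (forall x t, u < x < v -> a <= t <= b -> ccont (f x) t) ->
  (forall t x, a <= t <= b -> u < x < v -> ccont (f ^~ t) x) ->
  (forall x t, u < x < v -> a <= t <= b -> normc (f x t) <= M) ->
  forall x, u < x < v -> ccont (fun x => cint a b (f x)) x.
Proof.
move=> cf cx fM x xuv; split.
- apply: (@continuous_rint_param R (fun x t => Re (f x t)) a b u v M) => //.
  + by move=> y yuv; have [] := within_ccont (fun t => cf y t yuv).
  + by move=> t y tab yuv; have [] := cx t y tab yuv.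
  + by move=> y t yuv tab; apply: le_trans (fM y t yuv tab); exact: normr_Re_le.
- apply: (@continuous_rint_param R (fun x t => Im (f x t)) a b u v M) => //.
  + by move=> y yuv; have [] := within_ccont (fun t => cf y t yuv).
  + by move=> t y tab yuv; have [] := cx t y tab yuv.
  + by move=> y t yuv tab; apply: le_trans (fM y t yuv tab); exact: normr_Im_le.
Qed.

Lemma is_cder_cint_param (f f' : R -> R -> R[i]) a b u v M :
  (forall x t, u < x < v -> a <= t <= b -> ccont (f x) t) ->
  (forall t x, a <= t <= b -> u < x < v -> is_cder (f ^~ t) x (f' x t)) ->
  (forall x t, u < x < v -> a <= t <= b -> normc (f' x t) <= M) ->
  forall x, u < x < v -> is_cder (fun x => cint a b (f x)) x (cint a b (f' x)).
Proof.
move=> cf dx fM x xuv; split.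
- apply: (@is_derive_rint_param R (fun x t => Re (f x t)) (fun x t => Re (f' x t)) a b u v M) => //.
  + by move=> y yuv; have [] := within_ccont (fun t => cf y t yuv).
  + by move=> t y tab yuv; have [] := dx t y tab yuv.
  + by move=> y t yuv tab; apply: le_trans (fM y t yuv tab); exact: normr_Re_le.
- apply: (@is_derive_rint_param R (fun x t => Im (f x t)) (fun x t => Im (f' x t)) a b u v M) => //.
  + by move=> y yuv; have [] := within_ccont (fun t => cf y t yuv).
  + by move=> t y tab yuv; have [] := dx t y tab yuv.
  + by move=> y t yuv tab; apply: le_trans (fM y t yuv tab); exact: normr_Im_le.
Qed.

Definition ctends (F : set_system R) f z : Prop :=
  Re (f t) @[t --> F] --> Re z /\ Im (f t) @[t --> F] --> Im z.

Section ctends.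
Context (F : set_system R) {FF : ProperFilter F}.

Lemma ctends_cst z : ctends F (fun=> z) z.
Proof. by split; exact: cvg_cst. Qed.

Lemma ctendsD f g z w : ctends F f z -> ctends F g w ->
  ctends F (fun t => f t + g t) (z + w).
Proof.
move=> [h1 h2] [h3 h4]; split; rewrite ReImE.
- by under eq_fun do rewrite ReD; exact: cvgD.
- by under eq_fun do rewrite ImD; exact: cvgD.
Qed.

Lemma ctendsZ f z w : ctends F f z -> ctends F (fun t => w * f t) (w * z).
Proof.
move=> [h1 h2]; split; rewrite ReImE.
- under eq_fun do rewrite ReM.
  by apply: cvgB; apply: cvgM => //; exact: cvg_cst.
- under eq_fun do rewrite ImM.
  by apply: cvgD; apply: cvgM => //; exact: cvg_cst.
Qed.

Lemma ctends_near f g z : (\forall t \near F, f t = g t) ->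
  ctends F f z -> ctends F g z.
Proof.
move=> fg [h1 h2]; split.
- by apply: cvg_trans h1; apply: near_eq_cvg; apply: filterS fg => t ->.
- by apply: cvg_trans h2; apply: near_eq_cvg; apply: filterS fg => t ->.
Qed.

Lemma ctends0_le f (h : R -> R) : (\forall t \near F, normc (f t) <= h t) ->
  h t @[t --> F] --> 0 -> ctends F f 0.
Proof.
move=> fh h0; split; apply: norm_cvg0.
- apply: (@squeeze_cvgr _ _ _ _ (cst 0) h) => //; last exact: cvg_cst.
  apply: filterS fh => t fh; rewrite normr_ge0 /=.
  by apply: le_trans fh; exact: normr_Re_le.
- apply: (@squeeze_cvgr _ _ _ _ (cst 0) h) => //; last exact: cvg_cst.
  apply: filterS fh => t fh; rewrite normr_ge0 /=.
  by apply: le_trans fh; exact: normr_Im_le.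
Qed.

End ctends.

(** Value and existence of the improper integral in one predicate: the two tails converge
    separately, as [improper_int] demands. Integrability on every compact interval is included so
    that sums and multiples can be formed before passing to the limit. *)
Definition is_cimp f z : Prop :=
  (forall a b, cintegrable a b f) /\
  exists z1 z2, [/\ z = z1 + z2, ctends -oo (fun b => cint b 0 f) z1 &
                    ctends +oo (fun b => cint 0 b f) z2].

Lemma eq_is_cimp f g z w : is_cimp f z -> f =1 g -> z = w -> is_cimp g w.
Proof. by move=> + /funext <- <-. Qed.

Lemma is_cimpD f g z w : is_cimp f z -> is_cimp g w ->
  is_cimp (fun t => f t + g t) (z + w).
Proof.
move=> [fi [z1 [z2 [-> h1 h2]]]] [gi [w1 [w2 [-> h3 h4]]]]; split.
  by move=> a b; exact: cintegrableD.
exists (z1 + w1), (z2 + w2); split; first by rewrite addrACA.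
- by under eq_fun do rewrite cintD //; exact: ctendsD.
- by under eq_fun do rewrite cintD //; exact: ctendsD.
Qed.

Lemma is_cimpZ f z w : is_cimp f z -> is_cimp (fun t => w * f t) (w * z).
Proof.
move=> [fi [z1 [z2 [-> h1 h2]]]]; split.
  by move=> a b; exact: cintegrableZ.
exists (w * z1), (w * z2); split; first by rewrite mulrDr.
- by under eq_fun do rewrite cintZ //; exact: ctendsZ.
- by under eq_fun do rewrite cintZ //; exact: ctendsZ.
Qed.

Lemma is_cimp0 : is_cimp (fun=> 0) 0.
Proof.
have c0 t : ccont (fun=> 0 : R[i]) t by exact: ccont_cst.
split; first by move=> a b; apply: ccont_cintegrable.
have E a b : cint a b (fun=> 0) = 0.
  by rewrite /cint /rint Rintegral_cst //= mul0r.
by exists 0, 0; split; [by rewrite addr0| |];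
  (apply: (@ctends_near _ _ (fun=> 0)); last exact: ctends_cst);
  by apply: nearW => b; rewrite E.
Qed.

Lemma is_cimp_sum n (f : nat -> R -> R[i]) (z : nat -> R[i]) :
  (forall j, (j < n)%N -> is_cimp (f j) (z j)) ->
  is_cimp (fun t => \sum_(j < n) f j t) (\sum_(j < n) z j).
Proof.
elim: n => [|n IH] h.
  by apply: eq_is_cimp is_cimp0 _ _ => [t|]; rewrite big_ord0.
have h1 : is_cimp (fun t => \sum_(j < n) f j t) (\sum_(j < n) z j).
  by apply: IH => j jn; apply: h; exact: ltnW.
apply: eq_is_cimp (is_cimpD h1 (h n (ltnSn n))) _ _ => [t|];
  by rewrite big_ord_recr.
Qed.

Lemma is_cimp_ftc s f g z w : pccont s f -> (forall t, ccont g t) ->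
  (forall t, t \notin s -> is_cder g t (f t)) ->
  ctends +oo g z -> ctends -oo g w -> is_cimp f (z - w).
Proof.
move=> pf cg dg gz gw; split; first by move=> a b; exact: pccont_cintegrable pf.
exists (g 0 - w), (z - g 0); split.
- by ring.
- apply: (@ctends_near _ _ (fun b => g 0 + (- 1) * g b)).
    near=> b; have b0 : b <= 0 by near: b; exact: nbhs_ninfty_le.
    by rewrite (cint_pcftc b0 pf cg dg) mulN1r.
  by rewrite -(mulN1r w); apply: ctendsD; [exact: ctends_cst|exact: ctendsZ].
- apply: (@ctends_near _ _ (fun b => g b + (- g 0))).
    near=> b; have b0 : 0 <= b by near: b; exact: nbhs_pinfty_ge.
    by rewrite (cint_pcftc b0 pf cg dg).
  by apply: ctendsD => //; exact: ctends_cst.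
Unshelve. all: by end_near. Qed.

Lemma is_cimp_contour (g : R -> R[i]) (f : R[i] -> R[i]) z :
  is_cimp (fun t => f (g t) * curve_deriv g t) z ->
  contour_cvg g f /\ contour_int g f = z.
Proof.
move=> [_ [z1 [z2 [-> [a1 a2] [b1 b2]]]]]; split.
  by split; split; apply/cvg_ex; [exists (Re z1)|exists (Re z2)|exists (Im z1)|exists (Im z2)].
apply: complex_ext; rewrite ReImE /contour_int /improper_int /=.
- by congr +%R; exact: cvg_lim.
- by congr +%R; exact: cvg_lim.
Qed.

End ComplexIntegrals.

(** * Translating a contour to the left *)

Section LeftShift.
Context {R : realType}.
Implicit Types (a b t u v x y M N : R) (z w e : R[i]) (c d f g : R -> R[i]).
Local Notation normc := (@ComplexField.Normc.normc R).

(* Holomorphy on [U] with derivative [k'] is expressed by the chain rule along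
   curves staying in a bounded part of [U]; continuity likewise. *)
Definition hol_on (U : R[i] -> Prop) (k k' : R[i] -> R[i]) : Prop :=
  forall c d u v M, (forall t, u < t < v -> is_cder c t (d t)) ->
  (forall t, u < t < v -> [/\ U (c t), normc (c t) <= M & normc (d t) <= M]) ->
  forall t, u < t < v -> is_cder (fun x => k (c x)) t (k' (c t) * d t).

Definition cont_on (U : R[i] -> Prop) (k : R[i] -> R[i]) : Prop :=
  forall c u v M, (forall t, u < t < v -> ccont c t) ->
  (forall t, u < t < v -> U (c t) /\ normc (c t) <= M) ->
  forall t, u < t < v -> ccont (fun x => k (c x)) t.

(** Supplies the dominating constants for continuity and differentiation under the integral sign in
    [shift_int]. *)
Definition bounded_on (U : R[i] -> Prop) (k : R[i] -> R[i]) : Prop :=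
  forall M, exists C, forall z, U z -> normc z <= M -> normc (k z) <= C.

Definition halfplane a z : Prop := Re z < a.

Lemma near_itvoo t (P : R -> Prop) : (\forall x \near t, P x) ->
  exists u v, u < t < v /\ forall x, u < x < v -> P x.
Proof.
move=> /nbhs_ballP[e /= e0 eP]; exists (t - e), (t + e); split.
  by rewrite ltrBlDr ltrDl e0.
move=> x /andP[h1 h2]; apply: eP; rewrite /ball /= ltr_distlC.
by apply/andP; split; lra.
Qed.

Lemma ccont_near_bound c t : ccont c t ->
  \forall x \near t, normc (c x) <= `|Re (c t)| + `|Im (c t)| + 2.
Proof.
move=> [/cvgrPdist_lt h1 /cvgrPdist_lt h2].
near=> x; apply: le_trans (normc_le_ReIm _) _.
have k1 : `|Re (c t) - Re (c x)| < 1 by near: x; apply: h1.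
have k2 : `|Im (c t) - Im (c x)| < 1 by near: x; apply: h2.
have h3 : `|Re (c x)| <= `|Re (c t)| + 1.
  rewrite -(subKr (Re (c t)) (Re (c x))).
  by rewrite (le_trans (ler_normB _ _)) // lerD2l ltW.
have h4 : `|Im (c x)| <= `|Im (c t)| + 1.
  rewrite -(subKr (Im (c t)) (Im (c x))).
  by rewrite (le_trans (ler_normB _ _)) // lerD2l ltW.
by lra.
Unshelve. all: by end_near. Qed.

Lemma near_notin (s : seq R) t : t \notin s -> \forall x \near t, x \notin s.
Proof.
elim: s => [|y s IH]; first by move=> _; apply: filterE => x; rewrite in_nil.
rewrite inE negb_or => /andP[ty ts].
have yn : \forall x \near t, x != y.
  case: (ltgtP t y) ty => // h _.
    by apply: filterS (lt_nbhsl h) => x /lt_eqF ->.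
  by apply: filterS (lt_nbhsr h) => x /gt_eqF ->.
apply: filterS2 yn (IH ts) => x xy xs.
by rewrite inE negb_or xy.
Qed.

Lemma ccont_bounded a b c : a <= b -> (forall t, a <= t <= b -> ccont c t) ->
  exists M, forall t, a <= t <= b -> normc (c t) <= M.
Proof.
move=> ab cc; have [h1 h2] := within_ccont cc.
have h : {within `[a, b], continuous (fun t => `|Re (c t)| + `|Im (c t)|)}.
  apply: continuous_in_subspaceT => t; rewrite inE /= in_itv => /cc[k1 k2].
  by apply: cvgD; apply: cvg_norm; [exact: k1|exact: k2].
have [m _ hm] := EVT_max ab h.
exists (`|Re (c m)| + `|Im (c m)|) => t tab.
by rewrite (le_trans (normc_le_ReIm _)) // hm // in_itv.
Qed.

Lemma is_cder_Bcst c t e z : is_cder c t e -> is_cder (fun u => c u - z) t e.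
Proof. by move=> h; apply: is_cder_eq (is_cderB h (is_cder_cst z t)) _; rewrite subr0. Qed.

Lemma is_cder_cstB z t : is_cder (fun x => z - x%:C) t (- 1).
Proof.
rewrite (_ : (fun x => _) = fun x => z + x%:C * (- 1)); first exact: is_cder_addi.
by apply/funext => x; rewrite mulrN1.
Qed.

Section halfplane_shift.
Context (a : R) (k k' : R[i] -> R[i]).
Context (hk : hol_on (halfplane a) k k').
Context (ck : cont_on (halfplane a) k) (ck' : cont_on (halfplane a) k').
Context (bk : bounded_on (halfplane a) k) (bk' : bounded_on (halfplane a) k').

(* Its derivative [k z - k (z - N)] makes the integrals of [k] along a curve and
   along its translate by [- N] differ only by endpoint values. *)
Definition shift_int N z : R[i] := cint 0 N (fun x => k (z - x%:C)).

(** The range of [x] is an open interval containing [[0, N]], since Re z - a < 0. Two-sided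
    derivatives are thus available at the endpoints 0 and [N] as well. *)
Lemma halfplane_shift z N : halfplane a z -> exists M,
  forall x, Re z - a < x < N + 1 -> halfplane a (z - x%:C) /\ normc (z - x%:C) <= M.
Proof.
move=> za; exists (normc z + (`|Re z - a| + `|N + 1|)) => x /andP[h1 h2]; split.
  by rewrite /halfplane !ReImE /=; lra.
rewrite (le_trans (le_normcB _ _)) // lerD2l normc_real ler_norml.
have := ler_norm (N + 1); have := ler_norm (- (Re z - a)); rewrite normrN.
by have := normr_ge0 (N + 1); have := normr_ge0 (Re z - a); lra.
Qed.

Lemma ccont_shift (h : R[i] -> R[i]) z N x : cont_on (halfplane a) h ->
  halfplane a z -> 0 <= x <= N -> ccont (fun x => h (z - x%:C)) x.
Proof.
move=> ch za xN; have [M hM] := halfplane_shift N za.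
apply: (ch (fun x => z - x%:C) (Re z - a) (N + 1) M) => //.
  by move=> t _; apply: is_cder_ccont; exact: is_cder_cstB.
by move: za; rewrite /halfplane; lra.
Qed.

Lemma is_cder_shift z N x : halfplane a z -> 0 <= x <= N ->
  is_cder (fun x => k (z - x%:C)) x (- k' (z - x%:C)).
Proof.
move=> za xN; have [M hM] := halfplane_shift N za.
rewrite -mulrN1.
apply: (hk (c := fun x => z - x%:C) (d := fun=> - 1) (u := Re z - a) (v := N + 1)
  (M := Num.max M 1)).
- by move=> t _; exact: is_cder_cstB.
- move=> t /hM[h1 h2]; split=> //; first by rewrite le_max h2.
  by rewrite normcN ComplexField.Normc.normc1 le_max lexx orbT.
- by move: za; rewrite /halfplane; lra.
Qed.

(** Differentiation under the integral sign gives the integral over [[0, N]] of k'(c t - x) d t,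
    which the primitive - k(c t - x) d t evaluates. All arguments stay in the half-plane and in the
    ball of radius [M + N], where [k'] is bounded. *)
Lemma is_cder_shift_int c d u v M N : 0 <= N ->
  (forall t, u < t < v -> is_cder c t (d t)) ->
  (forall t, u < t < v -> [/\ halfplane a (c t), normc (c t) <= M & normc (d t) <= M]) ->
  forall t, u < t < v -> is_cder (fun x => shift_int N (c x)) t
     ((k (c t) - k (c t - N%:C)) * d t).
Proof.
move=> N0 dc hM t tuv.
have hc x : u < x < v -> halfplane a (c x) by move=> /hM[].
have hs z x : halfplane a z -> 0 <= x <= N -> halfplane a (z - x%:C).
  by rewrite /halfplane !ReImE /= => h1 h2; lra.
have nb x y : u < x < v -> 0 <= y <= N -> normc (c x - y%:C) <= M + N.
  move=> /hM[_ h1 _] h2; rewrite (le_trans (le_normcB _ _)) // normc_real.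
  by rewrite lerD // ger0_norm; lra.
have [C hC] := bk' (M + N).
have M0 : 0 <= M by have [_ h _] := hM t tuv; apply: le_trans h; exact: normc_ge0.
apply: is_cder_eq (is_cder_cint_param (f := fun x y => k (c x - y%:C))
   (f' := fun x y => k' (c x - y%:C) * d x) (u := u) (v := v) (M := C * M) _ _ _ tuv) _.
- by move=> x y xuv yN; apply: (ccont_shift (N := N)) => //; exact: hc.
- move=> y x yN xuv.
  apply: (hk (c := fun x => c x - y%:C) (d := d) (u := u) (v := v) (M := M + N)) => //.
    by move=> r /dc h; exact: is_cder_Bcst.
  move=> r ruv; split; [exact: hs (hc _ ruv) yN|exact: nb|].
  by have [_ _ h] := hM r ruv; lra.
- move=> x y xuv yN; rewrite ComplexField.Normc.normcM ler_pM ?normc_ge0 //.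
    by apply: hC; [exact: hs (hc _ xuv) yN|exact: nb].
  by have [] := hM x xuv.
- rewrite (cint_ftc (g := fun y => - k (c t - y%:C) * d t)) //.
  + by rewrite subr0; ring.
  + move=> y yN; apply: ccontM; last exact: ccont_cst.
    by apply: (ccont_shift (N := N)) => //; exact: hc.
  + move=> y yN.
    apply: is_cder_eq (is_cderM (is_cderN (is_cder_shift (hc _ tuv) yN)) (is_cder_cst _ _)) _.
    by ring.
Qed.

Lemma ccont_shift_int c u v M N : 0 <= N ->
  (forall t, u < t < v -> ccont c t) ->
  (forall t, u < t < v -> halfplane a (c t) /\ normc (c t) <= M) ->
  forall t, u < t < v -> ccont (fun x => shift_int N (c x)) t.
Proof.
move=> N0 cc hM.
have hc x : u < x < v -> halfplane a (c x) by move=> /hM[].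
have hs z x : halfplane a z -> 0 <= x <= N -> halfplane a (z - x%:C).
  by rewrite /halfplane !ReImE /= => h1 h2; lra.
have nb x y : u < x < v -> 0 <= y <= N -> normc (c x - y%:C) <= M + N.
  move=> /hM[_ h1] h2; rewrite (le_trans (le_normcB _ _)) // normc_real.
  by rewrite lerD // ger0_norm; lra.
have [C hC] := bk (M + N).
apply: (ccont_cint_param (f := fun x y => k (c x - y%:C)) (M := C)).
- by move=> x y xuv yN; apply: (ccont_shift (N := N)) => //; exact: hc.
- move=> y x yN xuv.
  apply: (ck (c := fun x => c x - y%:C) (u := u) (v := v) (M := M + N)) => //.
    by move=> r ruv; apply: ccontB; [exact: cc|exact: ccont_cst].
  by move=> r ruv; split; [exact: hs (hc _ ruv) yN|exact: nb].
- by move=> x y xuv yN; apply: hC; [exact: hs (hc _ xuv) yN|exact: nb].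
Qed.

(** The sector is stable under translation to the left, so the integrand is at most C / (x - Re
    z)^2, whose integral over [[0, N]] is at most C / (- Re z). The point is that this bound does
    not depend on [N]. *)
Lemma normc_shift_int_le C X N z : 0 <= N -> 0 <= C -> 0 < X ->
  (forall z, Re z <= - X -> `|Im z| <= - Re z / 2 -> normc (k z) <= C / Re z ^+ 2) ->
  halfplane a z -> Re z <= - X -> `|Im z| <= - Re z / 2 ->
  normc (shift_int N z) <= 2 * (C / - Re z).
Proof.
move=> N0 C0 X0 dk za zX zI.
pose h x := C / (x - Re z) ^+ 2.
have xz x : 0 <= x -> x - Re z != 0 by move=> x0; rewrite gt_eqF //; lra.
have dh x : 0 <= x -> is_derive x 1 (fun x => - C * (x - Re z)^-1) (h x).
  move=> x0.
  have d1 : is_derive x 1 (fun x => x - Re z) 1.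
    apply: (is_derive_eq (is_deriveB (is_derive_id _ _) (is_derive_cst _ _ _))).
    by rewrite subr0.
  have d2 : is_derive x 1 (fun y => (y - Re z)^-1) (- (x - Re z) ^- 2 *: 1).
    exact: (is_deriveV (f := fun y => y - Re z) (xz x x0) d1).
  rewrite (_ : (fun y => _) = (- C) \*: (fun y => (y - Re z)^-1)) //.
  apply: (is_derive_eq (is_deriveZ (- C) d2)).
  by rewrite /GRing.scale /= /h; field; exact: xz.
have ch : {within `[0, N], continuous h}.
  apply: continuous_in_subspaceT => x; rewrite inE /= in_itv /= => /andP[x0 _].
  have cx : {for x, continuous (fun y => (y - Re z) * (y - Re z))}.
    by apply: cvgM; (apply: cvgB; [exact: cvg_id|exact: cvg_cst]).
  apply: cvgM; first exact: cvg_cst.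
  apply: cvgV; first by rewrite expf_neq0 // xz.
  by under eq_fun do rewrite expr2; rewrite expr2; exact: cx.
have ci : rint 0 N h <= C / - Re z.
  have cF : {within `[0, N], continuous (fun x => - C * (x - Re z)^-1)}.
    apply: continuous_in_subspaceT => x; rewrite inE /= in_itv /= => /andP[x0 _].
    exact: is_derive_continuous_at (dh x x0).
  have -> : rint 0 N h = - C * (N - Re z)^-1 - - C * (0 - Re z)^-1.
    by apply: (rint_ftc N0 ch cF) => x /andP[/ltW x0 _]; exact: dh.
  by rewrite sub0r !mulNr opprK gerDr oppr_le0 divr_ge0 //; lra.
apply: (le_trans (normc_cint_le (k := h) _ _ _)); last by rewrite ler_pM2l.
- by apply: ccont_cintegrable => x xN; apply: (ccont_shift (N := N)) => //; exact: ck.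
- exact: continuous_rintegrable.
- move=> x /andP[x0 _]; apply: (le_trans (dk _ _ _)); rewrite !ReImE /= ?subr0.
  + by lra.
  + by move: zI; lra.
  + by rewrite /h -(sqrrN (x - _)) opprB.
Qed.

End halfplane_shift.

Section contour_vanish.
Context (L : R) (k k' : R[i] -> R[i]) (s : seq R) (c d : R -> R[i]).
Context (hk : forall a, a < L -> hol_on (halfplane a) k k').
Context (ck : forall a, a < L -> cont_on (halfplane a) k).
Context (ck' : forall a, a < L -> cont_on (halfplane a) k').
Context (bk : forall a, a < L -> bounded_on (halfplane a) k).
Context (bk' : forall a, a < L -> bounded_on (halfplane a) k').
Context (C X : R) (C0 : 0 <= C) (X0 : 0 < X).
Context (dk : forall z, Re z <= - X -> `|Im z| <= - Re z / 2 ->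
  normc (k z) <= C / Re z ^+ 2).
Context (cc : forall t, ccont c t) (pd : pccont s d).
Context (dc : forall t, t \notin s -> is_cder c t (d t)).
Context (cL : forall t, Re (c t) < L) (L0 : 0 < L).

(** The hypotheses on [k] hold on half-planes strictly inside Re z < L only; locally the curve stays
    in one of them, and continuity and derivatives are local. *)
Lemma contour_halfplane_near t : exists2 a, a < L & \forall x \near t, halfplane a (c x).
Proof.
have tL := cL t; have h1 : (Re (c t) + L) / 2 < L by lra.
exists ((Re (c t) + L) / 2) => //.
by have [h _] := cc t; apply: (cvgr_lt _ h); lra.
Qed.

Lemma contour_ccont_k t : ccont (fun x => k (c x)) t.
Proof.
have [a aL ha] := contour_halfplane_near t.
have [u [v [tuv huv]]] := near_itvoo (filterI ha (ccont_near_bound (cc t))).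
exact: (ck aL (fun x _ => cc x) huv).
Qed.

Lemma contour_ccont_F N t : 0 <= N -> ccont (fun x => shift_int k N (c x)) t.
Proof.
move=> N0; have [a aL ha] := contour_halfplane_near t.
have [u [v [tuv huv]]] := near_itvoo (filterI ha (ccont_near_bound (cc t))).
exact: (ccont_shift_int (ck aL) (bk aL) N0 (fun x _ => cc x) huv).
Qed.

Lemma contour_ccont_kN N t : 0 <= N -> ccont (fun x => k (c x - N%:C)) t.
Proof.
move=> N0; have [a aL ha] := contour_halfplane_near t.
have ct : ccont (fun x => c x - N%:C) t by apply: ccontB => //; exact: ccont_cst.
have [u [v [tuv huv]]] := near_itvoo (filterI ha (ccont_near_bound ct)).
apply: (ck aL (c := fun x => c x - N%:C) (u := u) (v := v)) => //.
  by move=> x _; apply: ccontB => //; exact: ccont_cst.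
move=> x /huv[h1 h2]; split; last exact: h2.
by move: h1; rewrite /halfplane !ReImE /=; lra.
Qed.

Lemma contour_is_cder_F N t : 0 <= N -> t \notin s ->
  is_cder (fun x => shift_int k N (c x)) t ((k (c t) - k (c t - N%:C)) * d t).
Proof.
move=> N0 ts; have [a aL ha] := contour_halfplane_near t.
have dt : ccont d t by case: pd => -[h1 _] [h2 _]; split; [exact: h1|exact: h2].
have [u [v [tuv huv]]] := near_itvoo (filterI (near_notin ts)
  (filterI ha (filterI (ccont_near_bound (cc t)) (ccont_near_bound dt)))).
pose M := Num.max (`|Re (c t)| + `|Im (c t)| + 2) (`|Re (d t)| + `|Im (d t)| + 2).
apply: (is_cder_shift_int (hk aL) (ck aL) (ck' aL) (bk' aL) (u := u) (v := v) (M := M)) => //.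
  by move=> x /huv[xs _]; exact: dc.
by move=> x /huv[_ [h1 [h2 h3]]]; split=> //; rewrite le_max ?h2 ?h3 ?orbT.
Qed.

Lemma contour_pccont_c f : (forall t, ccont f t) -> pccont s (fun t => f t * d t).
Proof.
move=> cf; apply: pccontM => //.
have [[h1 h2] [h3 h4]] : pccont [::] f by exact: ccont_pccont.
by split; split=> // t _; [exact: h1|exact: h3].
Qed.

Lemma cint_shift N a b : 0 <= N -> a <= b ->
  cint a b (fun t => k (c t) * d t) =
  shift_int k N (c b) - shift_int k N (c a) +
  cint a b (fun t => k (c t - N%:C) * d t).
Proof.
move=> N0 ab.
have p1 : pccont s (fun t => (k (c t) - k (c t - N%:C)) * d t).
  by apply: contour_pccont_c => t; apply: ccontB; [exact: contour_ccont_k|exact: contour_ccont_kN].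
have p2 : pccont s (fun t => k (c t - N%:C) * d t).
  by apply: contour_pccont_c => t; exact: contour_ccont_kN.
rewrite -(cint_pcftc ab p1 (fun t => contour_ccont_F t N0) (fun t => contour_is_cder_F N0 (t := t))).
rewrite -cintD; [|exact: pccont_cintegrable p1|exact: pccont_cintegrable p2].
by congr cint; apply/funext => t; ring.
Qed.

(** A compact arc translated far enough to the left lies in the sector, where [k] is small, while
    its length is unchanged. *)
Lemma cint_shift_small a b (e : R) : a <= b -> 0 < e -> exists2 N, 0 <= N &
  normc (cint a b (fun t => k (c t - N%:C) * d t)) <= e.
Proof.
move=> ab e0; have [M hM] := ccont_bounded ab (fun t _ => cc t).
have M0 : 0 <= M.
  by apply: le_trans (hM a _); [exact: normc_ge0|rewrite lexx].
pose D t := `|Re (d t)| + `|Im (d t)|.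
have Di : rintegrable a b D.
  have [h1 h2] := pccont_cintegrable a b pd.
  by apply: rintegrableD; exact: rintegrable_norm.
pose V := rint a b D.
have V0 : 0 <= V by apply: Rintegral_ge0 => t _; rewrite /D addr_ge0.
pose q := 2 * C * V / e; have q0 : 0 <= q.
  by rewrite /q divr_ge0 ?mulr_ge0 // ltW.
(* With |c| <= M on the arc, the translate has real part at most - 2 M - r and imaginary part at
   most M in absolute value: this is the sector. There |k| <= C / r^2 <= C / r because r >= 1, and r
   >= q makes 2 C V / r at most e. *)
pose r := X + q + 1; pose N := 3 * M + r; have r0 : 1 <= r.
  by have := X0; rewrite /r; lra.
exists N; first by rewrite /N; lra.
have kN t : a <= t <= b -> normc (k (c t - N%:C)) <= C / r.
  move=> /hM h; have h1 := le_trans (normr_Re_le _) h.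
  have h2 := le_trans (normr_Im_le _) h.
  have h3 : Re (c t) <= M := le_trans (ler_norm _) h1.
  have hr : r <= - Re (c t - N%:C) by rewrite !ReImE /= /N; lra.
  apply: (le_trans (dk _ _)).
  - by rewrite /r in hr; lra.
  - by rewrite !ReImE /= subr0 /N; lra.
  - rewrite ler_wpM2l // lef_pV2 ?posrE; [|nra|lra].
    by nra.
apply: (le_trans (normc_cint_le (k := fun t => (C / r) * D t) _ _ _)).
- apply: pccont_cintegrable; apply: contour_pccont_c => t; apply: contour_ccont_kN.
  by rewrite /N; lra.
- exact: rintegrableZ.
- move=> t tab; rewrite ComplexField.Normc.normcM ler_pM ?normc_ge0 //.
    exact: kN.
  exact: normc_le_ReIm.
rewrite rintZ // -/V.
have -> : 2 * (C / r * V) = (2 * C * V) / r by ring.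
rewrite ler_pdivrMr; last lra.
have -> : 2 * C * V = e * q by rewrite /q [RHS]mulrC divfK // gt_eqF.
by rewrite ler_pM2l // /r; have := X0; lra.
Qed.

Definition sector t : Prop := Re (c t) <= - X /\ `|Im (c t)| <= - Re (c t) / 2.

(** The translated integral can be made smaller than any [e], while the endpoint terms are bounded
    independently of [N]; so only the endpoint terms remain. *)
Lemma normc_cint_sector a b : a <= b -> sector a -> sector b ->
  normc (cint a b (fun t => k (c t) * d t)) <=
  2 * (C / - Re (c a)) + 2 * (C / - Re (c b)).
Proof.
move=> ab [a1 a2] [b1 b2]; apply/ler_addgt0Pr => e e0.
have [N N0 hN] := cint_shift_small ab e0.
have L2 : L / 2 < L by have := L0; lra.
have F t : sector t -> normc (shift_int k N (c t)) <= 2 * (C / - Re (c t)).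
  move=> [t1 t2].
  apply: (normc_shift_int_le (ck L2) N0 C0 X0 dk) => //.
  by have := X0; have := L0; rewrite /halfplane; lra.
rewrite (cint_shift N0 ab) (le_trans (le_normcD _ _)) // lerD //.
rewrite (le_trans (le_normcB _ _)) // addrC lerD //; exact: F.
Qed.

Context (cp : Re (c t) @[t --> +oo] --> -oo)
        (cm : Re (c t) @[t --> -oo] --> -oo).
Context (rp : (Im (c t) / Re (c t)) @[t --> +oo] --> 0)
        (rm : (Im (c t) / Re (c t)) @[t --> -oo] --> 0).

Lemma contour_near_sector (F : set_system R) {FF : ProperFilter F} :
  Re (c t) @[t --> F] --> -oo -> (Im (c t) / Re (c t)) @[t --> F] --> 0 ->
  \forall t \near F, sector t.
Proof.
move=> h1 h2; near=> t.
have hX : Re (c t) <= - X by near: t; exact: cvgrNy_le.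
have X1 := X0.
have hr : `|Im (c t) / Re (c t)| < 1 / 2.
  by near: t; apply: cvgr0_norm_lt => //; lra.
split=> //; move: hr; rewrite normrM normfV ltr_pdivrMr; last first.
  by rewrite normr_gt0 lt_eqF //; lra.
by rewrite (ltr0_norm (x := Re (c t))); lra.
Unshelve. all: by end_near. Qed.

Lemma contour_tail0 (F : set_system R) {FF : ProperFilter F} :
  Re (c t) @[t --> F] --> -oo -> 2 * (C / - Re (c t)) @[t --> F] --> 0.
Proof.
move=> h1; rewrite -(mulr0 2); apply: cvgM; first exact: cvg_cst.
rewrite -(mulr0 C); apply: cvgM; first exact: cvg_cst.
apply/gtr0_cvgV0; last exact/cvgNry.
by apply: filterS (cvgrNy_lt h1 0) => t; rewrite oppr_gt0.
Qed.

(** Cauchy's criterion, applied to real and imaginary parts at once through a 1-Lipschitz projection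
    [p]. [S] carries the sign condition on the truncation point, so that both ends of the line are
    covered. *)
Lemma contour_cauchy (F : set_system R) {FF : ProperFilter F} (I : R -> R[i]) (S : set R) :
  Re (c t) @[t --> F] --> -oo -> F S ->
  (forall x y, S x -> S y -> normc (I x - I y) <=
     2 * (C / - Re (c x)) + 2 * (C / - Re (c y))) ->
  exists z, ctends F I z.
Proof.
move=> cF FS hI.
have H (p : R[i] -> R) : (forall z w, `|p z - p w| <= normc (z - w)) ->
    cvg (p (I t) @[t --> F]).
  move=> hp; apply/cauchy_cvgP/cauchy_ballP => e e0.
  pose A := [set x | S x /\ 2 * (C / - Re (c x)) < e / 2].
  have FA : F A.
    apply: filterI => //.
    by apply: (cvgr_lt _ (contour_tail0 cF)); rewrite divr_gt0.
  exists ((fun x => p (I x)) @` A, (fun x => p (I x)) @` A).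
    by split; exact: (@filterS _ F _ A _ (fun x Ax => ex_intro2 _ _ x Ax erefl) FA).
  move=> [_ _] [/= [x [Sx hx] <-] [y [Sy hy] <-]]; rewrite /ball /=.
  apply: (le_lt_trans (hp _ _)); apply: (le_lt_trans (hI _ _ Sx Sy)).
  by rewrite [ltRHS](splitr e) ltrD.
have /cvg_ex[l1 h1] : cvg (Re (I t) @[t --> F]).
  by apply: H => z w; rewrite -ReN -ReD normr_Re_le.
have /cvg_ex[l2 h2] : cvg (Im (I t) @[t --> F]).
  by apply: H => z w; rewrite -ImN -ImD normr_Im_le.
by exists (l1 +i* l2); split.
Qed.

(** The endpoint bound first shows that each tail converges separately; only then can the sum of the
    two limits be computed along symmetric truncations. *)
Lemma is_cimp_vanish : is_cimp (fun t => k (c t) * d t) 0.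
Proof.
have fi a b : cintegrable a b (fun t => k (c t) * d t).
  by apply: pccont_cintegrable; apply: contour_pccont_c => t; exact: contour_ccont_k.
split=> //.
have sp : \forall b \near +oo, sector b := contour_near_sector cp rp.
have sm : \forall b \near -oo, sector b := contour_near_sector cm rm.
have sp' : \forall b \near +oo, 0 <= b /\ sector b.
  by near=> b; split; near: b; [exact: nbhs_pinfty_ge|exact: sp].
have sm' : \forall b \near -oo, b <= 0 /\ sector b.
  by near=> b; split; near: b; [exact: nbhs_ninfty_le|exact: sm].
pose f t := k (c t) * d t.
have [z2 hz2] : exists z, ctends +oo (fun b => cint 0 b f) z.
  apply: (contour_cauchy (S := [set b | 0 <= b /\ sector b]) cp).
    exact: sp'.
  move=> x y [x0 sx] [y0 sy]; have [xy|/ltW yx] := leP x y.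
    rewrite (cint_cat x0 xy) // opprD addNKr normcN.
    exact: normc_cint_sector.
  rewrite (cint_cat y0 yx) // addrC addKr addrC.
  exact: normc_cint_sector.
have [z1 hz1] : exists z, ctends -oo (fun b => cint b 0 f) z.
  apply: (contour_cauchy (S := [set b | b <= 0 /\ sector b]) cm).
    exact: sm'.
  move=> x y [x0 sx] [y0 sy]; have [xy|/ltW yx] := leP x y.
    rewrite (cint_cat xy y0) // addrK.
    exact: normc_cint_sector.
  rewrite (cint_cat yx x0) // opprD addrCA subrr addr0 normcN addrC.
  exact: normc_cint_sector.
exists z1, z2; split=> //.
have smN : \forall b \near +oo, sector (- b).
  case: sm => A [Ar hA]; exists (- A); split; first by rewrite realN.
  by move=> b hb; apply: hA; rewrite ltrNl.
have hz1' : ctends +oo (fun b => cint (- b) 0 f) z1.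
  by case: hz1 => h1 h2; split; [exact/(cvgNy_compNP (fun b => Re (cint b 0 f)))|
    exact/(cvgNy_compNP (fun b => Im (cint b 0 f)))].
(* The integral over [[- b, b]] is bounded by the two endpoint terms, and both tend to 0. *)
have h0 : ctends +oo (fun b => cint (- b) 0 f + cint 0 b f) 0.
  apply: (ctends0_le (h := fun b => 2 * (C / - Re (c (- b))) + 2 * (C / - Re (c b)))).
    near=> b.
    have b0 : 0 <= b by near: b; exact: nbhs_pinfty_ge.
    rewrite -cint_cat ?oppr_le0 //.
    apply: normc_cint_sector; first by rewrite (le_trans _ b0) // oppr_le0.
      by near: b; exact: smN.
    by near: b; exact: sp.
  rewrite -(addr0 0); apply: cvgD; last exact: contour_tail0.
  by apply/(cvgNy_compNP (fun b => 2 * (C / - Re (c b)))); exact: contour_tail0.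
have [h1 h2] := ctendsD hz1' hz2; have [h3 h4] := h0.
by apply: complex_ext; [exact: cvg_unique h3 h1|exact: cvg_unique h4 h2].
Unshelve. all: by end_near. Qed.

End contour_vanish.

End LeftShift.

(** * Closure properties of the functions to which the translation argument applies *)

Section Regular.
Context {R : realType}.
Implicit Types (a b t u v x y L M N : R) (z w e : R[i]) (c d : R -> R[i]).
Implicit Types (U : R[i] -> Prop) (f g : R[i] -> R[i]).
Local Notation normc := (@ComplexField.Normc.normc R).

(** Exactly what the translation argument asks of a function. The derivative is an argument so that
    it can be left to unification: the closure lemmas below build it, and its formula is never
    consulted. *)
Definition regular U f f' : Prop :=
  [/\ hol_on U f f', cont_on U f, cont_on U f', bounded_on U f & bounded_on U f'].

Lemma cont_on_cst U e : cont_on U (fun=> e).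
Proof. by move=> c u v M _ _ t _; exact: ccont_cst. Qed.

Lemma cont_on_id U : cont_on U id.
Proof. by move=> c u v M cc _ t tuv; exact: cc. Qed.

Lemma cont_onD U f g : cont_on U f -> cont_on U g -> cont_on U (fun z => f z + g z).
Proof.
by move=> hf hg c u v M h1 h2 t tuv; apply: ccontD; [exact: hf h1 h2 _ _|exact: hg h1 h2 _ _].
Qed.

Lemma cont_onM U f g : cont_on U f -> cont_on U g -> cont_on U (fun z => f z * g z).
Proof.
by move=> hf hg c u v M h1 h2 t tuv; apply: ccontM; [exact: hf h1 h2 _ _|exact: hg h1 h2 _ _].
Qed.

Lemma cont_onN U f : cont_on U f -> cont_on U (fun z => - f z).
Proof. by move=> hf c u v M h1 h2 t tuv; apply: ccontN; exact: hf h1 h2 _ _. Qed.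

Lemma cont_onV U f : (forall z, U z -> f z != 0) -> cont_on U f ->
  cont_on U (fun z => (f z)^-1).
Proof.
move=> f0 hf c u v M h1 h2 t tuv; apply: ccontV; last exact: hf h1 h2 _ _.
by apply: f0; case: (h2 t tuv).
Qed.

Lemma cont_on_cexp U f : cont_on U f -> cont_on U (fun z => cexp (f z)).
Proof. by move=> hf c u v M h1 h2 t tuv; apply: ccont_cexp; exact: hf h1 h2 _ _. Qed.

Lemma bounded_on_cst U e : bounded_on U (fun=> e).
Proof. by move=> M; exists (normc e). Qed.

Lemma bounded_on_id U : bounded_on U id.
Proof. by move=> M; exists M. Qed.

Lemma bounded_onD U f g : bounded_on U f -> bounded_on U g ->
  bounded_on U (fun z => f z + g z).
Proof.
move=> hf hg M; have [A hA] := hf M; have [B hB] := hg M; exists (A + B) => z Uz zM.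
by rewrite (le_trans (le_normcD _ _)) // lerD //; [exact: hA|exact: hB].
Qed.

Lemma bounded_onM U f g : bounded_on U f -> bounded_on U g ->
  bounded_on U (fun z => f z * g z).
Proof.
move=> hf hg M; have [A hA] := hf M; have [B hB] := hg M; exists (A * B) => z Uz zM.
by rewrite ComplexField.Normc.normcM ler_pM ?normc_ge0 //; [exact: hA|exact: hB].
Qed.

Lemma bounded_onN U f : bounded_on U f -> bounded_on U (fun z => - f z).
Proof.
by move=> hf M; have [A hA] := hf M; exists A => z Uz zM; rewrite normcN; exact: hA.
Qed.

Lemma bounded_onV U f (r : R) : 0 < r -> (forall z, U z -> r <= normc (f z)) ->
  bounded_on U (fun z => (f z)^-1).
Proof.
move=> r0 hr M; exists r^-1 => z Uz _.
by rewrite ComplexField.Normc.normcV lef_pV2 ?posrE ?hr //; exact: lt_le_trans (hr z Uz).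
Qed.

Lemma bounded_on_cexp U f : bounded_on U f -> bounded_on U (fun z => cexp (f z)).
Proof.
move=> hf M; have [A hA] := hf M; exists (expR A) => z Uz zM.
rewrite normc_cexp ler_expR; apply: le_trans (hA z Uz zM).
by apply: le_trans (normr_Re_le _); exact: ler_norm.
Qed.

Lemma regular_cst U e : regular U (fun=> e) (fun=> 0).
Proof.
split; [|exact: cont_on_cst|exact: cont_on_cst|exact: bounded_on_cst|exact: bounded_on_cst].
by move=> c d u v M _ _ t _; rewrite mul0r; exact: is_cder_cst.
Qed.

Lemma regular_id U : regular U id (fun=> 1).
Proof.
split; [|exact: cont_on_id|exact: cont_on_cst|exact: bounded_on_id|exact: bounded_on_cst].
by move=> c d u v M h _ t tuv; rewrite mul1r; exact: h.
Qed.

Lemma regularD U f f' g g' : regular U f f' -> regular U g g' ->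
  regular U (fun z => f z + g z) (fun z => f' z + g' z).
Proof.
move=> [h1 h2 h3 h4 h5] [k1 k2 k3 k4 k5].
split; [|exact: cont_onD|exact: cont_onD|exact: bounded_onD|exact: bounded_onD].
move=> c d u v M p q t tuv.
apply: is_cder_eq (is_cderD (h1 _ _ _ _ _ p q _ tuv) (k1 _ _ _ _ _ p q _ tuv)) _.
by rewrite mulrDl.
Qed.

Lemma regularN U f f' : regular U f f' -> regular U (fun z => - f z) (fun z => - f' z).
Proof.
move=> [h1 h2 h3 h4 h5].
split; [|exact: cont_onN|exact: cont_onN|exact: bounded_onN|exact: bounded_onN].
move=> c d u v M p q t tuv.
by apply: is_cder_eq (is_cderN (h1 _ _ _ _ _ p q _ tuv)) _; rewrite mulNr.
Qed.

Lemma regularM U f f' g g' : regular U f f' -> regular U g g' ->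
  regular U (fun z => f z * g z) (fun z => f' z * g z + f z * g' z).
Proof.
move=> [h1 h2 h3 h4 h5] [k1 k2 k3 k4 k5].
split; [|exact: cont_onM| |exact: bounded_onM|].
- move=> c d u v M p q t tuv.
  apply: is_cder_eq (is_cderM (h1 _ _ _ _ _ p q _ tuv) (k1 _ _ _ _ _ p q _ tuv)) _.
  by ring.
- by apply: cont_onD; exact: cont_onM.
- by apply: bounded_onD; exact: bounded_onM.
Qed.

Lemma regular_cexp U f f' : regular U f f' ->
  regular U (fun z => cexp (f z)) (fun z => cexp (f z) * f' z).
Proof.
move=> [h1 h2 h3 h4 h5].
split; [|exact: cont_on_cexp| |exact: bounded_on_cexp|].
- move=> c d u v M p q t tuv.
  apply: is_cder_eq (is_cder_cexp (h1 _ _ _ _ _ p q _ tuv)) _.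
  by rewrite mulrA.
- by apply: cont_onM => //; exact: cont_on_cexp.
- by apply: bounded_onM => //; exact: bounded_on_cexp.
Qed.

Lemma regularV U f f' (r : R) : 0 < r -> (forall z, U z -> r <= normc (f z)) ->
  regular U f f' -> regular U (fun z => (f z)^-1) (fun z => - f' z * ((f z)^-1 * (f z)^-1)).
Proof.
move=> r0 hr [h1 h2 h3 h4 h5].
have f0 z : U z -> f z != 0.
  by move=> /hr h; rewrite -normc_gt0; exact: lt_le_trans h.
have bV := bounded_onV r0 hr.
split=> //; [|exact: cont_onV| |].
- move=> c d u v M p q t tuv.
  have ft0 : f (c t) != 0 by apply: f0; case: (q t tuv).
  apply: is_cder_eq (is_cderV ft0 (h1 _ _ _ _ _ p q _ tuv)) _.
  by rewrite expr2 invfM; ring.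
- by apply: cont_onM; [exact: cont_onN|apply: cont_onM; exact: cont_onV].
- by apply: bounded_onM; [exact: bounded_onN|exact: bounded_onM].
Qed.

(** The m-th derivative of the entire function (e^z - 1) / z, as an integral that does not see the
    removable singularity at 0. *)
Definition expint (m : nat) z : R[i] :=
  cint 0 1 (fun x => (x ^+ m)%:C * cexp (x%:C * z)).

Lemma ccont_real_scale z t : ccont (fun x => x%:C * z) t.
Proof.
rewrite (_ : (fun x => _) = fun x => 0 + x%:C * z); last first.
  by apply/funext => x; rewrite add0r.
by apply: is_cder_ccont; exact: is_cder_addi.
Qed.

Lemma ccont_realX m t : ccont (fun x => (x ^+ m)%:C) t.
Proof.
rewrite (_ : (fun x => _) = fun x => (x%:C * 1) ^+ m); last first.
  by apply/funext => x; rewrite mulr1 rmorphXn.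
by apply: ccontX; exact: ccont_real_scale.
Qed.

Lemma expint_ccont m z t : ccont (fun x => (x ^+ m)%:C * cexp (x%:C * z)) t.
Proof.
by apply: ccontM; [exact: ccont_realX|apply: ccont_cexp; exact: ccont_real_scale].
Qed.

Lemma normc_expint_integrand m x z (B : R) : 0 <= x <= 1 -> Re z <= B -> 0 <= B ->
  normc ((x ^+ m)%:C * cexp (x%:C * z)) <= expR B.
Proof.
move=> /andP[x0 x1] zB B0; rewrite ComplexField.Normc.normcM normc_real normc_cexp.
rewrite -[leRHS]mul1r ler_pM ?expR_ge0 //.
  by rewrite normrX ger0_norm // exprn_ile1.
by rewrite ler_expR !ReImE /= mul0r subr0; nra.
Qed.

Lemma normc_expint m z (B : R) : Re z <= B -> 0 <= B ->
  normc (expint m z) <= 2 * expR B.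
Proof.
move=> zB B0; apply: (le_trans (normc_cint_le (k := fun=> expR B) _ _ _)).
- by apply: ccont_cintegrable => t _; exact: expint_ccont.
- by apply: continuous_rintegrable; apply: continuous_subspaceT => t; exact: cvg_cst.
- by move=> t t01; exact: normc_expint_integrand.
rewrite /rint Rintegral_cst //= lebesgue_measure_itv /= lte01 oppr0 adde0.
by rewrite mulr1.
Qed.

Lemma expint_mul z : z * expint 0 z = cexp z - 1.
Proof.
rewrite /expint -cintZ; last by apply: ccont_cintegrable => t _; exact: expint_ccont.
rewrite (cint_ftc (g := fun x => cexp (x%:C * z))) //.
- by rewrite mul1r mul0r cexp0.
- by move=> t _; apply: ccontM; [exact: ccont_cst|exact: expint_ccont].
move=> t _; have h : is_cder (fun x => x%:C * z) t z.
  by have := is_cder_addi 0 z t; under eq_fun do rewrite add0r.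
by apply: is_cder_eq (is_cder_cexp h) _; rewrite expr0 mul1r mulrC.
Qed.

Lemma cont_on_expint U m f : cont_on U f -> bounded_on U f ->
  cont_on U (fun z => expint m (f z)).
Proof.
move=> cf bf c u v M cc hM.
have [A hA] := bf M.
have fA x : u < x < v -> Re (f (c x)) <= `|A|.
  move=> /hM[h1 h2]; apply: (le_trans (ler_norm _)).
  by rewrite (le_trans (normr_Re_le _)) // (le_trans (hA _ h1 h2)) // ler_norm.
apply: (ccont_cint_param (f := fun x y => (y ^+ m)%:C * cexp (y%:C * f (c x)))
  (M := expR `|A|)).
- by move=> x y _ _; exact: expint_ccont.
- move=> y x _ xuv; apply: ccontM; first exact: ccont_cst.
  by apply: ccont_cexp; apply: ccontM; [exact: ccont_cst|exact: cf cc hM _ _].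
- by move=> x y xuv y01; apply: normc_expint_integrand => //; exact: fA.
Qed.

Lemma bounded_on_expint U m f : bounded_on U f ->
  bounded_on U (fun z => expint m (f z)).
Proof.
move=> bf M; have [A hA] := bf M; exists (2 * expR `|A|) => z Uz zM.
apply: normc_expint => //; apply: (le_trans (ler_norm _)).
by rewrite (le_trans (normr_Re_le _)) // (le_trans (hA _ Uz zM)) // ler_norm.
Qed.

Lemma regular_expint U m f f' : regular U f f' ->
  regular U (fun z => expint m (f z)) (fun z => expint m.+1 (f z) * f' z).
Proof.
move=> [h1 h2 h3 h4 h5].
split; [|exact: cont_on_expint| |exact: bounded_on_expint|].
- move=> c d u v M dc hM t tuv.
  have [A hA] := h4 M; have [B hB] := h5 M.
  have fA x : u < x < v -> Re (f (c x)) <= `|A|.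
    move=> /hM[k1 k2 _]; apply: (le_trans (ler_norm _)).
    by rewrite (le_trans (normr_Re_le _)) // (le_trans (hA _ k1 k2)) // ler_norm.
  have M0 : 0 <= M by have [_ h _] := hM t tuv; apply: le_trans h; exact: normc_ge0.
  apply: is_cder_eq (is_cder_cint_param
    (f := fun x y => (y ^+ m)%:C * cexp (y%:C * f (c x)))
    (f' := fun x y => (f' (c x) * d x) * ((y ^+ m.+1)%:C * cexp (y%:C * f (c x))))
    (u := u) (v := v) (M := B * M * expR `|A|) _ _ _ tuv) _.
  + by move=> x y _ _; exact: expint_ccont.
  + move=> y x _ xuv.
    apply: is_cder_eq (is_cderZ _ (is_cder_cexp (is_cderZ _ (h1 _ _ _ _ _ dc hM _ xuv)))) _.
    by rewrite exprS rmorphM; ring.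
  + move=> x y xuv y01; have [k1 k2 k3] := hM x xuv.
    rewrite ComplexField.Normc.normcM ler_pM ?normc_ge0 //.
      by rewrite ComplexField.Normc.normcM ler_pM ?normc_ge0 //; exact: hB.
    by apply: normc_expint_integrand => //; exact: fA.
  + rewrite cintZ; last by apply: ccont_cintegrable => y _; exact: expint_ccont.
    by rewrite /expint; ring.
- by apply: cont_onM => //; exact: cont_on_expint.
- by apply: bounded_onM => //; exact: bounded_on_expint.
Qed.

End Regular.

(** * A logarithm off the negative real axis *)

Section Logarithm.
Context {R : realType}.
Implicit Types (a b t u v x y L : R) (z w e : R[i]) (c d : R -> R[i]).
Local Notation normc := (@ComplexField.Normc.normc R).

(** From tan(theta / 2) = sin theta / (1 + cos theta), with numerator and denominator multiplied by
    the modulus. *)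
Definition half_arg a b : R := atan (b / (Num.sqrt (a * a + b * b) + a)).

(* The half-angle formula for the argument is smooth across the positive real
   axis, unlike the formula through [acos]. *)
Definition slit_log z : R[i] :=
  (ln (Re z * Re z + Im z * Im z) / 2) +i* (2 * half_arg (Re z) (Im z)).

(** Off the cut the denominator of [half_arg] does not vanish: if a <= 0 then b is nonzero, so the
    modulus exceeds |a|. *)
Lemma sqrtD_gt0 a b : (b = 0 -> 0 < a) ->
  0 < a * a + b * b /\ 0 < Num.sqrt (a * a + b * b) + a.
Proof.
move=> ab.
have N0 : 0 < a * a + b * b.
  have [/ab a0|b0] := eqVneq b 0; first by nra.
  have b2 : 0 < b * b by rewrite -expr2 exprn_even_gt0.
  by have := sqr_ge0 a; rewrite expr2; lra.
split=> //; set r := Num.sqrt _.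
have r2 : r * r = a * a + b * b by rewrite /r -expr2 sqr_sqrtr // ltW.
have r0 : 0 < r by rewrite sqrtr_gt0.
have [a0|a0] := ltP 0 a; first by lra.
have b0 : 0 < b * b.
  by rewrite -expr2 exprn_even_gt0 //=; apply/eqP => /ab; lra.
by nra.
Qed.

Lemma half_arg_algebra (a b a' b' r : R) : r * r = a * a + b * b -> 0 < r -> 0 < r + a ->
  2 * ((1 + (b / (r + a)) ^+ 2)^-1 *
    (b' * (r + a)^-1 - b * ((r + a) ^- 2 * ((2 * r)^-1 * (2 * (a * a' + b * b')) + a')))) =
  (a * b' - b * a') / (a * a + b * b).
Proof.
move=> r2 r0 ra0.
have r1 : r != 0 by rewrite gt_eqF.
have ra1 : r + a != 0 by rewrite gt_eqF.
have -> : 1 + (b / (r + a)) ^+ 2 = 2 * r / (r + a) + (a * a + b * b - r * r) / (r + a) ^+ 2.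
  by field.
rewrite -r2 subrr mul0r addr0.
(* [field] cannot use the relation between r^2 and a^2 + b^2, so the discrepancy is written as an
   explicit multiple of r^2 - (a^2 + b^2), which is then rewritten to 0. *)
suff -> : 2 * ((2 * r / (r + a))^-1 *
    (b' * (r + a)^-1 - b * ((r + a) ^- 2 * ((2 * r)^-1 * (2 * (a * a' + b * b')) + a')))) =
  (a * b' - b * a') / (r * r) + (r * r - (a * a + b * b)) * (b' / (r * r * (r + a))).
  by rewrite -r2 subrr mul0r addr0.
by field; rewrite r1 ra1.
Qed.

Lemma is_cder_slit_log c t e : is_cder c t e -> (Im (c t) = 0 -> 0 < Re (c t)) ->
  is_cder (fun u => slit_log (c u)) t (e / c t).
Proof.
move=> [h1 h2] pos; have [N0 ra0] := sqrtD_gt0 pos.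
pose N u := Re (c u) * Re (c u) + Im (c u) * Im (c u).
pose r u := Num.sqrt (N u).
have r2 : r t * r t = N t by rewrite /r -expr2 sqr_sqrtr // ltW.
have r0 : 0 < r t by rewrite sqrtr_gt0.
set a := Re (c t); set b := Im (c t).
have dN : is_derive t 1 N (2 * (a * Re e + b * Im e)).
  rewrite (_ : N = (fun u => Re (c u)) * (fun u => Re (c u)) +
     (fun u => Im (c u)) * (fun u => Im (c u))) //.
  apply: (is_derive_eq (is_deriveD (is_deriveM h1 h1) (is_deriveM h2 h2))).
  by rewrite /GRing.scale /= /a /b; ring.
have dl : is_derive t 1 (fun u => ln (N u)) ((N t)^-1 * (2 * (a * Re e + b * Im e))).
  by rewrite (_ : (fun u => _) = (@ln R) \o N) //;
    exact: (@is_derive1_comp R (@ln R) N t _ _ (is_derive1_ln (N0 : 0 < N t)) dN).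
have dr : is_derive t 1 r ((2 * r t)^-1 * (2 * (a * Re e + b * Im e))).
  by rewrite (_ : r = Num.sqrt \o N) //; exact: (@is_derive1_comp R _ N t _ _ (is_derive1_sqrt (N0 : 0 < N t)) dN).
pose q u := r u + Re (c u).
have q0 : q t != 0 by rewrite gt_eqF.
have dq : is_derive t 1 q ((2 * r t)^-1 * (2 * (a * Re e + b * Im e)) + Re e).
  by rewrite (_ : q = r + (fun u => Re (c u))) //; exact: is_deriveD.
have dqV : is_derive t 1 (fun u => (q u)^-1)
   (- (q t) ^- 2 *: ((2 * r t)^-1 * (2 * (a * Re e + b * Im e)) + Re e)).
  exact: (is_deriveV q0 dq).
have dbq : is_derive t 1 (fun u => Im (c u) * (q u)^-1)
  (Im e * (q t)^-1 - b * (q t ^- 2 * ((2 * r t)^-1 * (2 * (a * Re e + b * Im e)) + Re e))).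
  rewrite (_ : (fun u => _) = (fun u => Im (c u)) * (fun u => (q u)^-1)) //.
  apply: (is_derive_eq (is_deriveM h2 dqV)).
  by rewrite /GRing.scale /= -/b; ring.
have da := @is_derive1_comp R (@atan R) (fun u => Im (c u) * (q u)^-1) t _ _
  (is_derive1_atan _) dbq.
have N1 : N t != 0 by rewrite gt_eqF.
have eR : Re (e / c t) = (a * Re e + b * Im e) / N t.
  by rewrite ReM ReV ImV -/a -/b /N !expr2 -/a -/b; field; exact: N1.
have eI : Im (e / c t) = (a * Im e - b * Re e) / N t.
  by rewrite ImM ReV ImV -/a -/b /N !expr2 -/a -/b; field; exact: N1.
split.
- rewrite eR (_ : (fun u => _) = (fun u => ln (N u)) * cst (2^-1)) //.
  apply: (is_derive_eq (is_deriveM dl (is_derive_cst _ _ _))).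
  by rewrite /GRing.scale /=; field; exact: N1.
- rewrite eI (_ : (fun u => _) = cst 2 * (atan \o (fun u => Im (c u) * (q u)^-1))) //.
  apply: (is_derive_eq (is_deriveM (is_derive_cst _ _ _) da)).
  by rewrite /GRing.scale /= mulr0 addr0; exact: half_arg_algebra.
Qed.

(** With r the modulus, (r + a)(r - a) = b^2 and r - a >= - a, so b / (r + a) >= - a / b. The latter
    tends to +oo, where [atan] tends to pi / 2. *)
Lemma half_arg_pi (F : set_system R) {FF : ProperFilter F} (a b : R -> R) :
  a t @[t --> F] --> -oo -> (b t / a t) @[t --> F] --> 0 ->
  (\forall t \near F, 0 < b t) ->
  2 * half_arg (a t) (b t) @[t --> F] --> (pi : R).
Proof.
move=> aN ba b0; have -> : (pi : R) = 2 * (pi / 2) by rewrite mulrC divfK.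
apply: cvgM; first exact: cvg_cst.
apply: (cvg_comp (G := +oo) _ _ _ (@cvgy_atan R)).
apply/cvgryPge => A; near=> t.
have bt : 0 < b t by near: t.
have at0 : a t < 0 by near: t; exact: cvgrNy_lt.
have rt : `|b t / a t| < (`|A| + 1)^-1.
  by near: t; apply: cvgr0_norm_lt => //; rewrite invr_gt0 ltr_wpDl.
have [_ ra0] : 0 < a t * a t + b t * b t /\ 0 < Num.sqrt (a t * a t + b t * b t) + a t.
  by apply: sqrtD_gt0 => h; lra.
rewrite ler_pdivlMr //; apply: (@le_trans _ _ (`|A| * (Num.sqrt (a t * a t + b t * b t) + a t))).
  by rewrite ler_wpM2r ?ler_norm // ltW.
move: rt; rewrite normrM normfV (gtr0_norm bt) (ltr0_norm at0).
rewrite ltr_pdivrMr; last lra.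
have A1 : 0 < `|A| + 1 by rewrite ltr_wpDl.
rewrite mulrC ltr_pdivlMr // => h.
set r := Num.sqrt _ in ra0 *.
have r2 : r * r = a t * a t + b t * b t by rewrite /r -expr2 sqr_sqrtr //; nra.
have A0 := normr_ge0 A.
have h1 : (r + a t) * (r - a t) = b t * b t by nra.
have h2 : - a t <= r - a t by have : 0 <= r := sqrtr_ge0 _; lra.
have h3 : (r + a t) * - a t <= b t * b t by rewrite -h1 ler_wpM2l // ltW.
have h4 : `|A| * (r + a t) * - a t <= `|A| * (b t * b t).
  by rewrite -mulrA ler_wpM2l.
have h5 : `|A| * (b t * b t) <= b t * - a t by nra.
rewrite -(ler_pM2r (_ : 0 < - a t)); last lra.
exact: le_trans h4 h5.
Unshelve. all: by end_near. Qed.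

Lemma half_argN a b : half_arg a (- b) = - half_arg a b.
Proof. by rewrite /half_arg mulrNN mulNr atanN. Qed.

Lemma half_arg_right (F : set_system R) {FF : ProperFilter F} L (a b : R -> R) :
  0 < L ->
  a t @[t --> F] --> -oo -> (b t / a t) @[t --> F] --> 0 ->
  2 * half_arg (L - a t) (- b t) @[t --> F] --> 0.
Proof.
move=> L0 aN ba; rewrite -(mulr0 2); apply: cvgM; first exact: cvg_cst.
rewrite -(@atan0 R); apply: continuous_cvg; first exact: continuous_atan.
apply: norm_cvg0.
have h0 : `|b t / a t| @[t --> F] --> 0.
  by rewrite -(@normr0 _ R); exact: cvg_norm.
apply: (@squeeze_cvgr _ _ _ _ (cst 0) _ _ _ _ _ h0); last exact: cvg_cst.
near=> t; rewrite normr_ge0 /= !normrM !normrN ler_wpM2l // !normfV.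
have at0 : a t < 0 by near: t; exact: cvgrNy_lt.
have r0 : 0 <= Num.sqrt ((L - a t) * (L - a t) + - b t * - b t) := sqrtr_ge0 _.
have d0 : 0 < Num.sqrt ((L - a t) * (L - a t) + - b t * - b t) + (L - a t) by lra.
by rewrite (ltr0_norm at0) (gtr0_norm d0) lef_pV2 ?posrE; lra.
Unshelve. all: by end_near. Qed.

(** The squared moduli differ by L^2 - 2 L a, and ln (1 + u) <= u. Dividing by N >= a^2 with - a >=
    1 gives the bound (L^2 + 2 L) / (- a). *)
Lemma ln_ratio_tends (F : set_system R) {FF : ProperFilter F} L (a b : R -> R) :
  0 < L -> a t @[t --> F] --> -oo ->
  ln (a t * a t + b t * b t) / 2 -
    ln ((L - a t) * (L - a t) + - b t * - b t) / 2 @[t --> F] --> 0.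
Proof.
move=> L0 aN; apply: norm_cvg0.
have h0 : (L ^+ 2 + 2 * L) / - a t @[t --> F] --> 0.
  rewrite -(mulr0 (L ^+ 2 + 2 * L)); apply: cvgM; first exact: cvg_cst.
  apply/gtr0_cvgV0; last exact/cvgNry.
  by apply: filterS (cvgrNy_lt aN 0) => t; rewrite oppr_gt0.
apply: (@squeeze_cvgr _ _ _ _ (cst 0) _ _ _ _ _ h0); last exact: cvg_cst.
near=> t; rewrite normr_ge0 /=.
have at1 : a t <= - 1 by near: t; exact: cvgrNy_le.
set N := a t * a t + b t * b t; set N' := _ + - b t * - b t.
have N1 : a t * a t <= N by rewrite /N; nra.
have N0 : 0 < N by nra.
have E : N' = N + (L ^+ 2 - 2 * L * a t) by rewrite /N' /N; ring.
have d0 : 0 <= L ^+ 2 - 2 * L * a t by nra.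
have N'0 : 0 < N' by rewrite E; lra.
have q1 : 0 < N' / N by rewrite divr_gt0.
have -> : ln N / 2 - ln N' / 2 = - (ln (N' / N) / 2).
  by rewrite ln_div ?posrE //; lra.
have l0 : 0 <= ln (N' / N) by rewrite ln_ge0 // ler_pdivlMr // mul1r E lerDl.
have l1 : ln (N' / N) <= (L ^+ 2 - 2 * L * a t) / N.
  have := @le_ln1Dx R ((L ^+ 2 - 2 * L * a t) / N).
  have -> : 1 + (L ^+ 2 - 2 * L * a t) / N = N' / N.
    by rewrite E; field; rewrite gt_eqF.
  by apply; apply: lt_le_trans (_ : 0 <= _); [lra|rewrite divr_ge0 // ltW].
rewrite normrN ger0_norm; last lra.
apply: (@le_trans _ _ ((L ^+ 2 - 2 * L * a t) / N)); first lra.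
rewrite ler_pdivrMr // [leRHS]mulrAC ler_pdivlMr; last lra.
have h1 : L ^+ 2 * - a t <= L ^+ 2 * N by rewrite ler_wpM2l ?sqr_ge0 //; nra.
have h2 : 2 * L * (a t * a t) <= 2 * L * N by rewrite ler_wpM2l //; lra.
by lra.
Unshelve. all: by end_near. Qed.

End Logarithm.

(** * Integrals over the Hankel contour *)

Section HankelIntegrals.
Context {R : realType}.
Implicit Types (a b t u v x y : R) (z w e : R[i]) (c d : R -> R[i]).
Local Notation normc := (@ComplexField.Normc.normc R).

Definition gaussk y z : R[i] := cexp ((2 * y)%:C * z - z * z).

Lemma piecewise_C1_pcontinuous (h : R -> R) : piecewise_C1 h ->
  continuous h /\ exists s, pcontinuous s (derive1 h) /\
    forall t, t \notin s -> is_derive t 1 h (derive1 h t).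
Proof.
move=> [ch [s [h1 h2]]]; split=> //; exists s; split.
  split=> t; first by move=> /h1[].
  have [/h2//|/h1[_ k]] := boolP (t \in s).
  exact: cvg_at_lr.
by move=> t /h1[k _]; rewrite derive1E; split.
Qed.

Lemma pcontinuous_sub (s s' : seq R) (h : R -> R) : {subset s <= s'} ->
  pcontinuous s h -> pcontinuous s' h.
Proof.
move=> ss [h1 h2]; split=> // t ts; apply: h1; apply: contra ts; exact: ss.
Qed.

Lemma hankel_curve g : hankel_contour g -> exists s,
  [/\ pccont s (curve_deriv g), forall t, ccont g t &
      forall t, t \notin s -> is_cder g t (curve_deriv g t)].
Proof.
move=> [[/piecewise_C1_pcontinuous[c1 [s1 [p1 d1]]]
         /piecewise_C1_pcontinuous[c2 [s2 [p2 d2]]]] _ _ _].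
exists (s1 ++ s2); split.
- split.
    by apply: pcontinuous_sub p1 => t ts; rewrite mem_cat ts.
  by apply: pcontinuous_sub p2 => t ts; rewrite mem_cat ts orbT.
- by move=> t; split; [exact: c1|exact: c2].
- move=> t; rewrite mem_cat negb_or => /andP[t1 t2].
  by split; [exact: d1|exact: d2].
Qed.

(** The derivative is chosen before [U], so that a single one serves all the half-planes a < L. *)
Lemma regular_phase y : exists f', forall U : R[i] -> Prop,
  regular U (fun z => (2 * y)%:C * z - z * z) f'.
Proof.
eexists=> U; apply: regularD.
  by apply: regularM; [exact: regular_cst|exact: regular_id].
by apply: regularN; apply: regularM; exact: regular_id.
Qed.

(** With z = a + i b, the sector gives b^2 <= a^2 / 4, and 2 y a <= a^2 / 4 + 4 y^2 by completing a
    square. Hence the exponent is at most 4 y^2 - a^2 / 2, and e^(- a^2 / 2) <= 2 / a^2. *)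
Lemma gaussk_decay y z : Re z <= - 1 -> `|Im z| <= - Re z / 2 ->
  normc (gaussk y z) <= 2 * expR (4 * y ^+ 2) / Re z ^+ 2.
Proof.
move=> z1; rewrite ler_norml => /andP[zI1 zI2]; rewrite normc_cexp !ReImE /= mul0r subr0.
set a := Re z in z1 zI1 zI2 *; set b := Im z in zI1 zI2 *.
have b2 : b * b <= a ^+ 2 / 4 by nra.
have h : 2 * y * a - (a * a - b * b) <= 4 * y ^+ 2 + - (a ^+ 2 / 2).
  have : 0 <= (a / 2 - 2 * y) ^+ 2 by exact: sqr_ge0.
  by nra.
rewrite (le_trans (_ : _ <= expR (4 * y ^+ 2 + - (a ^+ 2 / 2)))) ?ler_expR //.
rewrite expRD (_ : 2 * _ / _ = expR (4 * y ^+ 2) * (2 / a ^+ 2)); last by ring.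
rewrite ler_pM2l ?expR_gt0 // expRN.
have a2 : 0 < a ^+ 2 by nra.
rewrite -[leRHS]invf_div lef_pV2 ?posrE ?expR_gt0 ?divr_gt0 //.
by apply: le_trans (expR_ge1Dx _); rewrite lerDr.
Qed.

Lemma ccont_slit_log c t : ccont c t -> (Im (c t) = 0 -> 0 < Re (c t)) ->
  ccont (fun u => slit_log (c u)) t.
Proof.
move=> [h1 h2] pos; have [N0 ra0] := sqrtD_gt0 pos.
have cN : {for t, continuous (fun u => Re (c u) * Re (c u) + Im (c u) * Im (c u))}.
  by apply: continuousD; exact: continuousM.
split => /=.
- apply: continuousM; last exact: cvg_cst.
  by apply: (continuous_comp cN); exact: continuous_ln.
- apply: continuousM; first exact: cvg_cst.
  apply: (@continuous_comp _ _ _ (fun u => Im (c u) /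
    (Num.sqrt (Re (c u) * Re (c u) + Im (c u) * Im (c u)) + Re (c u))) atan).
    apply: continuousM => //; apply: continuousV; first by rewrite gt_eqF.
    apply: continuousD => //; apply: (continuous_comp cN).
    exact: sqrt_continuous.
  exact: continuous_atan.
Qed.

Section contour.
Context (g : R -> R[i]) (hg : hankel_contour g) (L : R) (L0 : 0 < L).
Context (gL : forall t, Re (g t) < L).

Lemma hankel_neq0 t : g t != 0.
Proof.
case: hg => _ h _ _; apply/eqP => E; have := h t; rewrite E /= => /(_ erefl).
by rewrite ltxx.
Qed.

Lemma regular_vanish (k k' : R[i] -> R[i]) (C : R) : 0 <= C ->
  (forall a, a < L -> regular (halfplane a) k k') ->
  (forall z, Re z <= - 1 -> `|Im z| <= - Re z / 2 -> normc (k z) <= C / Re z ^+ 2) ->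
  is_cimp (fun t => k (g t) * curve_deriv g t) 0.
Proof.
move=> C0 hk dk; have [s [pd cg dg]] := hankel_curve hg.
case: (hg) => _ _ [m1 m2 _] [p1 p2 _].
by apply: (is_cimp_vanish (k' := k') _ _ _ _ _ C0 ltr01 dk cg pd dg gL L0 p1 m1 p2 m2);
  move=> a /hk[].
Qed.

Lemma is_cimp_gaussk y :
  is_cimp (fun t => gaussk y (g t) * curve_deriv g t) 0.
Proof.
have [f' hf] := regular_phase y.
apply: (regular_vanish (C := 2 * expR (4 * y ^+ 2))
    (k' := fun z => gaussk y z * f' z)).
- by rewrite mulr_ge0 // expR_ge0.
- by move=> a _; apply: regular_cexp.
- exact: gaussk_decay.
Qed.

Lemma halfplane_dist w a z : Re w = L -> halfplane a z -> L - a <= normc (w - z).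
Proof.
move=> wL za; apply: le_trans (normr_Re_le _); apply: le_trans (ler_norm _).
by rewrite !ReImE wL; move: za; rewrite /halfplane; lra.
Qed.

(** The pole [w] lies on the boundary line Re z = L, at distance at least L - a from each smaller
    half-plane, so the translation argument applies as it stands. *)
Lemma is_cimp_gaussk_cauchy y w : Re w = L ->
  is_cimp (fun t => gaussk y (g t) / (w - g t) * curve_deriv g t) 0.
Proof.
move=> wL; have [f' hf] := regular_phase y.
pose k z := gaussk y z * (w - z)^-1.
have [k' hk] : exists k', forall a, a < L -> regular (halfplane a) k k'.
  eexists=> a aL; apply: regularM; first exact: regular_cexp.
  apply: (regularV (r := L - a)); first by rewrite subr_gt0.
    by move=> z; exact: halfplane_dist.
  by apply: regularD; [exact: regular_cst|apply: regularN; exact: regular_id].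
apply: (regular_vanish (k := k) (C := 2 * expR (4 * y ^+ 2)) _ hk).
  by rewrite mulr_ge0 // expR_ge0.
move=> z z1 zI; rewrite /k ComplexField.Normc.normcM ComplexField.Normc.normcV.
have h1 : 1 <= normc (w - z).
  apply: le_trans (halfplane_dist (a := L - 1) wL _); first by lra.
  by have := L0; rewrite /halfplane; lra.
rewrite ler_pdivrMr; last lra.
apply: le_trans (gaussk_decay y z1 zI) _; rewrite ler_peMr //.
by rewrite divr_ge0 ?sqr_ge0 // mulr_ge0 // expR_ge0.
Qed.

(* [(gaussk y z - L / (L - z)) / z], written without its removable singularity. *)
Lemma is_cimp_gaussk_regular y : is_cimp (fun t =>
  (gaussk y (g t) - L%:C / (L%:C - g t)) / g t * curve_deriv g t) 0.
Proof.
have [f' hf] := regular_phase y.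
(* With q = (2 y - z) z one has e^q - 1 = q [expint] 0 q, and (1 - L / (L - z)) / z = - 1 / (L - z).
   The sum of the two quotients by z is [k]. *)
pose k z := ((2 * y)%:C - z) * expint 0 ((2 * y)%:C * z - z * z) - (L%:C - z)^-1.
have LC z : Re z < L -> L%:C - z != 0.
  move=> zL; apply/eqP => /(congr1 (@Re R)); rewrite !ReImE /= => E.
  by move: zL; rewrite -subr_gt0 E ltxx.
have kE z : z != 0 -> Re z < L -> k z = (gaussk y z - L%:C / (L%:C - z)) / z.
  move=> z0 zL; have L1 := LC z zL.
  apply: (mulIf z0); rewrite divfK //.
  have -> : gaussk y z = 1 + ((2 * y)%:C * z - z * z) * expint 0 ((2 * y)%:C * z - z * z).
    by rewrite expint_mul /gaussk; ring.
  by rewrite /k; field.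
have [k' hk] : exists k', forall a, a < L -> regular (halfplane a) k k'.
  eexists=> a aL; apply: regularD.
    apply: regularM; last exact: regular_expint.
    by apply: regularD; [exact: regular_cst|apply: regularN; exact: regular_id].
  apply: regularN; apply: (regularV (r := L - a)); first by rewrite subr_gt0.
    by move=> z; exact: halfplane_dist.
  by apply: regularD; [exact: regular_cst|apply: regularN; exact: regular_id].
apply: (eq_is_cimp (regular_vanish (k := k) (C := 2 * expR (4 * y ^+ 2) + L) _ hk _)) => //.
- by rewrite addr_ge0 ?(ltW L0) // mulr_ge0 // expR_ge0.
- move=> z z1 zI; have z0 : z != 0.
    by apply/eqP => E; move: z1; rewrite E /=; lra.
  rewrite kE //; last by have := L0; lra.
  rewrite ComplexField.Normc.normcM ComplexField.Normc.normcV.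
  have n1 : - Re z <= normc z.
    by apply: le_trans (normr_Re_le _); rewrite -normrN ler_norm.
  have n2 : - Re z <= normc (L%:C - z).
    apply: le_trans (normr_Re_le _); apply: le_trans (ler_norm _).
    by rewrite !ReImE /=; have := L0; lra.
  rewrite ler_pdivrMr; last lra.
  apply: (le_trans (le_normcB _ _)).
  have -> : normc (L%:C / (L%:C - z)) = L / normc (L%:C - z).
    by rewrite ComplexField.Normc.normcM ComplexField.Normc.normcV normc_real (gtr0_norm L0).
  have a2 : 0 < Re z ^+ 2 by nra.
  have h1 : normc (gaussk y z) <= 2 * expR (4 * y ^+ 2) / Re z ^+ 2 * normc z.
    apply: le_trans (gaussk_decay y z1 zI) _; rewrite ler_peMr //; last by lra.
    by rewrite divr_ge0 ?sqr_ge0 // mulr_ge0 // expR_ge0.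
  have h2 : L / normc (L%:C - z) <= L / Re z ^+ 2 * normc z.
    rewrite -mulrA ler_pM2l // ler_pdivlMl //.
    rewrite ler_pdivrMr; last lra.
    by rewrite -sqrrN; apply: ler_pM; lra.
  by rewrite mulrDl mulrDl lerD.
- by move=> t; rewrite kE // hankel_neq0.
Qed.

(** The primitive is log z - log (L - z). Along the contour the argument of z goes from - pi to pi,
    that of L - z tends to 0 at both ends, and the ratio of the moduli tends to 1. *)
Lemma is_cimp_slit_log :
  is_cimp (fun t => L%:C / (g t * (L%:C - g t)) * curve_deriv g t) (2 * pi%:C * 'i%C).
Proof.
have [s [pd cg dg]] := hankel_curve hg.
case: (hg) => _ pos [m1 m2 m3] [p1 p2 p3].
have posL t : Im (L%:C - g t) = 0 -> 0 < Re (L%:C - g t).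
  by move=> _; rewrite !ReImE /=; have := gL t; lra.
have LC t : L%:C - g t != 0.
  apply/eqP => E; have := posL t; rewrite E /= => /(_ erefl); by rewrite ltxx.
pose Q t := slit_log (g t) - slit_log (L%:C - g t).
have dl t e : is_cder g t e -> is_cder Q t (L%:C / (g t * (L%:C - g t)) * e).
  move=> ge.
  have h2 : is_cder (fun t => L%:C - g t) t (- e).
    by apply: is_cder_eq (is_cderB (is_cder_cst _ _) ge) _; rewrite sub0r.
  apply: is_cder_eq (is_cderB (is_cder_slit_log ge (pos t)) (is_cder_slit_log h2 (posL t))) _.
  by field; rewrite hankel_neq0 LC.
have h2 t : ccont (fun t => L%:C - g t) t by apply: ccontB => //; exact: ccont_cst.
have cf t : ccont (fun t => L%:C / (g t * (L%:C - g t))) t.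
  apply: ccontM; first exact: ccont_cst.
  by apply: ccontV; [rewrite mulf_neq0 // hankel_neq0|exact: ccontM].
have QRe : (fun t => Re (Q t)) = fun t =>
   ln (Re (g t) * Re (g t) + Im (g t) * Im (g t)) / 2 -
   ln ((L - Re (g t)) * (L - Re (g t)) + - Im (g t) * - Im (g t)) / 2.
  by apply/funext => t; rewrite /Q /slit_log !ReImE /= add0r.
have QIm : (fun t => Im (Q t)) = fun t =>
   2 * half_arg (Re (g t)) (Im (g t)) - 2 * half_arg (L - Re (g t)) (- Im (g t)).
  by apply/funext => t; rewrite /Q /slit_log !ReImE /= add0r.
have Qp : ctends +oo Q (0 +i* pi).
  split=> /=; first by rewrite QRe; exact: ln_ratio_tends.
  rewrite QIm -[X in _ --> X]subr0.
  by apply: cvgB; [exact: half_arg_pi|exact: half_arg_right].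
have Qm : ctends -oo Q (0 +i* (- pi)).
  split=> /=; first by rewrite QRe; exact: ln_ratio_tends.
  rewrite QIm -[X in _ --> X]subr0; apply: cvgB; last exact: half_arg_right.
  rewrite (_ : (fun t => _) = fun t => - (2 * half_arg (Re (g t)) (- Im (g t)))); last first.
    by apply/funext => t; rewrite half_argN mulrN opprK.
  apply: cvgN; apply: half_arg_pi => //.
    by under eq_fun do rewrite mulNr; rewrite -(@oppr0 R); exact: cvgN.
  by apply: filterS m3 => t; rewrite oppr_gt0.
have cQ t : ccont Q t.
  by apply: ccontB; [exact: ccont_slit_log (cg t) (pos t)|exact: ccont_slit_log (h2 t) (posL t)].
have -> : 2 * pi%:C * 'i%C = (0 +i* pi) - (0 +i* - pi) :> R[i].
  apply: complex_ext; rewrite !ReImE /=; last by ring.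
  by ring.
apply: (is_cimp_ftc (s := s) (g := Q)) => //.
  by apply: pccontM => //; exact: ccont_pccont.
by move=> t /dg; exact: dl.
Qed.

Lemma is_cimp_gaussk_pole y :
  is_cimp (fun t => gaussk y (g t) / g t * curve_deriv g t) (2 * pi%:C * 'i%C).
Proof.
apply: eq_is_cimp (is_cimpD (is_cimp_gaussk_regular y) is_cimp_slit_log) _ _.
  move=> t; have LC : L%:C - g t != 0.
    apply/eqP => /(congr1 (@Re R)); rewrite !ReImE /= => E.
    by have := gL t; rewrite -subr_gt0 E ltxx.
  by field; rewrite hankel_neq0 LC.
by rewrite add0r.
Qed.

(** The integrand is the derivative of e^(2yz - z^2) / z^(m+1) along the curve, and this primitive
    tends to 0 at both ends. It yields a three-term recurrence for the integrals with z^(-m). *)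
Lemma is_cimp_gaussk_deriv y m : is_cimp (fun t =>
  (((2 * y)%:C - 2 * g t) / g t ^+ m.+1 - m.+1%:R / g t ^+ m.+2) * gaussk y (g t)
  * curve_deriv g t) 0.
Proof.
have [s [pd cg dg]] := hankel_curve hg.
case: (hg) => _ pos [m1 m2 m3] [p1 p2 p3].
pose Q t := gaussk y (g t) * (g t ^+ m.+1)^-1.
have g0 n t : g t ^+ n != 0 by rewrite expf_neq0 // hankel_neq0.
have cE t : ccont (fun t => gaussk y (g t)) t.
  apply: ccont_cexp; apply: ccontB; last exact: ccontM.
  by apply: ccontM => //; exact: ccont_cst.
have cX n t : ccont (fun t => (g t ^+ n)^-1) t.
  by apply: ccontV => //; exact: ccontX.
have tends0 (F : set_system R) (FF : ProperFilter F) :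
    Re (g t) @[t --> F] --> -oo -> (Im (g t) / Re (g t)) @[t --> F] --> 0 ->
    ctends F Q 0.
  move=> h1 h2; apply: (@ctends0_le _ _ _ _
     (fun t => 2 * expR (4 * y ^+ 2) / - Re (g t))); last first.
    rewrite -(mulr0 (2 * expR (4 * y ^+ 2))); apply: cvgM; first exact: cvg_cst.
    apply/gtr0_cvgV0; last exact/cvgNry.
    by apply: filterS (cvgrNy_lt h1 0) => t; rewrite oppr_gt0.
  near=> t.
  have t1 : Re (g t) <= - 1 by near: t; exact: cvgrNy_le.
  have t2 : `|Im (g t) / Re (g t)| < 1 / 2.
    by near: t; apply: cvgr0_norm_lt => //; lra.
  have t3 : `|Im (g t)| <= - Re (g t) / 2.
    move: t2; rewrite normrM normfV ltr_pdivrMr; last by rewrite normr_gt0 lt_eqF //; lra.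
    by rewrite (ltr0_norm (x := Re (g t))); lra.
  have n1 : 1 <= normc (g t).
    apply: le_trans (normr_Re_le _); rewrite -normrN.
    by apply: le_trans (ler_norm _); lra.
  rewrite /Q ComplexField.Normc.normcM ComplexField.Normc.normcV normcX.
  have h3 : 1 <= normc (g t) ^+ m.+1 by rewrite exprn_ege1.
  rewrite ler_pdivrMr; last lra.
  have E0 : 0 <= 2 * expR (4 * y ^+ 2) / - Re (g t).
    by rewrite divr_ge0 ?mulr_ge0 ?expR_ge0 //; lra.
  apply: (@le_trans _ _ (2 * expR (4 * y ^+ 2) / - Re (g t))); last by rewrite ler_peMr.
  apply: le_trans (gaussk_decay y t1 t3) _.
  rewrite ler_pM2l ?mulr_gt0 ?expR_gt0 // lef_pV2 ?posrE; [nra|nra|lra].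
rewrite -(subr0 0).
apply: (is_cimp_ftc (s := s) (g := Q)).
- apply: (pccontM _ pd); apply: ccont_pccont => t; apply: ccontM; last exact: cE.
  apply: ccontB; apply: ccontM; [|exact: cX|exact: ccont_cst|exact: cX].
  apply: ccontB; first exact: ccont_cst.
  by apply: ccontM; [exact: ccont_cst|exact: cg].
- by move=> t; apply: ccontM; [exact: cE|exact: cX].
- move=> t /dg gt; rewrite /Q.
  have h2 : is_cder (fun t => (2 * y)%:C * g t - g t * g t) t
      (((2 * y)%:C - 2 * g t) * curve_deriv g t).
    by apply: is_cder_eq (is_cderB (is_cderZ _ gt) (is_cderM gt gt)) _; ring.
  apply: is_cder_eq (is_cderM (is_cder_cexp h2) (is_cderV (g0 m.+1 t) (is_cderX m.+1 gt))) _.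
  rewrite -/(gaussk y (g t)) /= !exprS; field.
  by rewrite hankel_neq0 g0.
- exact: tends0.
- exact: tends0.
Unshelve. all: by end_near. Qed.

End contour.

End HankelIntegrals.

(** * Hermite polynomials and the residues of e^(2yz - z^2) / z^m *)

Section HermitePolynomials.
Context {R : realType}.
Implicit Types (x y : R) (m n : nat).

Fixpoint hermite n : {poly R} :=
  if n is m.+1 then 2 *: 'X * hermite m - (hermite m)^`() else 1.

Lemma deriv_hermite n : (hermite n.+1)^`() = (2 * n.+1%:R) *: hermite n.
Proof.
elim: n => [|n IH].
  by rewrite /= mulr1 derivB derivZ derivX !derivC subr0 mulr1.
have -> : hermite n.+2 = 2 *: 'X * hermite n.+1 - (hermite n.+1)^`() by [].
rewrite derivB derivM derivZ derivX IH derivZ.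
have -> : hermite n.+1 = 2 *: 'X * hermite n - (hermite n)^`() by [].
rewrite -!mul_polyC -[n.+2%:R]natr1 !polyCM polyCD.
by ring.
Qed.

Lemma hermiteSS n :
  hermite n.+2 = 2 *: 'X * hermite n.+1 - (2 * n.+1%:R) *: hermite n.
Proof. by rewrite -deriv_hermite. Qed.

Lemma hermiteSS_horner n y : (hermite n.+2).[y] =
  2 * y * (hermite n.+1).[y] - 2 * n.+1%:R * (hermite n).[y].
Proof. by rewrite hermiteSS !hornerE. Qed.

Lemma hermite_size_lead n :
  size (hermite n) = n.+1 /\ lead_coef (hermite n) = 2 ^+ n.
Proof.
elim: n => [|n [IH1 IH2]]; first by rewrite size_poly1 lead_coef1.
have p2 : (2 : R) != 0 by rewrite pnatr_eq0.
have h0 : hermite n != 0 by rewrite -size_poly_eq0 IH1.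
have s1 : size (2 *: 'X * hermite n) = n.+2.
  by rewrite -scalerAl size_scale // mulrC size_mulX // IH1.
have s2 : (size (- (hermite n)^`()) < size (2 *: 'X * hermite n)%R)%N.
  by rewrite size_polyN s1 (leq_ltn_trans (size_poly _ _)) // IH1.
split; first by rewrite /= size_polyDl.
rewrite /= lead_coefDl // -scalerAl lead_coefZ lead_coefM lead_coefX mul1r IH2.
by rewrite exprS.
Qed.

Lemma size_hermite n : size (hermite n) = n.+1.
Proof. by case: (hermite_size_lead n). Qed.

(* The residue at 0 of [gaussk y z / z ^ m]. *)
Definition hankel_coef y m : R :=
  if m is m'.+1 then (hermite m').[y] / m'`!%:R else 0.

(** The Hermite three-term recurrence divided by factorials; it has the shape of the recurrence for
    the contour integrals, and the value 0 at m = 0 fits it. *)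
Lemma hankel_coefSS y m : hankel_coef y m.+2 =
  m.+1%:R^-1 * (2 * y * hankel_coef y m.+1 - 2 * hankel_coef y m).
Proof.
have n0 k : k.+1%:R != 0 :> R by rewrite pnatr_eq0.
have f0 k : k`!%:R != 0 :> R by rewrite pnatr_eq0 -lt0n fact_gt0.
case: m => [|m]; first by rewrite /= !hornerE /= fact0 !derivC !hornerE /= !divr1 invr1; ring.
rewrite /hankel_coef hermiteSS_horner !factS !natrM.
move: (n0 m.+1) (n0 m) (f0 m).
move: (m.+2%:R) (m.+1%:R) (m`!%:R) => a b c a0 b0 c0; field.
by rewrite a0 b0 c0.
Qed.

End HermitePolynomials.

Section HankelPowers.
Context {R : realType}.
Context (g : R -> R[i]) (hg : hankel_contour g) (L : R) (L0 : 0 < L).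
Context (gL : forall t, Re (g t) < L).

(** Two-step induction: the vanishing integral of a derivative gives (m + 1) I(m + 2) = 2 y I(m + 1)
    - 2 I(m), started by the pole-free case I(0) = 0 and the simple pole I(1). *)
Lemma is_cimp_gaussk_pow y m :
  is_cimp (fun t => gaussk y (g t) / g t ^+ m * curve_deriv g t)
    (2 * pi%:C * 'i%C * (hankel_coef y m)%:C).
Proof.
suff : is_cimp (fun t => gaussk y (g t) / g t ^+ m * curve_deriv g t)
    (2 * pi%:C * 'i%C * (hankel_coef y m)%:C) /\
  is_cimp (fun t => gaussk y (g t) / g t ^+ m.+1 * curve_deriv g t)
    (2 * pi%:C * 'i%C * (hankel_coef y m.+1)%:C) by case.
elim: m => [|m [IH1 IH2]].
  split.
    apply: eq_is_cimp (is_cimp_gaussk hg L0 gL y) _ _ => [t|].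
      by rewrite expr0 divr1.
    by rewrite mulr0.
  apply: eq_is_cimp (is_cimp_gaussk_pole hg L0 gL y) _ _ => [t|].
    by rewrite expr1.
  by rewrite /= hornerE fact0 divr1 mulr1.
split=> //.
have g0 n t : g t ^+ n != 0 by rewrite expf_neq0 // (hankel_neq0 hg).
have m0 : m.+1%:R != 0 :> R[i] by rewrite pnatr_eq0.
have h := is_cimpZ (m.+1%:R^-1) (is_cimpD (is_cimpD (is_cimpZ (2 * y)%:C IH2)
  (is_cimpZ (- 2) IH1)) (is_cimpZ (- 1) (is_cimp_gaussk_deriv hg y m))).
apply: eq_is_cimp h _ _ => [t|].
  rewrite !exprS; move: (m.+1%:R) m0 (g t ^+ m) (g0 m t) => k k0 w w0; field.
  by rewrite k0 w0 (hankel_neq0 hg).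
rewrite hankel_coefSS; move: (hankel_coef y m.+1) (hankel_coef y m) => p q.
rewrite !rmorphM rmorphB !rmorphM fmorphV !rmorph_nat.
by ring.
Qed.

End HankelPowers.

(** * Integrals over a vertical line *)

Section VerticalLine.
Context {R : realType}.
Implicit Types (a b s t u v x T : R).
Local Notation normc := (@ComplexField.Normc.normc R).
Local Notation gauss := (@gauss_fun R).

Lemma curve_deriv_vertical (L t : R) : curve_deriv (vertical_line L) t = 'i%C.
Proof.
apply: complex_ext; rewrite /curve_deriv /vertical_line /= derive1E.
  by rewrite derive_cst.
by rewrite derive_id.
Qed.

Lemma is_cder_vertical s t : is_cder (fun t => s +i* t) t 'i%C.
Proof.
rewrite (_ : (fun t => _) = fun t => s%:C + t%:C * 'i%C); first exact: is_cder_addi.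
by apply/funext => u; apply: complex_ext; rewrite !ReImE /=; ring.
Qed.

Lemma is_cder_horizontal s t : is_cder (fun s => s +i* t) s 1.
Proof.
rewrite (_ : (fun t => _) = fun s => (0 +i* t) + s%:C * 1); first exact: is_cder_addi.
by apply/funext => u; apply: complex_ext; rewrite !ReImE /=; ring.
Qed.

Definition gaussz s t : R[i] := cexp ((s +i* t) * (s +i* t)).

Lemma normc_gaussz s t : normc (gaussz s t) = expR (s ^+ 2 - t ^+ 2).
Proof. by rewrite normc_cexp /= -!expr2. Qed.

Lemma is_cder_gaussz_v s t : is_cder (gaussz s) t (gaussz s t * (2 * (s +i* t) * 'i%C)).
Proof.
apply: is_cder_eq (is_cder_cexp (is_cderM (is_cder_vertical s t) (is_cder_vertical s t))) _.
by rewrite /gaussz; ring.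
Qed.

Lemma is_cder_gaussz_h s t : is_cder (gaussz ^~ t) s (gaussz s t * (2 * (s +i* t))).
Proof.
apply: is_cder_eq (is_cder_cexp (is_cderM (is_cder_horizontal s t) (is_cder_horizontal s t))) _.
by rewrite /gaussz; ring.
Qed.

(** The Cauchy-Riemann equation: differentiating under the integral in [s] produces the
    [t]-derivative of [gaussz s], which integrates to the endpoint values. [B] bounds |Re| + |Im|
    for abscissas in []s - 1, s + 1[] and ordinates in [[a, b]]. *)
Lemma is_cder_gaussz_int a b s : a <= b ->
  is_cder (fun s => cint a b (fun t => gaussz s t * 'i%C)) s (gaussz s b - gaussz s a).
Proof.
move=> ab; pose B := (`|s| + 1) + (`|a| + `|b|).
have cv x t : ccont (fun t => gaussz x t * (2 * (x +i* t)) * 'i%C) t.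
  apply: ccontM; last exact: ccont_cst.
  apply: ccontM; first exact: is_cder_ccont (is_cder_gaussz_v _ _).
  by apply: ccontM; [exact: ccont_cst|exact: is_cder_ccont (is_cder_vertical _ _)].
apply: is_cder_eq (is_cder_cint_param (f := fun s t => gaussz s t * 'i%C)
   (f' := fun s t => gaussz s t * (2 * (s +i* t)) * 'i%C)
   (u := s - 1) (v := s + 1) (M := expR (B ^+ 2) * (2 * B)) _ _ _ _) _.
- move=> x t _ _; apply: ccontM; last exact: ccont_cst.
  exact: is_cder_ccont (is_cder_gaussz_v _ _).
- move=> t x _ _.
  apply: is_cder_eq (is_cderM (is_cder_gaussz_h x t) (is_cder_cst _ _)) _.
  by rewrite mulr0 addr0.
- move=> x t /andP[x1 x2] /andP[t1 t2].
  have i1 : normc 'i%C = 1 by rewrite /= expr0n add0r expr1n sqrtr1.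
  rewrite (ComplexField.Normc.normcM (gaussz x t * _)) (ComplexField.Normc.normcM (gaussz x t)).
  rewrite i1 mulr1 normc_gaussz (ComplexField.Normc.normcM 2).
  have n2 : normc 2 = 2 by rewrite -[2]/(2%:R) -(rmorph_nat (real_complex R)) normc_real ger0_norm.
  have xB : `|x| <= `|s| + 1.
    by rewrite ler_norml; have := ler_norm s; have := ler_norm (- s); rewrite normrN; lra.
  have tB : `|t| <= `|a| + `|b|.
    rewrite ler_norml; have := ler_norm b; have := ler_norm (- a); rewrite normrN.
    by have := normr_ge0 a; have := normr_ge0 b; lra.
  have s0 := normr_ge0 s; have a0 := normr_ge0 a; have b0 := normr_ge0 b.
  apply: ler_pM; rewrite ?expR_ge0 ?mulr_ge0 ?normc_ge0 //.
    rewrite ler_expR.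
    have : x ^+ 2 <= B ^+ 2.
      by rewrite -(real_normK (num_real x)) lerXn2r ?nnegrE //; rewrite /B; lra.
    by have := sqr_ge0 t; lra.
  rewrite n2 ler_pM2l // (le_trans (normc_le_ReIm _)) //= /B; lra.
- by apply/andP; split; lra.
- rewrite (cint_ftc (g := gaussz s)) //.
  by move=> t _; apply: is_cder_eq (is_cder_gaussz_v s t) _; ring.
Qed.

(** Cauchy's theorem on a rectangle, by integrating the previous derivative from [x] to [y]. *)
Lemma gaussz_rectangle x y a b : x <= y -> a <= b ->
  cint a b (fun t => gaussz y t * 'i%C) - cint a b (fun t => gaussz x t * 'i%C) =
  cint x y (gaussz ^~ b) - cint x y (gaussz ^~ a).
Proof.
move=> xy ab.
have ch t s : ccont (gaussz ^~ t) s by exact: is_cder_ccont (is_cder_gaussz_h _ _).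
rewrite -(cint_ftc (f := fun s => gaussz s b - gaussz s a)
  (g := fun s => cint a b (fun t => gaussz s t * 'i%C)) xy); last 2 first.
- by move=> s _; exact: ccontB.
- by move=> s _; exact: is_cder_gaussz_int.
rewrite -[- cint x y _]mulN1r -cintZ; last by apply: ccont_cintegrable.
rewrite -cintD; [|exact: ccont_cintegrable|].
  by congr cint; apply/funext => s; rewrite mulN1r.
by apply: cintegrableZ; exact: ccont_cintegrable.
Qed.

Lemma gauss_cvg0 (F : set_system R) : F = +oo \/ F = -oo -> gauss x @[x --> F] --> 0.
Proof.
case=> ->; first exact: cvg_gauss_fun.
apply/cvgNy_compNP; rewrite (_ : gauss \o _ = gauss); first exact: cvg_gauss_fun.
by apply/funext => x; rewrite /gauss_fun /= sqrrN.
Qed.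

Lemma gaussz_side x y (F : set_system R) {FF : ProperFilter F} :
  F = +oo \/ F = -oo -> x <= y -> ctends F (fun t => cint x y (gaussz ^~ t)) 0.
Proof.
move=> hF xy; pose B := `|x| + `|y|.
apply: (@ctends0_le _ _ _ _ (fun t => 2 * ((y - x) * expR (B ^+ 2)) * gauss t)); last first.
  rewrite -(mulr0 (2 * ((y - x) * expR (B ^+ 2)))); apply: cvgM; first exact: cvg_cst.
  exact: gauss_cvg0.
apply: nearW => t.
apply: (le_trans (normc_cint_le (k := fun=> expR (B ^+ 2) * gauss t) _ _ _)).
- by apply: ccont_cintegrable => s _; exact: is_cder_ccont (is_cder_gaussz_h _ _).
- by apply: continuous_rintegrable; apply: continuous_subspaceT => s; exact: cvg_cst.
- move=> s /andP[s1 s2]; rewrite normc_gaussz /gauss_fun -expRD ler_expR.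
  rewrite lerD2r -(real_normK (num_real s)) lerXn2r ?nnegrE // ?addr_ge0 //.
  rewrite ler_norml /B; have := ler_norm y; have := ler_norm (- x); rewrite normrN.
  by have := normr_ge0 x; have := normr_ge0 y; lra.
rewrite /rint Rintegral_cst //= lebesgue_measure_itv /=.
case: ifP => [_|]; last by rewrite mulr0 mulr0 // => _; rewrite !mulr_ge0 ?expR_ge0 // subr_ge0.
by rewrite -EFinB /=; nra.
Qed.

Lemma ctendsN (F : set_system R) {FF : ProperFilter F} (f : R -> R[i]) z :
  ctends F f z -> ctends F (fun t => - f t) (- z).
Proof.
by move=> h; rewrite -mulN1r; under eq_fun do rewrite -mulN1r; exact: ctendsZ.
Qed.

(** The horizontal sides at infinity vanish. The side on the real axis, [K], remains: it changes the
    lower half integral by [K] and the upper one by [- K], so the total is preserved. *)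
Lemma is_cimp_gaussz_shift x y z : x <= y ->
  is_cimp (fun t => gaussz x t * 'i%C) z <-> is_cimp (fun t => gaussz y t * 'i%C) z.
Proof.
move=> xy.
have ci s a b : cintegrable a b (fun t => gaussz s t * 'i%C).
  apply: ccont_cintegrable => t _; apply: ccontM; last exact: ccont_cst.
  exact: is_cder_ccont (is_cder_gaussz_v _ _).
pose K := cint x y (gaussz ^~ 0).
pose G s a b := cint a b (fun t => gaussz s t * 'i%C).
have hp : ctends +oo (fun b => G y 0 b - G x 0 b) (- K).
  apply: (@ctends_near _ _ _ (fun b => cint x y (gaussz ^~ b) + (- K))).
    near=> b; have b0 : 0 <= b by near: b; exact: nbhs_pinfty_ge.
    by rewrite /G gaussz_rectangle.
  rewrite -[X in ctends _ _ X]add0r; apply: ctendsD; last exact: ctends_cst.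
  by apply: gaussz_side => //; left.
have hm : ctends -oo (fun b => G y b 0 - G x b 0) K.
  apply: (@ctends_near _ _ _ (fun b => K - cint x y (gaussz ^~ b))).
    near=> b; have b0 : b <= 0 by near: b; exact: nbhs_ninfty_le.
    by rewrite /G gaussz_rectangle.
  rewrite -[X in ctends _ _ X]subr0; apply: ctendsD; first exact: ctends_cst.
  by apply: ctendsN; apply: gaussz_side => //; right.
split=> -[_ [z1 [z2 [-> h1 h2]]]]; split=> //.
- exists (K + z1), (- K + z2); split; first by ring.
    apply: (@ctends_near _ _ _ (fun b => (G y b 0 - G x b 0) + G x b 0)).
      by apply: nearW => b; rewrite subrK.
    exact: ctendsD.
  apply: (@ctends_near _ _ _ (fun b => (G y 0 b - G x 0 b) + G x 0 b)).
    by apply: nearW => b; rewrite subrK.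
  exact: ctendsD.
- exists (- K + z1), (- - K + z2); split; first by ring.
    apply: (@ctends_near _ _ _ (fun b => - (G y b 0 - G x b 0) + G y b 0)).
      by apply: nearW => b; rewrite opprB subrK.
    by apply: ctendsD => //; exact: ctendsN.
  apply: (@ctends_near _ _ _ (fun b => - (G y 0 b - G x 0 b) + G y 0 b)).
    by apply: nearW => b; rewrite opprB subrK.
  by apply: ctendsD => //; exact: ctendsN.
Unshelve. all: by end_near. Qed.

Lemma rint0_gauss_cvg : rint 0 b gauss @[b --> +oo] --> Num.sqrt pi / 2.
Proof.
have h := @gauss_integral.gauss_integral_proof.cvg_integral0_gauss_sqr R.
have {h} h : Num.sqrt (rint 0 b gauss ^+ 2) @[b --> +oo] --> Num.sqrt (pi / 4).
  by apply: continuous_cvg => //; exact: sqrt_continuous.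
move: h; rewrite sqrtrM ?pi_ge0 // sqrtrV // (_ : 4 = 2 ^+ 2 :> R); last first.
  by rewrite expr2 -natrM.
rewrite sqrtr_sqr ger0_norm // (_ : (fun _ => Num.sqrt _) = fun b => rint 0 b gauss) //.
apply/funext => r; rewrite sqrtr_sqr ger0_norm //.
by apply: Rintegral_ge0 => t _; exact: gauss_fun_ge0.
Qed.

Lemma rint_gauss_opp b : rint b 0 gauss = rint 0 (- b) gauss.
Proof.
have [b0|b0] := leP b 0; last first.
  rewrite /rint !set_itv_ge ?Rintegral_set0 // bnd_simp -ltNge //.
  by rewrite oppr_lt0.
have b0' : 0 <= - b by rewrite oppr_ge0.
have := @integration_by_substitution_oppr R gauss 0 (- b) b0'.
rewrite opprK oppr0 /rint /Rintegral => ->.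
  by congr fine; apply: eq_integral => t _; rewrite /gauss_fun /= sqrrN.
by apply: continuous_subspaceT; exact: continuous_gauss_fun.
Qed.

Lemma ctends_real (F : set_system R) {FF : ProperFilter F} (h : R -> R) (l : R) :
  h t @[t --> F] --> l -> ctends F (fun t => (h t)%:C) l%:C.
Proof. by move=> hl; split=> //=; exact: cvg_cst. Qed.

Lemma is_cimp_gauss : is_cimp (fun t => (gauss t)%:C) (Num.sqrt pi)%:C.
Proof.
have cg t : ccont (fun t => (gauss t)%:C) t.
  by split=> /=; [exact: continuous_gauss_fun|exact: cvg_cst].
have E a b : cint a b (fun t => (gauss t)%:C) = (rint a b gauss)%:C.
  by apply: complex_ext => //=; rewrite /rint Rintegral_cst //= mul0r.
split=> [a b|]; first exact: ccont_cintegrable.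
exists (Num.sqrt pi / 2)%:C, (Num.sqrt pi / 2)%:C; split.
- by rewrite -rmorphD /= -splitr.
- rewrite (_ : (fun b => _) = fun b => (rint 0 (- b) gauss)%:C); last first.
    by apply/funext => b; rewrite E rint_gauss_opp.
  apply: ctends_real; apply/(cvgNy_compNP (fun b => rint 0 (- b) gauss)).
  rewrite (_ : _ \o _ = fun b => rint 0 b gauss); first exact: rint0_gauss_cvg.
  by apply/funext => b /=; rewrite opprK.
- rewrite (_ : (fun b => _) = fun b => (rint 0 b gauss)%:C); last first.
    by apply/funext => b; rewrite E.
  by apply: ctends_real; exact: rint0_gauss_cvg.
Qed.

Lemma is_cimp_gaussz s : is_cimp (fun t => gaussz s t * 'i%C) ('i%C * (Num.sqrt pi)%:C).
Proof.
have h0 : is_cimp (fun t => gaussz 0 t * 'i%C) ('i%C * (Num.sqrt pi)%:C).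
  apply: eq_is_cimp (is_cimpZ 'i%C is_cimp_gauss) _ _ => // t.
  rewrite mulrC; congr (_ * _); rewrite /gaussz /gauss_fun -cexp_real; congr cexp.
  by apply: complex_ext; rewrite /= ?expr2; ring.
have [s0|/ltW s0] := leP 0 s.
  by apply/(is_cimp_gaussz_shift _ s0).
by apply/(is_cimp_gaussz_shift _ s0).
Qed.

(** One term of the exponential series gives e^(t^2) >= t^(2(n+1)) / (n+1)!, and |t|^(n+1) <=
    t^(2(n+1)) as |t| >= 1. *)
Lemma norm_expX_gauss n t : 1 <= `|t| ->
  `|t| ^+ n * gauss t <= (n.+1)`!%:R / `|t|.
Proof.
move=> t1; have t0 : 0 < `|t| by lra.
have f0 : 0 < (n.+1)`!%:R :> R by rewrite ltr0n fact_gt0.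
have h := @expR_ge1Dxn R (t ^+ 2) n (sqr_ge0 t).
have h1 : (t ^+ 2) ^+ n.+1 / (n.+1)`!%:R <= expR (t ^+ 2) by lra.
rewrite /gauss_fun expRN ler_pdivrMr ?expR_gt0 //.
rewrite mulrAC ler_pdivlMr // -exprSr.
apply: le_trans (_ : (t ^+ 2) ^+ n.+1 <= _).
  rewrite -(real_normK (num_real t)) -exprM mulnC.
  by apply: ler_weXn2l => //; rewrite leq_pmulr.
by move: h1; rewrite ler_pdivrMr // mulrC.
Qed.

End VerticalLine.

(** * Moments of e^(w^2 - 2xw) along the vertical line *)

Section VerticalMoments.
Context {R : realType}.
Implicit Types (s t x L : R).
Local Notation normc := (@ComplexField.Normc.normc R).
Local Notation gauss := (@gauss_fun R).

Definition gaussw x (w : R[i]) : R[i] := cexp (w * w - (2 * x)%:C * w).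

Lemma normc_gaussw x L t : normc (gaussw x (L +i* t)) =
  expR (L ^+ 2 - 2 * x * L) * gauss t.
Proof.
by rewrite normc_cexp /gauss_fun -expRD; congr expR; rewrite !ReImE /=; ring.
Qed.

(** The integrand is the derivative of e^(w^2 - 2xw) w^j along the line, where this primitive tends
    to 0 at both ends. *)
Lemma is_cimp_gaussw_deriv x L j : is_cimp (fun t =>
  ((2 * (L +i* t) - (2 * x)%:C) * (L +i* t) ^+ j + j%:R * (L +i* t) ^+ j.-1) *
   gaussw x (L +i* t) * 'i%C) 0.
Proof.
pose w t := L +i* t; pose Q t := gaussw x (w t) * w t ^+ j.
have dw t : is_cder w t 'i%C by exact: is_cder_vertical.
have cw t : ccont w t := is_cder_ccont (dw t).
have dg t : is_cder (fun t => gaussw x (w t)) t (gaussw x (w t) * ((2 * w t - (2 * x)%:C) * 'i%C)).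
  apply: is_cder_eq (is_cder_cexp (is_cderB (is_cderM (dw t) (dw t)) (is_cderZ _ (dw t)))) _.
  by rewrite /gaussw; ring.
have cg t : ccont (fun t => gaussw x (w t)) t := is_cder_ccont (dg t).
have dQ t : is_cder Q t (((2 * w t - (2 * x)%:C) * w t ^+ j + j%:R * w t ^+ j.-1) *
   gaussw x (w t) * 'i%C).
  by apply: is_cder_eq (is_cderM (dg t) (is_cderX j (dw t))) _; ring.
have tends0 (F : set_system R) (FF : ProperFilter F) :
    (\forall t \near F, 1 <= `|t|) -> `|t|^-1 @[t --> F] --> 0 -> ctends F Q 0.
  move=> F1 F0.
  pose C := expR (L ^+ 2 - 2 * x * L) * (`|L| + 1) ^+ j * (j.+1)`!%:R.
  apply: (@ctends0_le _ _ _ _ (fun t => C * `|t|^-1)); last first.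
    by rewrite -(mulr0 C); apply: cvgM => //; exact: cvg_cst.
  near=> t; have t1 : 1 <= `|t| by near: t.
  rewrite /Q ComplexField.Normc.normcM normcX normc_gaussw.
  have wt : normc (w t) <= (`|L| + 1) * `|t|.
    apply: (le_trans (normc_le_ReIm _)) => /=.
    by have := normr_ge0 L; nra.
  have wj : normc (w t) ^+ j <= (`|L| + 1) ^+ j * `|t| ^+ j.
    by rewrite -exprMn lerXn2r ?nnegrE ?normc_ge0 // mulr_ge0 // addr_ge0.
  have h := norm_expX_gauss j t1.
  have e0 := expR_ge0 (L ^+ 2 - 2 * x * L).
  have L1 : 0 <= (`|L| + 1) ^+ j by rewrite exprn_ge0 // addr_ge0.
  rewrite /C -!mulrA ler_wpM2l //.
  apply: (@le_trans _ _ (gauss t * ((`|L| + 1) ^+ j * `|t| ^+ j))).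
    by rewrite ler_wpM2l // gauss_fun_ge0.
  rewrite mulrCA ler_wpM2l //; by rewrite mulrC.
rewrite -(subr0 (0 : R[i])); apply: (is_cimp_ftc (s := [::]) (g := Q)).
- apply: ccont_pccont => t; apply: ccontM; last exact: ccont_cst.
  apply: ccontM; last exact: cg.
  apply: ccontD; apply: ccontM; [|exact: ccontX|exact: ccont_cst|exact: ccontX].
  by apply: ccontB; [apply: ccontM; [exact: ccont_cst|exact: cw]|exact: ccont_cst].
- by move=> t; exact: is_cder_ccont (dQ t).
- by move=> t _; exact: dQ.
- apply: tends0.
    near=> t; apply: le_trans (ler_norm _); near: t; exact: nbhs_pinfty_ge.
  apply/gtr0_cvgV0.
    near=> t; rewrite normr_gt0 gt_eqF //; near: t; exact: nbhs_pinfty_gt.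
  apply/cvgryPge => A; near=> t; apply: le_trans (ler_norm _); near: t.
  by apply: nbhs_pinfty_ge; exact: num_real.
- apply: tends0.
    near=> t; rewrite -normrN; apply: le_trans (ler_norm _).
    rewrite lerNr; near: t; exact: nbhs_ninfty_le.
  apply/gtr0_cvgV0.
    near=> t; rewrite normr_gt0 lt_eqF //; near: t; exact: nbhs_ninfty_lt.
  apply/cvgryPge => A; near=> t; rewrite -normrN; apply: le_trans (ler_norm _).
  by rewrite lerNr; near: t; apply: nbhs_ninfty_le; exact: num_real.
Unshelve. all: by end_near. Qed.

Definition line_moment x j : R[i] :=
  'i%C * (Num.sqrt pi * expR (- x ^+ 2) * ((hermite j).[x] / 2 ^+ j))%:C.

(** The zeroth moment is the Gaussian integral after completing the square, w^2 - 2xw = (w - x)^2 -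
    x^2. The derivative identity then gives the recurrence of the monic Hermite polynomials H_j /
    2^j. *)
Lemma is_cimp_gaussw_pow x L j :
  is_cimp (fun t => gaussw x (L +i* t) * (L +i* t) ^+ j * 'i%C) (line_moment x j).
Proof.
have H0 : is_cimp (fun t => gaussw x (L +i* t) * (L +i* t) ^+ 0 * 'i%C) (line_moment x 0).
  apply: eq_is_cimp (is_cimpZ (cexp (- x ^+ 2)%:C) (is_cimp_gaussz (L - x))) _ _.
    move=> t; rewrite expr0 mulr1 mulrA; congr (_ * _); rewrite /gaussz /gaussw -cexpD.
    by congr cexp; apply: complex_ext; rewrite !ReImE /=; ring.
  have h0 : (hermite 0).[x] / 2 ^+ 0 = 1 by rewrite /= hornerE expr0 divr1.
  by rewrite /line_moment h0 mulr1 cexp_real !rmorphM; ring.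
suff : is_cimp (fun t => gaussw x (L +i* t) * (L +i* t) ^+ j * 'i%C) (line_moment x j) /\
  is_cimp (fun t => gaussw x (L +i* t) * (L +i* t) ^+ j.+1 * 'i%C) (line_moment x j.+1).
  by case.
have t2 : (2 : R[i]) != 0 by rewrite pnatr_eq0.
elim: j => [|j [IH1 IH2]]; split=> //.
  apply: eq_is_cimp (is_cimpZ 2^-1 (is_cimpD (is_cimp_gaussw_deriv x L 0)
    (is_cimpZ (2 * x)%:C H0))) _ _.
    by move=> t; rewrite !expr0 expr1; field.
  have h0 : (hermite 0).[x] / 2 ^+ 0 = 1 by rewrite /= hornerE expr0 divr1.
  have h1 : (hermite 1).[x] / 2 ^+ 1 = x.
    by rewrite /= derivC !hornerE /= expr1; field.
  rewrite /line_moment h0 h1 mulr1.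
  by rewrite !rmorphM rmorph_nat; field.
apply: eq_is_cimp (is_cimpZ 2^-1 (is_cimpD (is_cimp_gaussw_deriv x L j.+1)
    (is_cimpD (is_cimpZ (2 * x)%:C IH2) (is_cimpZ (- j.+1%:R) IH1)))) _ _.
  by move=> t /=; rewrite !exprS; field.
rewrite /line_moment hermiteSS_horner.
have -> : (2 * x * (hermite j.+1).[x] - 2 * j.+1%:R * (hermite j).[x]) / 2 ^+ j.+2 =
  2^-1 * (2 * x * ((hermite j.+1).[x] / 2 ^+ j.+1) - j.+1%:R * ((hermite j).[x] / 2 ^+ j)).
  have p2 : 2 ^+ j != 0 :> R by rewrite expf_neq0 // pnatr_eq0.
  by rewrite !exprS; field.
move: ((hermite j.+1).[x] / 2 ^+ j.+1) ((hermite j).[x] / 2 ^+ j) => p q.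
rewrite !rmorphM rmorphB !rmorphM fmorphV !rmorph_nat.
by field.
Qed.

End VerticalMoments.

(** * Two by two matrices and their exponentials *)

Section TwoByTwo.
Context {K : nmodType}.

Lemma mx2P (M : 'M[K]_2) : M = mx2 (M 0 0) (M 0 1) (M 1 0) (M 1 1).
Proof.
apply/matrixP => i j; rewrite mxE.
have h (k : 'I_2) : k = if k == ord0 then 0 else 1.
  by case: eqP => [->//|/eqP]; case: k => [[|[|k]] hk] //= _; exact: val_inj.
by rewrite {1}(h i) {1}(h j); do 2 case: ifP.
Qed.

Lemma mx2E (a b c d : K) : (mx2 a b c d 0 0 = a) * (mx2 a b c d 0 1 = b) *
  (mx2 a b c d 1 0 = c) * (mx2 a b c d 1 1 = d).
Proof. by rewrite !mxE. Qed.

Lemma eq_mx2 (M N : 'M[K]_2) : M 0 0 = N 0 0 -> M 0 1 = N 0 1 ->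
  M 1 0 = N 1 0 -> M 1 1 = N 1 1 -> M = N.
Proof. by move=> h1 h2 h3 h4; rewrite (mx2P M) (mx2P N) h1 h2 h3 h4. Qed.

Lemma forall_ord2 (P : 'I_2 -> 'I_2 -> Prop) :
  P 0 0 -> P 0 1 -> P 1 0 -> P 1 1 -> forall i j, P i j.
Proof.
move=> h1 h2 h3 h4 i j.
have h (k : 'I_2) : k = 0 \/ k = 1.
  by case: k => [[|[|k]] hk] //; [left|right]; exact: val_inj.
by case: (h i) => ->; case: (h j) => ->.
Qed.

End TwoByTwo.

Section TwoByTwoRing.
Context {K : comNzRingType}.

Lemma mulmx2 (a b c d a' b' c' d' : K) :
  mx2 a b c d *m mx2 a' b' c' d' =
  mx2 (a * a' + b * c') (a * b' + b * d') (c * a' + d * c') (c * b' + d * d').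
Proof.
by apply: eq_mx2; rewrite mxE !big_ord_recl big_ord0 addr0 !mx2E -?[lift _ _]/(1 : 'I_2);
  rewrite (_ : lift ord0 ord0 = 1) ?mx2E //; exact: val_inj.
Qed.

Lemma scale_mx2 (k a b c d : K) : k *: mx2 a b c d = mx2 (k * a) (k * b) (k * c) (k * d).
Proof. by apply: eq_mx2; rewrite mxE !mx2E. Qed.

Lemma add_mx2 (a b c d a' b' c' d' : K) :
  mx2 a b c d + mx2 a' b' c' d' = mx2 (a + a') (b + b') (c + c') (d + d').
Proof. by apply: eq_mx2; rewrite mxE !mx2E. Qed.

Lemma one_mx2 : 1%:M = mx2 1 0 0 1 :> 'M[K]_2.
Proof. by apply: eq_mx2; rewrite mxE !mx2E. Qed.

Lemma det_mx2 (a b c d : K) : \det (mx2 a b c d) = a * d - b * c.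
Proof.
rewrite (expand_det_row _ 0) !big_ord_recl big_ord0 addr0 /cofactor !det_mx11 !mxE /=.
by rewrite expr0 mul1r expr1 mulN1r mulrN.
Qed.

End TwoByTwoRing.

Lemma map_mx2 (aR rR : nmodType) (f : aR -> rR) (a b c d : aR) :
  map_mx f (mx2 a b c d) = mx2 (f a) (f b) (f c) (f d).
Proof. by apply: eq_mx2; rewrite mxE !mx2E. Qed.

Section MatrixExponential.
Context {K : numFieldType}.

Lemma expmx_nilpotent (M : 'M[K]_2) : M *m M = 0 -> expmx M = 1 + M.
Proof.
move=> M2; apply: cvg_lim => //; apply: cvg_near_cst.
apply: filterS (nbhs_infty_ge 2) => -[|[|n]] // _.
rewrite /series /= big_mkord !big_ord_recl /= !expr0 expr1 !fact0 factS fact0 invr1 !scale1r.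
rewrite big1 ?addr0 // => i _; rewrite -[bump 0 (bump 0 i)]/(i.+2).
by rewrite !exprS mulrA (_ : M * M = 0) ?mul0r ?scaler0.
Qed.

Lemma expmx_diag (a e : K) :
  (forall eps : K, 0 < eps -> \forall n \near \oo,
     `|e - \sum_(k < n) (k`!%:R)^-1 * a ^+ k| < eps) ->
  expmx (mx2 a 0 0 0) = mx2 e 0 0 1.
Proof.
move=> /cvgrPdist_lt he; apply: cvg_lim => //.
have aX k : mx2 a 0 0 0 ^+ k.+1 = a ^+ k.+1 *: mx2 1 0 0 0.
  elim: k => [|k IH]; first by rewrite !expr1 scale_mx2 !mulr0 mulr1.
  rewrite exprS IH [X in X = _](_ : _ = mx2 a 0 0 0 *m (a ^+ k.+1 *: mx2 1 0 0 0)) //.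
  by rewrite !scale_mx2 mulmx2 !mulr0 !mul0r !addr0 !mulr1 -exprS.
(* The term k = 0 is the identity and alone feeds the lower right corner, whence the index
   [n.+1]. *)
have E n : series (fun k => (k`!%:R : K)^-1 *: mx2 a 0 0 0 ^+ k) n.+1 =
   (\sum_(k < n.+1) (k`!%:R)^-1 * a ^+ k) *: mx2 1 0 0 0 + mx2 0 0 0 1.
  rewrite /series /= big_mkord !big_ord_recl /= !expr0 fact0 invr1 mulr1 scale1r scalerDl.
  rewrite addrAC scale1r add_mx2 !addr0 add0r -[1]/(1%:M) one_mx2; congr +%R.
  rewrite scaler_suml; apply: eq_bigr => k _.
  by rewrite -[bump 0 _]/(k.+1) aX scalerA.
have -> : mx2 e 0 0 1 = e *: mx2 1 0 0 0 + mx2 0 0 0 1 :> 'M[K]_2.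
  by rewrite scale_mx2 add_mx2 !mulr0 !addr0 mulr1 add0r.
pose S n : 'M[K]_2 := (\sum_(k < n) (k`!%:R)^-1 * a ^+ k) *: mx2 1 0 0 0 + mx2 0 0 0 1.
have : S @ \oo --> (e *: mx2 1 0 0 0 + mx2 0 0 0 1 : 'M[K]_2).
  by apply: cvgD; [exact: cvgZr_tmp|exact: cvg_cst].
apply: cvg_trans; apply: near_eq_cvg.
by apply: filterS (nbhs_infty_ge 1) => -[|n] // _; rewrite E.
Qed.

End MatrixExponential.

(** * The exponential series, the logarithm and matrix powers of complex numbers *)

Section ComplexExponentialSeries.
Context {R : realType}.
Implicit Types (z w : R[i]).
Local Notation normc := (@ComplexField.Normc.normc R).

Definition exp_sum n z : R[i] := \sum_(k < n) (k`!%:R)^-1 * z ^+ k.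

Lemma is_cder_exp_sum n z t :
  is_cder (fun x => exp_sum n.+1 (x%:C * z)) t (exp_sum n (t%:C * z) * z).
Proof.
have dz : is_cder (fun x => x%:C * z) t z.
  by have := is_cder_addi 0 z t; under eq_fun do rewrite add0r.
elim: n => [|n IH].
  rewrite /exp_sum big_ord0 mul0r.
  under eq_fun do rewrite big_ord1 expr0 mulr1; exact: is_cder_cst.
rewrite (_ : (fun x => _) = fun x => exp_sum n.+1 (x%:C * z) +
   (n.+1`!%:R)^-1 * (x%:C * z) ^+ n.+1); last first.
  by apply/funext => x; rewrite /exp_sum big_ord_recr.
apply: is_cder_eq (is_cderD IH (is_cderZ _ (is_cderX n.+1 dz))) _.
rewrite [in RHS]/exp_sum big_ord_recr /= -/(exp_sum n _) mulrDl; congr (_ + _).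
have n0 : n.+1%:R != 0 :> R[i] by rewrite pnatr_eq0.
have f0 : n`!%:R != 0 :> R[i] by rewrite pnatr_eq0 -lt0n fact_gt0.
rewrite factS natrM.
move: (n.+1%:R) (n`!%:R) n0 f0 ((t%:C * z) ^+ n) => p q p0 q0 r.
by field; rewrite p0 q0.
Qed.

(** Links [expmx], a series, to [cexp], given by cos and sin. With S the partial sum, the derivative
    of S(tz) e^(-tz) in t telescopes to - z (tz)^n / n! e^(-tz), so S(z) e^(-z) - 1 is a small
    integral over [[0, 1]]. *)
Lemma normc_exp_sum_sub n z :
  normc (exp_sum n.+1 z - cexp z) <=
  2 * expR (2 * normc z) * (normc z * exp_coeff (normc z) n).
Proof.
have dz t : is_cder (fun x => x%:C * z) t z.
  by have := is_cder_addi 0 z t; under eq_fun do rewrite add0r.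
pose G t := exp_sum n.+1 (t%:C * z) * cexp (- (t%:C * z)).
pose G' t : R[i] := (- z * (n`!%:R)^-1) * ((t%:C * z) ^+ n * cexp (- (t%:C * z))).
have dE t : is_cder (fun t => cexp (- (t%:C * z))) t (cexp (- (t%:C * z)) * - z).
  exact: is_cder_cexp (is_cderN (dz t)).
have dG t : is_cder G t (G' t).
  apply: is_cder_eq (is_cderM (is_cder_exp_sum n z t) (dE t)) _.
  by rewrite /G' [in X in _ + X]/exp_sum big_ord_recr /= -/(exp_sum n _); ring.
have cG' t : ccont G' t.
  apply: ccontM; first exact: ccont_cst.
  apply: ccontM; last exact: is_cder_ccont (dE t).
  by apply: ccontX; exact: is_cder_ccont (dz t).
have := cint_ftc (ler01 : 0 <= 1 :> R) (fun t _ => cG' t) (fun t _ => dG t).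
rewrite /G mul0r oppr0 cexp0 mulr1 mul1r.
have -> : exp_sum n.+1 0 = 1.
  rewrite /exp_sum big_ord_recl /= expr0 fact0 invr1 mulr1 big1 ?addr0 // => i _.
  by rewrite -[bump 0 _]/(i.+1) expr0n /= mulr0.
move=> h.
have -> : exp_sum n.+1 z - cexp z = (exp_sum n.+1 z * cexp (- z) - 1) * cexp z.
  by rewrite cexpN; field; exact: cexp_neq0.
rewrite -h ComplexField.Normc.normcM normc_cexp.
have nz := normc_ge0 z.
have bz : normc (cint 0 1 G') <= 2 * (normc z * exp_coeff (normc z) n * expR (normc z)).
  apply: (le_trans (normc_cint_le
    (k := fun=> normc z * exp_coeff (normc z) n * expR (normc z)) _ _ _)).
  - by apply: ccont_cintegrable.
  - by apply: continuous_rintegrable; apply: continuous_subspaceT => t; exact: cvg_cst.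
  - move=> t /andP[t0 t1]; rewrite /G'.
    rewrite (ComplexField.Normc.normcM (- z * _)) (ComplexField.Normc.normcM (- z)).
    rewrite (ComplexField.Normc.normcM (_ ^+ n)) normcN ComplexField.Normc.normcV normcX.
    rewrite -(rmorph_nat (real_complex R)) normc_real ger0_norm ?ler0n //.
    rewrite normc_cexp (ComplexField.Normc.normcM t%:C) normc_real ger0_norm //.
    rewrite /exp_coeff /= -!mulrA ler_wpM2l // [X in _ <= X]mulrCA ler_wpM2l ?invr_ge0 ?ler0n //.
    apply: ler_pM; rewrite ?expR_ge0 ?exprn_ge0 ?mulr_ge0 //.
      by rewrite lerXn2r ?nnegrE ?mulr_ge0 // ler_piMl.
    rewrite ler_expR !ReImE /= mul0r subr0.
    have := normr_Re_le z; have := ler_norm (- Re z); rewrite normrN.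
    by have := normr_ge0 (Re z); nra.
  rewrite /rint Rintegral_cst //= lebesgue_measure_itv /= lte01 oppr0 adde0.
  by rewrite mulr1.
have ez : expR (Re z) <= expR (normc z).
  by rewrite ler_expR (le_trans (ler_norm _)) // normr_Re_le.
apply: (le_trans (ler_pM (normc_ge0 _) (expR_ge0 _) bz ez)).
rewrite (_ : 2 * normc z = normc z + normc z); last by ring.
by rewrite expRD le_eqVlt; apply/orP; left; apply/eqP; ring.
Qed.

Lemma expmx_cexp z : expmx (mx2 z 0 0 0) = mx2 (cexp z) 0 0 1.
Proof.
(* In the order of [R[i]], 0 < e forces [e] to be real; the estimate is then a real one on
   [normc]. *)
apply: expmx_diag => e; rewrite ltcE /= => /andP[/eqP e0 e1].
have h : 2 * expR (2 * normc z) * (normc z * exp_coeff (normc z) n) @[n --> \oo] --> 0.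
  rewrite -(mulr0 (2 * expR (2 * normc z))); apply: cvgM; first exact: cvg_cst.
  rewrite -(mulr0 (normc z)); apply: cvgM; first exact: cvg_cst.
  exact: cvg_exp_coeff.
suff : \forall n \near \oo, `|cexp z - exp_sum n.+1 z| < e.
  by move=> [N _ hN]; exists N.+1 => // -[|n] // /hN.
apply: filterS (cvgr_lt _ h _ e1) => n hn.
rewrite distrC ltcE /= e0 eqxx /=.
by apply: le_lt_trans hn; exact: normc_exp_sum_sub.
Qed.

(** [acos] yields the right cosine and |Im z| / |z| as sine; the sign chosen in [carg] restores that
    of Im z. Points of the cut are included. *)
Lemma cexp_clog z : z != 0 -> cexp (clog z) = z.
Proof.
move=> z0; have n0 : 0 < normc z by rewrite normc_gt0.
have nn : normc z != 0 by rewrite gt_eqF.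
rewrite /cexp /clog /= lnK ?posrE //.
have c1 : - 1 <= Re z / normc z <= 1.
  by rewrite -ler_norml normrM normfV (ger0_norm (ltW n0)) ler_pdivrMr // mul1r normr_Re_le.
have ca : cos (acos (Re z / normc z)) = Re z / normc z.
  by rewrite acosK // in_itv.
have sa : sin (acos (Re z / normc z)) = `|Im z| / normc z.
  rewrite sin_acos // -[RHS](ger0_norm (_ : 0 <= _)); last by rewrite divr_ge0 // ltW.
  rewrite -sqrtr_sqr; congr Num.sqrt.
  rewrite !expr_div_n real_normK ?num_real // normc_sqr.
  by field; rewrite -normc_sqr expf_neq0.
have -> : cos (carg z) = Re z / normc z.
  by rewrite /carg; case: ifP => _; rewrite ?cosN ca.
have -> : sin (carg z) = Im z / normc z.
  rewrite /carg; case: ifPn => h; rewrite ?sinN sa; first by rewrite ger0_norm.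
  by rewrite ltr0_norm ?mulNr ?opprK // ltNge.
by apply: complex_ext; rewrite !ReImE /=; field.
Qed.

(** The eigenvalues of J are integers, so the branch of the logarithm disappears. *)
Lemma cpowmx_J z : z != 0 -> cpowmx z (mx2 1 0 0 0) = mx2 z 0 0 1.
Proof.
by move=> z0; rewrite /cpowmx scale_mx2 !mulr0 mulr1 expmx_cexp cexp_clog.
Qed.

Lemma cpowmx_NJ z : z != 0 -> cpowmx z (- mx2 1 0 0 0) = mx2 z^-1 0 0 1.
Proof.
move=> z0; rewrite /cpowmx -scaleN1r scale_mx2 scale_mx2 !mulr0 mulr1 mulrN1.
by rewrite expmx_cexp cexpN cexp_clog.
Qed.

End ComplexExponentialSeries.

(** * The double contour integral *)

Section ContourSide.
Context {R : realType}.
Implicit Types (z w : R[i]).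
Context (nu x y : R) (n : nat).

Local Notation D := (1 + n%:R / 2 * nu ^+ 2).
Local Notation c := (n%:R * nu / 2).

Lemma mxB_det_gt0 : 0 < D.
Proof. by rewrite ltr_pwDl // mulr_ge0 ?sqr_ge0 // divr_ge0 ?ler0n. Qed.

Lemma det_mxB : \det (mxB n nu) = D.
Proof. by rewrite /mxB det_mx2; field. Qed.

Lemma invmx_mxB : invmx (map_mx (real_complex R) (mxB n nu)) =
  mx2 (D%:C)^-1 (nu%:C / D%:C) (- (c%:C / D%:C)) (D%:C)^-1.
Proof.
have D0 : D%:C != 0 :> R[i].
  by rewrite (inj_eq (@complexI R) _ 0) gt_eqF // mxB_det_gt0.
have DE : D%:C = 1 + nu%:C * c%:C :> R[i].
  by rewrite -rmorphM -(rmorph1 (real_complex R)) -rmorphD; congr (_%:C); field.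
set B := map_mx _ _; set B' := mx2 _ _ _ _.
have BB : B *m B' = 1%:M.
  rewrite /B /mxB map_mx2 /B' mulmx2 one_mx2.
  have -> : (- nu)%:C = - nu%:C by exact: rmorphN.
  rewrite rmorph1.
  move: D0; rewrite DE; move: (nu%:C) (c%:C) => p q pq.
  by congr mx2; field.
have [Bu _] := mulmx1_unit BB.
by rewrite -[LHS]mulmx1 -BB mulKmx.
Qed.

(* The expansion (w/z)^m / (w - z) = 1/(w - z) + \sum_(j < m) w^j / z^(j+1). *)
Definition cauchy_sum m w z : R[i] :=
  gaussk y z / (w - z) + \sum_(j < m) w ^+ j * (gaussk y z / z ^+ j.+1).

Lemma cauchy_sumE m w z : z != 0 -> w != z ->
  gaussk y z * (w / z) ^+ m / (w - z) = cauchy_sum m w z.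
Proof.
move=> z0 wz; have d0 : w - z != 0 by rewrite subr_eq0.
elim: m => [|m IH]; first by rewrite /cauchy_sum big_ord0 addr0 expr0 mulr1.
rewrite /cauchy_sum big_ord_recr /= addrA -/(cauchy_sum m w z) -IH.
rewrite !expr_div_n !exprS; have zm : z ^+ m != 0 by rewrite expf_neq0.
move: (z ^+ m) (w ^+ m) zm => p q p0; field.
by rewrite z0 d0 p0.
Qed.

(** With c = n nu / 2, the product of the two conjugates is 1/D times the matrix with rows (1 + nu c
    z/w, nu (w - z)) and (c (w - z)/(z w), 1 + nu c w/z). Multiplied by (w/z)^n / (w - z), the
    diagonal keeps the Cauchy factor with exponents n and n -+ 1, and off the diagonal it
    cancels. *)
Definition CD_entry w z : 'M[R[i]]_2 := mx2
  (gaussw x w * (D%:C)^-1 * (cauchy_sum n w z + (nu * c)%:C * cauchy_sum n.-1 w z))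
  (gaussw x w * (nu / D)%:C * w ^+ n * (gaussk y z / z ^+ n))
  (gaussw x w * (c / D)%:C * w ^+ n.-1 * (gaussk y z / z ^+ n.+1))
  (gaussw x w * (D%:C)^-1 * (cauchy_sum n w z + (nu * c)%:C * cauchy_sum n.+1 w z)).

Lemma CD_integrandE w z : w != 0 -> z != 0 -> w != z ->
  CD_integrand n nu x y w z = CD_entry w z.
Proof.
move=> w0 z0 wz; have d0 : w - z != 0 by rewrite subr_eq0.
have D0 : D%:C != 0 :> R[i].
  by rewrite (inj_eq (@complexI R) _ 0) gt_eqF // mxB_det_gt0.
have DE : D%:C = 1 + nu%:C * c%:C :> R[i].
  by rewrite -rmorphM -(rmorph1 (real_complex R)) -rmorphD; congr (_%:C); field.
rewrite /CD_integrand !cpowmx_J // !cpowmx_NJ // invmx_mxB /mxB map_mx2 rmorph1.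
have -> : (- nu)%:C = - nu%:C by exact: rmorphN.
have -> : cexp (w ^+ 2 - 2 * x%:C * w - z ^+ 2 + 2 * z * y%:C + n%:R * clog (w / z)) =
    gaussw x w * (gaussk y z * (w / z) ^+ n).
  rewrite -[X in _ * (_ * X ^+ _)]cexp_clog ?mulf_neq0 ?invr_eq0 // -cexpMn /gaussw /gaussk.
  by rewrite -!cexpD; congr cexp; rewrite !rmorphM rmorph_nat; ring.
rewrite !mulmx2 scale_mx2 /CD_entry -!cauchy_sumE //.
have -> : (nu * c)%:C = nu%:C * c%:C by exact: rmorphM.
have -> : (nu / D)%:C = nu%:C / D%:C by rewrite rmorphM fmorphV.
have -> : (c / D)%:C = c%:C / D%:C by rewrite rmorphM fmorphV.
move: (gaussw x w) (gaussk y z) => G g.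
(* For n = 0 the truncated [n.-1] is 0 instead of -1, but its terms carry the factor n nu / 2 =
   0. *)
have [n0|n_gt0] := posnP n.
  have c0 : c%:C = 0 by rewrite n0 !mul0r.
  rewrite DE c0 n0 /= mulr0 addr0 !expr0 !expr1.
  by congr mx2; field; rewrite ?z0 ?w0 ?d0.
have zp : z ^+ n.-1 != 0 by rewrite expf_neq0.
have zE : z ^+ n = z * z ^+ n.-1 by rewrite -exprS prednK.
have wE : w ^+ n = w * w ^+ n.-1 by rewrite -exprS prednK.
rewrite !expr_div_n !exprS zE wE.
move: D0; rewrite DE.
move: (nu%:C) (c%:C) (z ^+ n.-1) (w ^+ n.-1) zp => p q u v u0 pq.
have r0 : 2 + n%:R * (nu%:C * nu%:C) != 0.
  rewrite -(rmorph_nat (real_complex R) n) -(rmorph_nat (real_complex R) 2) -!rmorphM -rmorphD.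
  rewrite (inj_eq (@complexI R) _ 0) gt_eqF //.
  have : 0 <= n%:R * (nu * nu) by rewrite mulr_ge0 ?ler0n // -expr2 sqr_ge0.
  by lra.
by congr mx2; field; rewrite ?pq ?z0 ?w0 ?d0 ?u0 ?r0.
Qed.

Local Notation h j := ((hermite j).[x] / 2 ^+ j).
Local Notation A m := (hankel_coef y m).

(** The scalar Hermite kernel, sum of H_j(y) H_j(x) / (2^j j!), without the factor 1 / sqrt(pi) and
    the Gaussians. *)
Definition kernel_sum m : R := \sum_(j < m) A j.+1 * h j.

(** The closed form at which the contour side and the kernel side meet. *)
Definition kernel_entries : 'M[R]_2 := mx2
  ((kernel_sum n + nu * c * kernel_sum n.-1) / D)
  (nu / D * (A n * h n)) (c / D * (A n.+1 * h n.-1))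
  ((kernel_sum n + nu * c * kernel_sum n.+1) / D).

Section contour.
Context (g : R -> R[i]) (hg : hankel_contour g) (L : R) (L0 : 0 < L).
Context (gL : forall t, Re (g t) < L).

Local Notation c0 := (2 * pi%:C * 'i%C).

Definition moment_sum m w : R[i] := \sum_(j < m) w ^+ j * (A j.+1)%:C.

Lemma is_cimp_cauchy_sum m w : Re w = L ->
  is_cimp (fun t => cauchy_sum m w (g t) * curve_deriv g t) (c0 * moment_sum m w).
Proof.
move=> wL.
have hs := @is_cimp_sum R m
  (fun j t => w ^+ j * (gaussk y (g t) / g t ^+ j.+1 * curve_deriv g t))
  (fun j => w ^+ j * (c0 * (A j.+1)%:C))
  (fun j _ => is_cimpZ (w ^+ j) (is_cimp_gaussk_pow hg L0 gL y j.+1)).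
apply: eq_is_cimp (is_cimpD (is_cimp_gaussk_cauchy hg L0 gL y wL) hs) _ _.
  move=> t; rewrite /cauchy_sum mulrDl; congr (_ + _).
  by rewrite mulr_suml; apply: eq_bigr => j _; rewrite mulrA.
by rewrite add0r /moment_sum mulr_sumr; apply: eq_bigr => j _; ring.
Qed.

Definition inner_entry w : 'M[R[i]]_2 := mx2
  (gaussw x w * (D%:C)^-1 * (c0 * moment_sum n w + (nu * c)%:C * (c0 * moment_sum n.-1 w)))
  (gaussw x w * (nu / D)%:C * w ^+ n * (c0 * (A n)%:C))
  (gaussw x w * (c / D)%:C * w ^+ n.-1 * (c0 * (A n.+1)%:C))
  (gaussw x w * (D%:C)^-1 * (c0 * moment_sum n w + (nu * c)%:C * (c0 * moment_sum n.+1 w))).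

Lemma is_cimp_inner w i j : Re w = L ->
  is_cimp (fun t => CD_integrand n nu x y w (g t) i j * curve_deriv g t) (inner_entry w i j).
Proof.
move=> wL.
have E t : CD_integrand n nu x y w (g t) = CD_entry w (g t).
  apply: CD_integrandE; last 2 first.
  - exact: hankel_neq0.
  - by apply/eqP => E; have := gL t; rewrite -E wL ltxx.
  by apply/eqP => w0; move: wL; rewrite w0 /=; have := L0; lra.
have hc m := is_cimp_cauchy_sum m wL.
have hp m := is_cimp_gaussk_pow hg L0 gL y m.
move: i j; apply: forall_ord2; rewrite mx2E.
- apply: eq_is_cimp (is_cimpZ _ (is_cimpD (hc n) (is_cimpZ (nu * c)%:C (hc n.-1)))) _ (erefl _).
  by move=> t; rewrite E mx2E; ring.
- apply: eq_is_cimp (is_cimpZ _ (hp n)) _ (erefl _).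
  by move=> t; rewrite E mx2E mulrA.
- apply: eq_is_cimp (is_cimpZ _ (hp n.+1)) _ (erefl _).
  by move=> t; rewrite E mx2E mulrA.
- apply: eq_is_cimp (is_cimpZ _ (is_cimpD (hc n) (is_cimpZ (nu * c)%:C (hc n.+1)))) _ (erefl _).
  by move=> t; rewrite E mx2E; ring.
Qed.

Local Notation k0 := ('i%C * (Num.sqrt pi * expR (- x ^+ 2))%:C).

Lemma is_cimp_moment_sum m : is_cimp
  (fun t => gaussw x (L +i* t) * moment_sum m (L +i* t) * 'i%C) (k0 * (kernel_sum m)%:C).
Proof.
have hs := @is_cimp_sum R m
  (fun j t => (A j.+1)%:C * (gaussw x (L +i* t) * (L +i* t) ^+ j * 'i%C))
  (fun j => (A j.+1)%:C * line_moment x j)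
  (fun j _ => is_cimpZ (A j.+1)%:C (is_cimp_gaussw_pow x L j)).
apply: eq_is_cimp hs _ _.
  move=> t; rewrite /moment_sum mulr_sumr mulr_suml; apply: eq_bigr => j _.
  by ring.
rewrite /kernel_sum rmorph_sum mulr_sumr; apply: eq_bigr => j _.
rewrite /line_moment; move: (Num.sqrt pi * expR _) (A j.+1) (h j) => e a b.
by rewrite !rmorphM; ring.
Qed.

Lemma is_cimp_outer i j :
  is_cimp (fun t => inner_entry (L +i* t) i j * 'i%C)
    (c0 * k0 * (kernel_entries i j)%:C).
Proof.
have hm := is_cimp_moment_sum; have hp := is_cimp_gaussw_pow x L.
have E1 (p q r d : R) : ((p + q * r) / d)%:C = (p%:C + q%:C * r%:C) / d%:C.
  by rewrite rmorphM fmorphV rmorphD rmorphM.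
have E2 (p q r : R) : (p * (q * r))%:C = p%:C * (q%:C * r%:C) by rewrite !rmorphM.
have E3 (p q : R) : (p * q)%:C = p%:C * q%:C by rewrite rmorphM.
move: i j; apply: forall_ord2; rewrite mx2E.
- apply: eq_is_cimp (is_cimpZ ((D%:C)^-1 * c0) (is_cimpD (hm n) (is_cimpZ (nu * c)%:C (hm n.-1)))) _ _.
    by move=> t; rewrite mx2E; ring.
  by rewrite E1; ring.
- apply: eq_is_cimp (is_cimpZ ((nu / D)%:C * c0 * (A n)%:C) (hp n)) _ _.
    by move=> t; rewrite mx2E; ring.
  rewrite /line_moment E2 (E3 (Num.sqrt pi * _)).
  by move: ((Num.sqrt pi * _)%:C) ((nu / D)%:C) ((A n)%:C) ((h n)%:C) => ? ? ? ?; ring.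
- apply: eq_is_cimp (is_cimpZ ((c / D)%:C * c0 * (A n.+1)%:C) (hp n.-1)) _ _.
    by move=> t; rewrite mx2E; ring.
  rewrite /line_moment E2 (E3 (Num.sqrt pi * _)).
  by move: ((Num.sqrt pi * _)%:C) ((c / D)%:C) ((A n.+1)%:C) ((h n.-1)%:C) => ? ? ? ?; ring.
- apply: eq_is_cimp (is_cimpZ ((D%:C)^-1 * c0) (is_cimpD (hm n) (is_cimpZ (nu * c)%:C (hm n.+1)))) _ _.
    by move=> t; rewrite mx2E; ring.
  by rewrite E1; ring.
Qed.

Lemma contour_inner w i j : Re w = L ->
  contour_cvg g (fun z => CD_integrand n nu x y w z i j) /\
  contour_int g (fun z => CD_integrand n nu x y w z i j) = inner_entry w i j.
Proof. by move=> wL; apply: is_cimp_contour; exact: is_cimp_inner. Qed.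

Lemma contour_intmx_inner w : Re w = L ->
  contour_intmx g (CD_integrand n nu x y w) = inner_entry w.
Proof.
by move=> wL; apply/matrixP => i j; rewrite mxE; case: (contour_inner i j wL).
Qed.

Lemma contour_outer i j :
  let F w := contour_intmx g (CD_integrand n nu x y w) i j in
  contour_cvg (vertical_line L) F /\
  contour_int (vertical_line L) F = c0 * k0 * (kernel_entries i j)%:C.
Proof.
apply: is_cimp_contour; apply: eq_is_cimp (is_cimp_outer i j) _ (erefl _) => t.
by rewrite contour_intmx_inner // curve_deriv_vertical.
Qed.

(** The constants combine as 2 / (2 pi i)^2 times 2 pi i times i sqrt(pi), which is 1 / sqrt(pi),
    and e^((x^2 - y^2)/2) e^(-x^2) becomes symmetric in x and y. *)
Lemma contour_side :
  (2 / c0 ^+ 2 * cexp (((x ^+ 2 - y ^+ 2) / 2)%:C)) *: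
    contour_intmx (vertical_line L)
      (fun w => contour_intmx g (CD_integrand n nu x y w)) =
  map_mx (real_complex R)
    ((expR (- (x ^+ 2 + y ^+ 2) / 2) / Num.sqrt pi) *: kernel_entries).
Proof.
move: kernel_entries contour_outer => K hK.
apply/matrixP => i j; rewrite !mxE; have [_ ->] := hK i j.
have E : expR ((x ^+ 2 - y ^+ 2) / 2) * expR (- x ^+ 2) = expR (- (x ^+ 2 + y ^+ 2) / 2).
  by rewrite -expRD; congr expR; field.
have p0 : Num.sqrt pi != 0 :> R by rewrite gt_eqF // sqrtr_gt0 pi_gt0.
have p2 : pi = Num.sqrt pi * Num.sqrt pi :> R by rewrite -expr2 sqr_sqrtr // pi_ge0.
have q0 : (Num.sqrt pi)%:C != 0 :> R[i] by rewrite (inj_eq (@complexI R) _ 0).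
have i0 : 'i%C != 0 :> R[i] by apply/eqP => /(congr1 (@Im R)) /= /eqP; rewrite oner_eq0.
rewrite -E cexp_real.
have E1 (a b d e : R) : (a * b / d * e)%:C = a%:C * b%:C / d%:C * e%:C.
  by rewrite !rmorphM fmorphV.
have E2 (a b : R) : (a * b)%:C = a%:C * b%:C by rewrite rmorphM.
have -> : pi%:C = (Num.sqrt pi)%:C * (Num.sqrt pi)%:C :> R[i] by rewrite -E2 -p2.
rewrite E1 E2; move: ((Num.sqrt pi)%:C) ('i%C) q0 i0 => q k q0 i0.
by field; rewrite q0 i0.
Qed.

End contour.

End ContourSide.

(** * Hermite polynomials and the Gaussian weight *)

Section GaussianFunctional.
Context {R : realType}.
Implicit Types (p q : {poly R}).
Local Notation mu := (@lebesgue_measure R).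
Local Notation gauss := (@gauss_fun R).

Definition gauss_pairing p : R := \int[mu]_x (p.[x] * gauss x).

(** Half of the Gaussian absorbs the power, through |t^n| <= 1 + t^(2n) and t^(2n) <= 2^n n!
    e^(t^2/2); the other half is an integrable majorant. *)
Lemma expX_gauss_le n (t : R) : `|t ^+ n * gauss t| <=
  (1 + 2 ^+ n * n`!%:R) * expR (- (t ^+ 2 / 2)).
Proof.
rewrite normrM (ger0_norm (gauss_fun_ge0 _)).
have t2 : 0 <= t ^+ 2 / 2 by rewrite divr_ge0 ?sqr_ge0.
have E : gauss t = expR (- (t ^+ 2 / 2)) * expR (- (t ^+ 2 / 2)).
  by rewrite /gauss_fun -expRD; congr expR; field.
rewrite E mulrA ler_wpM2r ?expR_ge0 // expRN ler_pdivrMr ?expR_gt0 //.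
have e1 : 1 <= expR (t ^+ 2 / 2) by rewrite -[X in X <= _]expR0 ler_expR.
have h : (t ^+ 2) ^+ n <= 2 ^+ n * n`!%:R * expR (t ^+ 2 / 2).
  case: n => [|n]; first by rewrite !expr0 fact0 !mul1r.
  have := @expR_ge1Dxn R (t ^+ 2 / 2) n t2.
  have f0 : 0 < (n.+1)`!%:R :> R by rewrite ltr0n fact_gt0.
  have w0 : 0 < 2 ^+ n.+1 :> R by rewrite exprn_gt0.
  rewrite expr_div_n => h1.
  have : (t ^+ 2) ^+ n.+1 / 2 ^+ n.+1 / n.+1`!%:R <= expR (t ^+ 2 / 2) by lra.
  rewrite ler_pdivrMr // ler_pdivrMr // => h3; apply: le_trans h3 _.
  by rewrite le_eqVlt; apply/orP; left; apply/eqP; ring.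
have h2 : `|t ^+ n| <= 1 + (t ^+ 2) ^+ n.
  rewrite -exprM mulnC exprM -(real_normK (num_real (t ^+ n))).
  by have := sqr_ge0 (`|t ^+ n| - 1); have := normr_ge0 (t ^+ n); nra.
by apply: (le_trans h2); rewrite mulrDl mul1r lerD.
Qed.

Lemma integrable_gauss_sqrt : mu.-integrable setT (fun t => (expR (- (t ^+ 2 / 2)))%:E).
Proof.
have h := @integrable_normal_pdf R 0 1.
have p0 : normal_peak (1 : R) != 0.
  by rewrite invr_eq0 sqrtr_eq0 -ltNge expr1n mul1r pmulrn_rgt0 // pi_gt0.
have := integrableZl measurableT ((normal_peak (1 : R))^-1) h.
apply: eq_integrable => // t _ /=.
rewrite /normal_pdf oner_eq0 -EFinM mulrA mulVf // mul1r /normal_fun subr0 expr1n.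
by congr (expR _)%:E; rewrite mulNr.
Qed.

Lemma integrable_expX_gauss n : mu.-integrable setT (fun t => (t ^+ n * gauss t)%:E).
Proof.
apply: (le_integrable measurableT) (integrableZl measurableT (1 + 2 ^+ n * n`!%:R) integrable_gauss_sqrt).
- apply/measurable_EFinP; apply: measurable_funM; first exact: exprn_measurable.
  exact: measurable_gauss_fun.
- move=> t _ /=; rewrite lee_fin (le_trans (expX_gauss_le n t)) //.
  exact: ler_norm.
Qed.

Lemma integrable_poly_gauss p : mu.-integrable setT (EFin \o (fun t => p.[t] * gauss t)).
Proof.
suff h n : mu.-integrable setT (EFin \o (fun t => t ^+ n * p.[t] * gauss t)).
  by apply: eq_integrable (h 0%N) => // t _ /=; rewrite expr0 mul1r.
elim/poly_ind: p n => [|p c IH] n.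
  apply: eq_integrable (integrable0 mu setT) => // t _ /=.
  by rewrite horner0 mulr0 mul0r.
have := integrableD measurableT (IH n.+1) (integrableZl measurableT c (integrable_expX_gauss n)).
apply: eq_integrable => // t _ /=; rewrite -EFinM -EFinD; congr EFin.
by rewrite hornerMXaddC exprS; ring.
Qed.

Lemma gauss_pairingD p q : gauss_pairing (p + q) = gauss_pairing p + gauss_pairing q.
Proof.
rewrite /gauss_pairing -RintegralD //; try exact: integrable_poly_gauss.
by apply: eq_Rintegral => t _; rewrite hornerD mulrDl.
Qed.

Lemma gauss_pairingZ (c : R) p : gauss_pairing (c *: p) = c * gauss_pairing p.
Proof.
rewrite /gauss_pairing -RintegralZl //; last exact: integrable_poly_gauss.
by apply: eq_Rintegral => t _; rewrite hornerZ mulrA.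
Qed.

Lemma gauss_pairing0 : gauss_pairing 0 = 0.
Proof. by rewrite -(scale0r (0 : {poly R})) gauss_pairingZ mul0r. Qed.

Lemma gauss_pairingB p q : gauss_pairing (p - q) = gauss_pairing p - gauss_pairing q.
Proof. by rewrite gauss_pairingD -scaleN1r gauss_pairingZ mulN1r. Qed.

Lemma gauss_pairing_sum (I : finType) (f : I -> {poly R}) :
  gauss_pairing (\sum_i f i) = \sum_i gauss_pairing (f i).
Proof.
by apply: (big_morph _ gauss_pairingD gauss_pairing0).
Qed.

Lemma gauss_pairing1 : gauss_pairing 1 = Num.sqrt pi.
Proof.
rewrite /gauss_pairing /Rintegral.
under eq_integral do rewrite hornerC mul1r.
by rewrite integralT_gauss.
Qed.

(** Stated for |b n| = n so as to cover both endpoints of [[- n, n]]. *)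
Lemma poly_gauss_cvg0 p (b : nat -> R) : (forall n, `|b n| = n%:R) ->
  p.[b n] * gauss (b n) @[n --> \oo] --> 0.
Proof.
move=> hb.
have X0 k : b n ^+ k * gauss (b n) @[n --> \oo] --> 0.
  apply: norm_cvg0.
  have h0 : (k.+1)`!%:R * n%:R^-1 @[n --> \oo] --> (0 : R).
    rewrite -(mulr0 (k.+1)`!%:R); apply: cvgM; first exact: cvg_cst.
    apply/gtr0_cvgV0; last exact: cvgr_idn.
    by apply: filterS (nbhs_infty_gt 0) => n n0; rewrite ltr0n.
  apply: (@squeeze_cvgr _ _ _ _ (cst 0) _ _ _ _ _ h0); last exact: cvg_cst.
  apply: filterS (nbhs_infty_ge 1) => n n1; rewrite normr_ge0 /=.
  rewrite normrM (ger0_norm (gauss_fun_ge0 _)) normrX -(hb n).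
  by apply: norm_expX_gauss; rewrite hb ler1n.
suff h k : b n ^+ k * p.[b n] * gauss (b n) @[n --> \oo] --> 0.
  by have := h 0%N; under eq_fun do rewrite expr0 mul1r.
elim/poly_ind: p k => [|p c IH] k.
  by under eq_fun do rewrite horner0 mulr0 mul0r; exact: cvg_cst.
have h : b n ^+ k.+1 * p.[b n] * gauss (b n) + c * (b n ^+ k * gauss (b n)) @[n --> \oo] --> 0 + c * 0.
  by apply: cvgD; [exact: IH|apply: cvgM; [exact: cvg_cst|exact: X0]].
rewrite mulr0 addr0 in h; apply: cvg_trans h; apply: near_eq_cvg; apply: nearW => n.
by rewrite hornerMXaddC exprS; ring.
Qed.

Lemma integrable_rint_cvg (h : R -> R) : mu.-integrable setT (EFin \o h) ->
  rint (- n%:R) n%:R h @[n --> \oo] --> \int[mu]_x h x.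
Proof.
move=> hi; have mh : measurable_fun setT (EFin \o h) by exact: measurable_int hi.
apply: fine_cvg.
rewrite fineK; last exact: integral_fune_fin_num.
rewrite (_ : (fun n => _) = fun n : nat =>
  (\int[mu]_x ((EFin \o h) \_ (`[(- n%:R)%R, (n%:R)%R]%classic)) x)%E); last first.
  by apply/funext => n; rewrite -integral_mkcond.
apply: (@dominated_cvg _ _ _ mu setT measurableT _ _ (fun x => `|(h x)%:E|%E)) => //.
- move=> n; apply/(measurable_restrictT _ _).1 => //.
  exact: measurable_funS mh.
- move=> t _; apply: cvg_near_cst.
  near=> n; rewrite patchE; case: ifPn => //; rewrite notin_setE /= in_itv /= => ht.
  exfalso; apply: ht; rewrite -ler_norml.
  by near: n; exact: nbhs_infty_ger.
- exact: integrable_abse.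
- move=> n t _; rewrite patchE; case: ifPn => //.
  by rewrite abse0 abse_ge0.
Unshelve. all: by end_near. Qed.

(** The integrand is the derivative of p(x) e^(-x^2), which vanishes at both infinities. This makes
    the raising operator 2 x - d/dx adjoint to d/dx. *)
Lemma gauss_pairing_deriv p : gauss_pairing (p^`() - 2 *: 'X * p) = 0.
Proof.
pose F (t : R) := p.[t] * gauss t.
have dg (t : R) : is_derive t 1 gauss (- (2 * t) * gauss t).
  rewrite (_ : gauss = expR \o (fun t => - t ^+ 2)) //.
  have d2 : is_derive t 1 (fun t => - t ^+ 2) (- (2 * t)).
    apply: (is_derive_eq (is_deriveN (is_deriveX 2 (is_derive_id t (1 : R))))).
    by rewrite /GRing.scale /= expr1 mulr1.
  apply: (is_derive_eq (is_derive1_comp (is_derive_expR _) d2)).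
  by rewrite mulrC.
have dF (t : R) : is_derive t 1 F ((p^`() - 2 *: 'X * p).[t] * gauss t).
  apply: (is_derive_eq (is_deriveM (is_derive_poly p t) (dg t))).
  by rewrite /GRing.scale /= hornerD hornerN hornerM hornerZ hornerX; ring.
have cF : continuous F by move=> t; exact: is_derive_continuous_at (dF t).
have h1 := integrable_rint_cvg (integrable_poly_gauss (p^`() - 2 *: 'X * p)).
have h2 : rint (- n%:R) n%:R (fun t => (p^`() - 2 *: 'X * p).[t] * gauss t) @[n --> \oo] --> 0.
  have h3 : F n%:R - F (- n%:R) @[n --> \oo] --> 0 - 0.
    apply: cvgB; apply: poly_gauss_cvg0 => n; rewrite ?normrN ger0_norm //.
  rewrite subr0 in h3; apply: cvg_trans h3; apply: near_eq_cvg; apply: nearW => n.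
  apply/esym/rint_ftc => //.
  - by have := ler0n R n; lra.
  - apply: continuous_subspaceT => t.
    by apply: cvgM; [exact: continuous_horner|exact: continuous_gauss_fun].
  - exact: continuous_subspaceT.
exact: cvg_unique h1 h2.
Qed.

Lemma gauss_pairing_hermiteS p m :
  gauss_pairing (p * hermite m.+1) = gauss_pairing (p^`() * hermite m).
Proof.
have -> : p * hermite m.+1 = p^`() * hermite m -
    ((p * hermite m)^`() - 2 *: 'X * (p * hermite m)).
  by rewrite derivM /=; ring.
by rewrite gauss_pairingB gauss_pairing_deriv subr0.
Qed.

Definition hermite_norm2 j : R := 2 ^+ j * j`!%:R * Num.sqrt pi.

Lemma hermite_norm2S j : hermite_norm2 j.+1 = 2 * j.+1%:R * hermite_norm2 j.
Proof. by rewrite /hermite_norm2 factS natrM exprS; ring. Qed.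

Lemma hermite_norm2_gt0 j : 0 < hermite_norm2 j.
Proof.
by rewrite /hermite_norm2 !mulr_gt0 ?exprn_gt0 ?ltr0n ?fact_gt0 // sqrtr_gt0 pi_gt0.
Qed.

(** Adjointness moves one raising step of H_j onto H_i as a derivative, which lowers both indices by
    one, down to the Gaussian integral. *)
Lemma hermite_orthogonal i j :
  gauss_pairing (hermite i * hermite j) = (i == j)%:R * hermite_norm2 j.
Proof.
elim: j i => [|j IH] i.
  case: i => [|i].
    by rewrite /= mulr1 gauss_pairing1 /hermite_norm2 fact0 expr0 !mul1r.
  by rewrite mulrC gauss_pairing_hermiteS derivC mul0r gauss_pairing0 mul0r.
rewrite gauss_pairing_hermiteS; case: i => [|i].
  by rewrite derivC mul0r gauss_pairing0 mul0r.
rewrite deriv_hermite -scalerAl gauss_pairingZ IH eqSS hermite_norm2S.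
by case: eqP => [->|_]; rewrite ?mul1r // !mul0r mulr0.
Qed.

Lemma hermite_expansion n p : (size p <= n)%N ->
  exists u : nat -> R, p = \sum_(j < n) u j *: hermite j.
Proof.
elim: n p => [|n IH] p hp.
  by exists (fun=> 0); rewrite big_ord0; apply/eqP; rewrite -size_poly_leq0.
have [_ lc] := hermite_size_lead (R := R) n; have sh := size_hermite (R := R) n.
pose q := p - (p`_n / 2 ^+ n) *: hermite n.
have hq : (size q <= n)%N.
  apply/leq_sizeP => k; rewrite leq_eqVlt => /predU1P[<-|nk].
    rewrite coefB coefZ -lc /lead_coef sh /= divfK ?subrr //.
    by rewrite -[(hermite n)`_n]/((hermite n)`_(n.+1.-1)) -sh -/(lead_coef _) lc
      expf_neq0 // pnatr_eq0.
  rewrite coefB coefZ (nth_default _ (leq_trans hp nk)) (nth_default _ (_ : size (hermite n) <= k)%N).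
    by rewrite mulr0 subr0.
  by rewrite sh.
have [u hu] := IH q hq.
exists (fun j => if j == n then p`_n / 2 ^+ n else u j).
rewrite big_ord_recr /= eqxx -[LHS](subrK ((p`_n / 2 ^+ n) *: hermite n)) -/q hu.
by congr (_ + _); apply: eq_bigr => j _; rewrite ltn_eqF.
Qed.

End GaussianFunctional.

(** * The Christoffel-Darboux kernel *)

Section KernelSide.
Context {R : realType}.
Implicit Types (x y : R).
Local Notation mu := (@lebesgue_measure R).
Local Notation gauss := (@gauss_fun R).

(* The transition matrix [u] between two families of the same finite size is
   square, so its one-sided inverse is two-sided. *)
Lemma orthonormal_completeness (I : finType) (u : I -> I -> R) (g : I -> R) :
  (forall k, g k != 0) ->
  (forall i j, \sum_k u i k * g k * u j k = (i == j)%:R) ->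
  forall k l, \sum_i u i k * u i l = (k == l)%:R / g k.
Proof.
move=> g0 hu k l.
pose U : 'M[R]_#|I| := \matrix_(i, j) u (enum_val i) (enum_val j).
pose V : 'M[R]_#|I| := \matrix_(i, j) (g (enum_val i) * u (enum_val j) (enum_val i)).
have UV : U *m V = 1%:M.
  apply/matrixP => i j; rewrite !mxE -(inj_eq enum_val_inj) -hu.
  rewrite [RHS](reindex (@enum_val I predT)); last by apply: onW_bij; exact: enum_val_bij.
  by apply: eq_bigr => m _; rewrite !mxE mulrA.
have := mulmx1C UV => /matrixP /(_ (enum_rank k) (enum_rank l)).
rewrite !mxE (inj_eq enum_rank_inj) => <-.
rewrite mulr_suml [LHS](reindex (@enum_val I predT)); last by apply: onW_bij; exact: enum_val_bij.
by apply: eq_bigr => m _; rewrite !mxE !enum_rankK mulrC; field; exact: g0.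
Qed.

Context (nu : R) (P : nat -> {poly 'M[R]_2}).
Context (hP : orthonormal_mxpolys (hermite_weight nu) P).

Lemma expmx_mxA x : expmx (x *: mxA nu) = mx2 1 (nu * x) 0 1.
Proof.
rewrite expmx_nilpotent /mxA.
  by rewrite scale_mx2 -[1]/(1%:M) one_mx2 add_mx2 !mulr0 !addr0 add0r mulrC.
by rewrite scale_mx2 mulmx2 !mulr0 !mul0r !addr0; apply: eq_mx2; rewrite !mx2E mxE.
Qed.

Lemma expmx_mxA_tr x : expmx (x *: (mxA nu)^T) = (expmx (x *: mxA nu))^T.
Proof.
have tr (a b c d : R) : (mx2 a b c d)^T = mx2 a c b d.
  by apply: eq_mx2; rewrite mxE !mx2E.
rewrite expmx_mxA /mxA !tr expmx_nilpotent.
  by rewrite scale_mx2 -[1]/(1%:M) one_mx2 add_mx2 !mulr0 !addr0 add0r mulrC.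
by rewrite scale_mx2 mulmx2 !mulr0 !mul0r !addr0; apply: eq_mx2; rewrite !mx2E mxE.
Qed.

Definition entry_poly (p : {poly 'M[R]_2}) (a b : 'I_2) : {poly R} :=
  \poly_(i < size p) (p`_i a b).

Lemma entry_polyE p a b x : mxpoly_eval p x a b = (entry_poly p a b).[x].
Proof.
rewrite /mxpoly_eval horner_coef summxE horner_poly; apply: eq_bigr => i _.
have -> : (x%:M : 'M[R]_2) ^+ i = (x ^+ i)%:M.
  elim: (i : nat) => [|m IH]; first by rewrite !expr0.
  by rewrite !exprS IH -[LHS]/(x%:M *m (x ^+ m)%:M) -scalar_mxM.
by rewrite -[p`_i * _]/(p`_i *m _) mul_mx_scalar mxE mulrC.
Qed.

(** A row (p, q) of P_k multiplied by e^(A x) becomes (p, nu x p + q), again polynomial. The matrix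
    weight is thereby reduced to the scalar weight e^(-x^2). *)
Definition row_poly (k : nat) (a b : 'I_2) : {poly R} :=
  if b == 0 then entry_poly (P k) a 0
  else nu *: 'X * entry_poly (P k) a 0 + entry_poly (P k) a 1.

Lemma row_polyE k x a b :
  (mxpoly_eval (P k) x *m expmx (x *: mxA nu)) a b = (row_poly k a b).[x].
Proof.
rewrite expmx_mxA [mxpoly_eval _ _]mx2P mulmx2 /row_poly !entry_polyE.
move: a b; apply: forall_ord2; rewrite mx2E /=.
- by rewrite mulr1 mulr0 addr0.
- by rewrite hornerD hornerM hornerZ hornerX; ring.
- by rewrite mulr1 mulr0 addr0.
- by rewrite hornerD hornerM hornerZ hornerX; ring.
Qed.

Lemma hermite_funE k x a b : hermite_fun nu P k x a b =
  expR (- x ^+ 2 / 2) * (row_poly k a b).[x].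
Proof. by rewrite /hermite_fun mxE row_polyE. Qed.

Lemma row_poly_orthonormal k m a b :
  \sum_c gauss_pairing (row_poly k a c * row_poly m b c) = ((k == m) && (a == b))%:R.
Proof.
have [_ /(_ k m) /matrixP /(_ a b)] := hP.
rewrite !mxE => h; rewrite -gauss_pairing_sum.
have -> : ((k == m) && (a == b))%:R = (k == m)%:R *+ (a == b) :> R.
  by case: (k == m); case: (a == b).
rewrite -h; apply: eq_Rintegral => x _.
rewrite /hermite_weight.
set F := mxpoly_eval (P k) x; set G := mxpoly_eval (P m) x; set E := expmx (x *: mxA nu).
have -> : F *m (expR (- x ^+ 2) *: (E *m expmx (x *: (mxA nu)^T))) *m G^T =
    expR (- x ^+ 2) *: ((F *m E) *m (G *m E)^T).
  by rewrite trmx_mul expmx_mxA_tr -scalemxAr -scalemxAl !mulmxA.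
rewrite [RHS]mxE horner_sum mulrC; congr (_ * _); rewrite [RHS]mxE.
by apply: eq_bigr => c _; rewrite hornerM -!row_polyE [X in _ = _ * X]mxE.
Qed.

Context (n : nat).
Local Notation D := (1 + n%:R / 2 * nu ^+ 2).
Local Notation I := ('I_n * 'I_2)%type.

(* An orthogonal basis of the rows (p, nu x p + q) with deg p, deg q < n.  For
   p = H_j the entry nu x H_j is cancelled by q, except when j = n - 1: then the
   top term nu / 2 H_n of nu x H_(n-1) cannot be reached by q and remains. *)
Definition basis_poly (k : I) (c : 'I_2) : {poly R} :=
  if k.2 == 0 then
    if c == 0 then hermite k.1 else (k.1.+1 == n :> nat)%:R * (nu / 2) *: hermite n
  else if c == 0 then 0 else hermite k.1.

(** The exceptional row (H_(n-1), nu/2 H_n) has squared norm |H_(n-1)|^2 + nu^2/4 |H_n|^2. As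
    |H_n|^2 = 2 n |H_(n-1)|^2, this is |H_(n-1)|^2 (1 + n nu^2 / 2): here det B enters. *)
Definition basis_norm2 (k : I) : R :=
  if (k.2 == 0) && (k.1.+1 == n :> nat) then hermite_norm2 k.1 * D
  else hermite_norm2 k.1.

Lemma basis_norm2_gt0 k : 0 < basis_norm2 k.
Proof.
rewrite /basis_norm2; case: ifP => _; last exact: hermite_norm2_gt0.
by apply: mulr_gt0; [exact: hermite_norm2_gt0|exact: (mxB_det_gt0 nu n)].
Qed.

Lemma sum_ord2 (f : 'I_2 -> R) : \sum_c f c = f 0 + f 1.
Proof.
rewrite !big_ord_recl big_ord0 addr0; congr (f _ + f _); exact: val_inj.
Qed.

Lemma gauss_pairingZl (e : R) p q : gauss_pairing (e *: p * q) = e * gauss_pairing (p * q).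
Proof. by rewrite -scalerAl gauss_pairingZ. Qed.

Lemma gauss_pairingZr (e : R) p q : gauss_pairing (p * (e *: q)) = e * gauss_pairing (p * q).
Proof. by rewrite -scalerAr gauss_pairingZ. Qed.

(** The only second entry beside the H_j with j < n is a multiple of H_n, which is orthogonal to all
    of them. *)
Lemma basis_orthogonal (k l : I) :
  \sum_c gauss_pairing (basis_poly k c * basis_poly l c) = (k == l)%:R * basis_norm2 k.
Proof.
have o01 : (1 == 0 :> 'I_2) = false by [].
have ne (j : 'I_n) : (n == j :> nat) = false by rewrite gtn_eqF.
have ne' (j : 'I_n) : (j == n :> nat) = false by rewrite ltn_eqF.
have case2 (c : 'I_2) : c = 0 \/ c = 1.
  by case: c => [[|[|c]] hc] //; [left|right]; exact: val_inj.
rewrite sum_ord2; case: k => k a; case: l => l b; rewrite /basis_poly /basis_norm2 xpair_eqE /=.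
case: (case2 a) => ->; case: (case2 b) => ->; rewrite ?eqxx ?o01 /=.
- rewrite hermite_orthogonal gauss_pairingZl gauss_pairingZr hermite_orthogonal eqxx mul1r.
  rewrite andbT -val_eqE /=; have [kn|kn] := eqVneq k.+1 n.
    have hn : hermite_norm2 n = 2 * n%:R * hermite_norm2 k :> R.
      by rewrite -[in LHS]kn hermite_norm2S kn.
    have [ln|ln] := eqVneq l.+1 n.
      have kl : (k : nat) = l by apply: succn_inj; rewrite kn ln.
      by rewrite -kl eqxx !mul1r hn; field.
    have -> : (k == l :> nat) = false by apply/eqP => kl; case/eqP: ln; rewrite -kl.
    by rewrite !mul0r mulr0 addr0.
  rewrite !mul0r addr0.
  by have [->|_] := eqVneq (k : nat) l; rewrite ?mul1r ?mul0r.
- rewrite mulr0 gauss_pairing0 add0r gauss_pairingZl hermite_orthogonal ne.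
  by rewrite mul0r mulr0 andbF mul0r.
- rewrite mul0r gauss_pairing0 add0r gauss_pairingZr hermite_orthogonal ne'.
  by rewrite mul0r mulr0 andbF mul0r.
- rewrite mul0r gauss_pairing0 add0r hermite_orthogonal andbT -val_eqE /=.
  by have [->|_] := eqVneq (k : nat) l; rewrite ?mul1r ?mul0r.
Qed.

Lemma row_poly_expansion k a : (k < n)%N ->
  exists u : I -> R, forall c, row_poly k a c = \sum_l u l *: basis_poly l c.
Proof.
move=> kn; have [szP _] := hP.
have sz b : (size (entry_poly (P k) a b) <= n)%N.
  by apply: leq_trans (size_poly _ _) _; rewrite szP.
have [u hu] := hermite_expansion (sz 0).
have [m nm] : exists m, n = m.+1.
  by exists n.-1; rewrite prednK //; exact: leq_ltn_trans kn.
(* Since x H_m = (H_(m+1) + H_m') / 2 with m = n - 1, the only part of degree n in nu x p is the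
   multiple u_m nu / 2 of H_n. The exceptional row supplies it, and the rest expands in the H_j with
   j < n. *)
pose q := nu *: 'X * entry_poly (P k) a 0 + entry_poly (P k) a 1 - (u m * (nu / 2)) *: hermite n.
have szq : (size q <= n)%N.
  have XH : 'X * hermite m = 2^-1 *: hermite n + 2^-1 *: (hermite m)^`() :> {poly R}.
    have p2 : (2 : R) != 0 by rewrite pnatr_eq0.
    have hS : hermite m.+1 = 2 *: 'X * hermite m - (hermite m)^`() :> {poly R} by [].
    by rewrite nm hS -scalerDr subrK -scalerAl scalerA mulVf // scale1r.
  have -> : q = nu *: ('X * \sum_(j < m) u j *: hermite j) +
      (nu * u m / 2) *: (hermite m)^`() + entry_poly (P k) a 1.
    have hs : \sum_(j < n) u j *: hermite j =
        \sum_(j < m) u j *: hermite j + u m *: hermite m :> {poly R}.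
      by rewrite nm big_ord_recr.
    rewrite /q hu hs -scalerAl mulrDr -scalerAr XH.
    rewrite -!mul_polyC !polyCM; ring.
  apply: (leq_trans (size_polyD _ _)); rewrite geq_max sz andbT.
  apply: (leq_trans (size_polyD _ _)); rewrite geq_max; apply/andP; split.
    apply: (leq_trans (size_scale_leq _ _)).
    apply: (leq_trans (size_polyMleq _ _)); rewrite size_polyX /= nm ltnS.
    apply: (leq_trans (size_sum _ _ _)); apply/bigmax_leqP => j _.
    by apply: (leq_trans (size_scale_leq _ _)); rewrite size_hermite.
  apply: (leq_trans (size_scale_leq _ _)); apply: (leq_trans (size_poly _ _)).
  by rewrite size_hermite nm.
have [v hv] := hermite_expansion szq.
exists (fun l : I => if l.2 == 0 then u l.1 else v l.1) => c.
rewrite -(pair_bigA _ (fun (j : 'I_n) (s : 'I_2) => (if s == 0 then u j else v j) *: basis_poly (j, s) c)) /=.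
have o01 : (1 == 0 :> 'I_2) = false by [].
have sum2 (f : 'I_2 -> {poly R}) : \sum_s f s = f 0 + f 1.
  by rewrite !big_ord_recl big_ord0 addr0; congr (f _ + f _); exact: val_inj.
under eq_bigr => j _ do rewrite sum2 /basis_poly /=.
rewrite big_split /= /row_poly; case: (eqVneq c 0) => _.
  by rewrite [X in _ + X]big1 ?addr0 // => j _; rewrite scaler0.
have -> : \sum_(j < n) u j *: (((j.+1 == n)%:R * (nu / 2)) *: hermite n) = (u m * (nu / 2)) *: hermite n.
  have hs (F : nat -> {poly R}) : \sum_(j < n) F j = \sum_(j < m) F j + F m.
    by rewrite nm big_ord_recr.
  have mn : m.+1 == n by rewrite nm.
  have jn (j : 'I_m) : (j.+1 == n) = false by rewrite nm eqSS ltn_eqF.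
  rewrite (hs (fun j => u j *: (((j.+1 == n)%:R * (nu / 2)) *: hermite n))) mn mul1r.
  by rewrite big1 ?add0r ?scalerA // => j _; rewrite jn mul0r scale0r scaler0.
by rewrite -hv /q addrC subrK.
Qed.

(** Orthonormality of the rows reads u G u^T = 1, with G the diagonal matrix of basis norms;
    completeness turns it into u^T u = G^(-1). *)
Lemma row_coordinates : exists u : I -> I -> R,
  (forall (i : I) c, row_poly i.1 i.2 c = \sum_l u i l *: basis_poly l c) /\
  (forall k l, \sum_i u i k * u i l = (k == l)%:R / basis_norm2 k).
Proof.
have /choice[u hu] : forall i : I, exists u : I -> R,
    forall c, row_poly i.1 i.2 c = \sum_l u l *: basis_poly l c.
  by move=> [i a]; exact: row_poly_expansion.
exists u; split=> //; apply: orthonormal_completeness.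
  by move=> k; rewrite gt_eqF // basis_norm2_gt0.
move=> i j.
have <- : \sum_c gauss_pairing (row_poly i.1 i.2 c * row_poly j.1 j.2 c) = (i == j)%:R.
  by rewrite row_poly_orthonormal; case: i j => [i a] [j b]; rewrite xpair_eqE.
transitivity (\sum_c \sum_l \sum_m (u i l * u j m) *
    gauss_pairing (basis_poly l c * basis_poly m c)); last first.
  apply: eq_bigr => c _; rewrite !hu big_distrlr gauss_pairing_sum.
  apply: eq_bigr => l _; rewrite gauss_pairing_sum; apply: eq_bigr => m _.
  by rewrite gauss_pairingZl gauss_pairingZr mulrA.
rewrite exchange_big; apply: eq_bigr => l _; rewrite exchange_big /=.
under eq_bigr => m _ do rewrite -mulr_sumr basis_orthogonal.
rewrite (bigD1 l) //= eqxx big1 ?addr0; first by rewrite mul1r mulrAC.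
by move=> m ml; rewrite eq_sym (negbTE ml) mul0r mulr0.
Qed.

(** A reproducing kernel can be computed in any orthogonal basis, so the given sequence [P]
    disappears from the right-hand side. *)
Lemma CD_kernel_basis x y a b : CD_kernel nu P n x y a b =
  expR (- (x ^+ 2 + y ^+ 2) / 2) *
  \sum_l (basis_poly l a).[y] * (basis_poly l b).[x] / basis_norm2 l.
Proof.
have [u [hu huu]] := row_coordinates.
have rowE (i : I) c z : (row_poly i.1 i.2 c).[z] = \sum_l u i l * (basis_poly l c).[z].
  by rewrite hu horner_sum; apply: eq_bigr => l _; rewrite hornerZ.
have -> : \sum_l (basis_poly l a).[y] * (basis_poly l b).[x] / basis_norm2 l =
    \sum_(i : I) (row_poly i.1 i.2 a).[y] * (row_poly i.1 i.2 b).[x].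
  under [RHS]eq_bigr => i _ do rewrite !rowE big_distrlr /=.
  rewrite exchange_big; apply: eq_bigr => l _; rewrite exchange_big /=.
  under [RHS]eq_bigr => m _.
    under eq_bigr => i _ do rewrite mulrACA mulrC.
    rewrite -mulr_sumr huu; over.
  rewrite (bigD1 l) //= eqxx big1 ?addr0; first by rewrite mul1r.
  by move=> m ml; rewrite eq_sym (negbTE ml) mul0r mulr0.
rewrite /CD_kernel summxE mulr_sumr.
rewrite -(pair_bigA _ (fun (i : 'I_n) (c : 'I_2) => expR (- (x ^+ 2 + y ^+ 2) / 2) *
  ((row_poly i c a).[y] * (row_poly i c b).[x]))) /=.
apply: eq_bigr => k _; rewrite mxE; apply: eq_bigr => c _; rewrite mxE !hermite_funE.
by rewrite mulrACA -expRD; congr (expR _ * _); field.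
Qed.

(** Write t_j for the j-th kernel term, S_k for the sum of the first k, and D = 1 + nu c with c = n
    nu / 2. The first diagonal entry is S_(n-1) + t_(n-1) / D = (S_n + nu c S_(n-1)) / D, the second
    S_n + nu c t_n / D = (S_n + nu c S_(n+1)) / D. Off the diagonal only the exceptional row
    contributes. *)
Lemma CD_kernel_entries x y : CD_kernel nu P n x y =
  (expR (- (x ^+ 2 + y ^+ 2) / 2) / Num.sqrt pi) *: kernel_entries nu x y n.
Proof.
have p0 : Num.sqrt pi != 0 :> R by rewrite gt_eqF // sqrtr_gt0 pi_gt0.
have D0 : D != 0 by rewrite gt_eqF // (mxB_det_gt0 nu n).
have N0 j : hermite_norm2 j != 0 :> R by rewrite gt_eqF // hermite_norm2_gt0.
have o01 : (1 == 0 :> 'I_2) = false by [].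
pose t j : R := (hermite j).[y] * (hermite j).[x] / hermite_norm2 j.
have f0 j : j`!%:R != 0 :> R by rewrite pnatr_eq0 -lt0n fact_gt0.
have w0 j : 2 ^+ j != 0 :> R by rewrite expf_neq0 // pnatr_eq0.
have tE j : hankel_coef y j.+1 * ((hermite j).[x] / 2 ^+ j) = Num.sqrt pi * t j.
  rewrite /t /hermite_norm2 /hankel_coef.
  by move: (f0 j) (w0 j) => f1 w1; field; rewrite p0 f1 w1.
have ksE k : kernel_sum x y k = Num.sqrt pi * \sum_(j < k) t j.
  by rewrite /kernel_sum mulr_sumr; apply: eq_bigr => j _; rewrite tE.
have key a b : \sum_l (basis_poly l a).[y] * (basis_poly l b).[x] / basis_norm2 l =
    kernel_entries nu x y n a b / Num.sqrt pi.
  rewrite -(pair_bigA _ (fun (j : 'I_n) (s : 'I_2) => (basis_poly (j, s) a).[y] * (basis_poly (j, s) b).[x] /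
     basis_norm2 (j, s))) /=.
  under eq_bigr => j _ do rewrite sum_ord2 /basis_poly /basis_norm2 /=.
  have [n0|n_gt0] := posnP n.
    rewrite big1; last by move=> [j hj]; exfalso; rewrite n0 in hj.
    move: a b; apply: forall_ord2; rewrite mx2E n0 ?ksE ?big_ord0 /=; ring.
  have [m nm] : exists m, n = m.+1 by exists n.-1; rewrite prednK.
  have hsum (F : nat -> R) : \sum_(j < n) F j = \sum_(j < m) F j + F m.
    by rewrite nm big_ord_recr.
  have jn (j : 'I_m) : (j.+1 == n) = false by rewrite nm eqSS ltn_eqF.
  have mn : m.+1 == n by rewrite nm.
  have hN : hermite_norm2 n = 2 * n%:R * hermite_norm2 m :> R.
    by rewrite [in LHS]nm hermite_norm2S -nm.
  have n0 : n%:R != 0 :> R by rewrite pnatr_eq0 -lt0n.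
  have r0 : 2 + n%:R * (nu * nu) != 0.
    rewrite gt_eqF //; have : 0 <= n%:R * (nu * nu) by rewrite mulr_ge0 ?ler0n // -expr2 sqr_ge0.
    by lra.
  (* [g] and [e] are indexed by plain numbers, so that the top index m = n - 1, the only exceptional
     one, can be split off the sums. *)
  pose g j : R := if j.+1 == n then hermite_norm2 j * D else hermite_norm2 j.
  pose e j z : R := (j.+1 == n)%:R * (nu / 2) * (hermite n).[z].
  have gm : g m = hermite_norm2 m * D by rewrite /g mn.
  have em z : e m z = nu / 2 * (hermite n).[z] by rewrite /e mn mul1r.
  have e0 (j : 'I_m) z : e j z = 0 by rewrite /e jn mul0r mul0r.
  have g0 (j : 'I_m) : g j = hermite_norm2 j by rewrite /g jn.
  have tn : \sum_(j < n) t j = \sum_(j < m) t j + t m by exact: hsum.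
  have n1 : n.-1 = m by rewrite nm.
  have An : hankel_coef y n = (hermite m).[y] / m`!%:R by rewrite nm.
  have nf : n`!%:R = n%:R * m`!%:R :> R by rewrite [in LHS]nm factS -nm natrM.
  have Xn : 2 ^+ n = 2 * 2 ^+ m :> R by rewrite [in LHS]nm exprS.
  have Nm : hermite_norm2 m = 2 ^+ m * m`!%:R * Num.sqrt pi :> R by [].
  move: a b; apply: forall_ord2; rewrite mx2E /=.
  - rewrite (eq_bigr (fun j : 'I_n => (hermite j).[y] * (hermite j).[x] / g j)); last first.
      by move=> j _; rewrite horner0 !mul0r addr0.
    rewrite (hsum (fun j => (hermite j).[y] * (hermite j).[x] / g j)) gm.
    rewrite (eq_bigr (fun j : 'I_m => t j)); last by move=> j _; rewrite g0.
    rewrite !ksE tn n1 /t; move: (\sum_(j < m) _) (N0 m) => S N1; field.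
    by rewrite p0 N1 r0.
  - rewrite (eq_bigr (fun j : 'I_n => (hermite j).[y] * e j x / g j)); last first.
      by move=> j _; rewrite horner0 !mul0r addr0 hornerZ.
    rewrite (hsum (fun j => (hermite j).[y] * e j x / g j)) gm em.
    rewrite big1; last by move=> j _; rewrite e0 mulr0 mul0r.
    rewrite An Xn Nm; move: (f0 m) (w0 m) => f1 w1; field.
    by rewrite p0 f1 w1 r0.
  - rewrite (eq_bigr (fun j : 'I_n => e j y * (hermite j).[x] / g j)); last first.
      by move=> j _; rewrite horner0 mulr0 !mul0r addr0 hornerZ.
    rewrite (hsum (fun j => e j y * (hermite j).[x] / g j)) gm em.
    rewrite big1; last by move=> j _; rewrite e0 !mul0r.
    rewrite nf n1 Nm; move: (f0 m) (w0 m) => f1 w1; field.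
    by rewrite p0 f1 w1 r0 n0.
  - rewrite (eq_bigr (fun j : 'I_n => e j y * e j x / g j + t j)); last first.
      by move=> j _; rewrite !hornerZ.
    rewrite (hsum (fun j => e j y * e j x / g j + t j)) gm !em.
    rewrite (eq_bigr (fun j : 'I_m => t j)); last first.
      by move=> j _; rewrite e0 !mul0r add0r.
    rewrite !ksE [\sum_(j < n.+1) _]big_ord_recr /= tn [t n]/t hN.
    move: (\sum_(j < m) _) (t m) (N0 m) => S T N1; field.
    by rewrite p0 N1 r0 n0.
apply/matrixP => a b; rewrite CD_kernel_basis key [RHS]mxE.
by field.
Qed.

End KernelSide.

Theorem proposition2p1 (R : realType) (nu : R) (P : nat -> {poly 'M[R]_2})
    (hP : orthonormal_mxpolys (hermite_weight nu) P)
    (L : R) (hL : 0 < L) (gamma : R -> R[i]) (hgamma : hankel_contour gamma)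
    (hgammaL : forall t : R, Re (gamma t) < L)
    (n : nat) (x y : R) :
  [/\ \det (mxB n nu) = 1 + n%:R / 2 * nu ^+ 2,
      forall t : R, contour_cvgmx gamma
        (CD_integrand n nu x y (vertical_line L t)),
      contour_cvgmx (vertical_line L)
        (fun w => contour_intmx gamma (CD_integrand n nu x y w))
    & map_mx (real_complex R) (CD_kernel nu P n x y) =
      (2 / (2 * pi%:C * 'i%C) ^+ 2 * cexp (((x ^+ 2 - y ^+ 2) / 2)%:C)) *:
      contour_intmx (vertical_line L)
        (fun w => contour_intmx gamma (CD_integrand n nu x y w))].
Proof.
split; [exact: det_mxB| | |].
- move=> t i j.
  have Lt : Re (vertical_line L t) = L by [].
  by have [] := contour_inner nu x y n hgamma hL hgammaL i j Lt.
- by move=> i j; have [] := contour_outer nu x y n hgamma hL hgammaL i j.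
- by rewrite (CD_kernel_entries hP) contour_side.
Qed.
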